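(* Let $(A,R,S)$ satisfy the rank condition stated in the context. The law $\eta^h_t$ of $X^h_t$ and the distribution $\eta_t$ of the non-absorbed particle are connected, for every $t\ge0$, by $$\eta^h_t=\mathbb{B}_{h_0}(\eta_t)\quad\text{and}\quad \eta_t=\mathbb{B}_{h_0^{-1}}(\eta^h_t).$$ In addition, if $\eta_0=\mathcal{N}(\widehat X_0,P_0)$, then for all $t\ge0$ $$\eta^h_t=\mathcal{N}(\widehat X^h_t,P^h_t)\quad\text{and}\quad \eta_t=\mathcal{N}(\widehat X_t,P_t),$$ where $(\widehat X_t,P_t)$ solves $$\partial_t\widehat X_t=(A-P_tS)\widehat X_t,\qquad \partial_tP_t=AP_t+P_tA'+R-P_tSP_t,$$ with initial condition $(\widehat X_0,P_0)$, and $$P^h_t=(P_t^{-1}+Q_\infty)^{-1},\qquad \widehat X^h_t=P^h_tP_t^{-1}\widehat X_t.$$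
   Context: Setting: $r\ge1$; $A,R,S$ are real $r\times r$ matrices, $R,S$ symmetric positive semi-definite; $'$ denotes transposition. Rank condition: the matrices $[R^{1/2},AR^{1/2},\ldots,A^{r-1}R^{1/2}]$ and $[S^{1/2},A'S^{1/2},\ldots,(A')^{r-1}S^{1/2}]$ both have rank $r$. Under this condition let $Q_\infty$ be the unique positive definite solution of $A'Q+QA-QRQ+S=0$. Put $h_0(x)=\exp(-\frac12x'Q_\infty x)$, $h_0^{-1}=1/h_0$, and $V(x)=\frac12x'Sx$. For a positive function $g$ and a probability measure $\eta$ with $\eta(g):=\int g\,d\eta\in(0,\infty)$, $\mathbb{B}_g(\eta)(dx):=g(x)\eta(dx)/\eta(g)$. Let $B$ be an $r\times r_1$ matrix with $BB'=R$, $W_t$ an $r_1$-dimensional Brownian motion independent of the initial states. Let $X_t$ solve $dX_t=AX_t\,dt+B\,dW_t$ with $X_0\sim\eta_0$ ($\eta_0$ a probability measure on $\mathbb{R}^r$); let $X^c_t$ evolve as $X_t$ from $X_0^c=X_0$ and be killed at rate $V(X^c_t)$, with killing time $\tau^c$. Then $\eta_t(dx):=\mathbb{P}(X^c_t\in dx\mid\tau^c>t)$, equivalently $\eta_t(f)=\mathbb{E}(f(X_t)e^{-\int_0^tV(X_s)ds})/\mathbb{E}(e^{-\int_0^tV(X_s)ds})$. The $h$-process solves $dX^h_t=(A-RQ_\infty)X^h_t\,dt+B\,dW_t$ with $X^h_0\sim\mathbb{B}_{h_0}(\eta_0)$, and $\eta_t^h$ is the law of $X^h_t$. $\mathcal{N}(m,P)$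 is the Gaussian measure with mean $m$ and positive semi-definite covariance $P$. Under the rank condition $P_t>0$ for $t>0$; if $P_0$ is singular the expressions at $t=0$ are understood through the identities $(P^{-1}+Q_\infty)^{-1}=(I+PQ_\infty)^{-1}P$ and $(P^{-1}+Q_\infty)^{-1}P^{-1}=(I+PQ_\infty)^{-1}$, valid for invertible $P$. *)

(* Defs.v *)
From HB Require Import structures.
From mathcomp Require Import all_boot all_order all_algebra.
From mathcomp Require Import all_classical all_reals all_analysis.

Set Implicit Arguments.
Unset Strict Implicit.
Unset Printing Implicit Defensive.

Import Order.TTheory GRing.Theory Num.Theory.
Import numFieldNormedType.Exports.

Local Open Scope classical_set_scope.
Local Open Scope ring_scope.

Definition qform (K : realType) (r : nat) (M : 'M[K]_r) (x : 'cV[K]_r) : K :=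
  (x^T *m M *m x) 0 0.

Definition psdmx (K : realType) (r : nat) (M : 'M[K]_r) : Prop :=
  M^T = M /\ forall x : 'cV[K]_r, 0 <= qform M x.

Definition posdefmx (K : realType) (r : nat) (M : 'M[K]_r) : Prop :=
  M^T = M /\ forall x : 'cV[K]_r, x != 0 -> 0 < qform M x.

Definition psd_sqrt (K : realType) (r : nat) (M N : 'M[K]_r) : Prop :=
  psdmx N /\ N *m N = M.

(* [M^{1/2}, A M^{1/2}, ..., A^{r-1} M^{1/2}] has rank r. The positive
   semi-definite square root N of M exists and is unique when M is positive
   semi-definite. *)
Definition full_kalman_rank (K : realType) (r : nat) (A M : 'M[K]_r) : Prop :=
  exists2 N : 'M[K]_r, psd_sqrt M N &
    \rank (\mxrow_(j < r) (A ^+ j *m N)) = r.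

Definition rank_condition (K : realType) (r : nat) (A R S : 'M[K]_r) : Prop :=
  full_kalman_rank A R /\ full_kalman_rank A^T S.

Definition riccati_eq (K : realType) (r : nat) (A R S Q : 'M[K]_r) : Prop :=
  A^T *m Q + Q *m A - Q *m R *m Q + S = 0.

Definition h0 (K : realType) (r : nat) (Q : 'M[K]_r) (x : 'cV[K]_r) : K :=
  expR (- (qform Q x / 2)).

Definition potential (K : realType) (r : nat) (S : 'M[K]_r) (x : 'cV[K]_r) : K :=
  qform S x / 2.

(* y' = F(y) on [0, +oo[, y(0) = y0; continuity at 0 and the equation on
   ]0, +oo[ give the one-sided equation at 0. *)
Definition solves_ode (K : realType) (m n : nat)
    (F : K -> 'M[K]_(m, n) -> 'M[K]_(m, n)) (y0 : 'M[K]_(m, n))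
    (y : K -> 'M[K]_(m, n)) : Prop :=
  [/\ y 0 = y0,
      {within `[0, +oo[, continuous y} &
      forall t : K, 0 < t -> is_derive t (1 : K) y (F t (y t))].

(* The else branches extend the formulas in the then branches to singular P,
   through the identities (P^-1 + Q)^-1 = (1 + P Q)^-1 P and
   (P^-1 + Q)^-1 P^-1 = (1 + P Q)^-1 valid for invertible P. *)
Definition hcov (K : realType) (r : nat) (Q P : 'M[K]_r) : 'M[K]_r :=
  if P \in unitmx then invmx (invmx P + Q) else invmx (1%:M + P *m Q) *m P.

Definition hmean (K : realType) (r : nat) (Q P : 'M[K]_r) (x : 'cV[K]_r) :
    'cV[K]_r :=
  if P \in unitmx then hcov Q P *m invmx P *m x
  else invmx (1%:M + P *m Q) *m x.

Notation borelV K r := (g_sigma_algebraType (@open 'cV[K]_r)).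

Definition same_measure (d : measure_display) (T : measurableType d)
    (K : realType) (mu nu : set T -> \bar K) : Prop :=
  forall C : set T, measurable C -> mu C = nu C.

(* The library's normal_prob takes the standard deviation, and is not the
   Dirac mass when the latter is 0. *)
Definition normal_law (K : realType) (m v : K) :
    set (measurableTypeR K) -> \bar K :=
  if v == 0 then dirac (m : measurableTypeR K) else normal_prob m (Num.sqrt v).

(* mu = N(m, P), P possibly singular: every linear functional x |-> u'x is
   normally distributed under mu, with mean u'm and variance u'Pu. *)
Definition is_gaussian (K : realType) (r : nat) (m : 'cV[K]_r) (P : 'M[K]_r)
    (mu : set (borelV K r) -> \bar K) : Prop :=
  psdmx P /\
  forall u : 'cV[K]_r,
    same_measure
      (pushforward mu
        ((fun x : 'cV[K]_r => (u^T *m x) 0 0) : borelV K r -> measurableTypeR K))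
      (normal_law ((u^T *m m) 0 0) (qform P u)).

(* nu = B_g(eta) *)
Definition is_boltzmann (K : realType) (r : nat) (g : 'cV[K]_r -> K)
    (eta nu : set (borelV K r) -> \bar K) : Prop :=
  ((0 < \int[eta]_x (g x)%:E < +oo) /\
   same_measure nu
     (fun C => (\int[eta]_(x in C) (g x)%:E) / (\int[eta]_x (g x)%:E)))%E.

(* Processes are indexed by K, but only times t >= 0 matter. *)

Section processes.
Context (K : realType) (d : measure_display) (T : measurableType d)
        (Pr : probability T K).

Definition indep_systems (F G : set_system T) : Prop :=
  forall C D : set T, F C -> G D -> Pr (C `&` D) = (Pr C * Pr D)%E.

(* sigma(Y) *)
Definition sigma_rv (d' : measure_display) (T' : measurableType d')
    (Y : T -> T') : set_system T :=
  preimage_set_system [set: T] Y measurable.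

(* sigma(X_s : s in I) *)
Definition sigma_process (n : nat) (I : set K)
    (X : K -> {mfun T >-> borelV K n}) : set_system T :=
  <<s \bigcup_(s in I) sigma_rv (X s) >>.

Definition continuous_paths (n : nat) (X : K -> {mfun T >-> borelV K n}) : Prop :=
  forall w : T,
    {within `[0, +oo[, continuous (fun t : K => X t w : 'cV[K]_n)}.

Definition increment (n : nat) (X : K -> {mfun T >-> borelV K n}) (s t : K) :
    T -> borelV K n :=
  fun w => (X t w : 'cV[K]_n) - (X s w : 'cV[K]_n).

Definition brownian_motion (n : nat) (W : K -> {mfun T >-> borelV K n}) : Prop :=
  [/\ {ae Pr, forall w, W 0 w = (0 : 'cV[K]_n)},
      continuous_paths W,
      (forall s t : K, 0 <= s -> s <= t ->
         is_gaussian 0 (t - s)%:M (pushforward Pr (increment W s t))) &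
      (forall s t : K, 0 <= s -> s <= t ->
         indep_systems (sigma_process `[0, s] W) (sigma_rv (increment W s t)))].

(* dX_t = M X_t dt + B dW_t, i.e. X_t = X_0 + int_0^t M X_s ds + B W_t: since
   the noise is additive with constant coefficient B, int_0^t B dW_s = B W_t. *)
Definition linear_sde (r r1 : nat) (M : 'M[K]_r) (B : 'M[K]_(r, r1))
    (W : K -> {mfun T >-> borelV K r1}) (X : K -> {mfun T >-> borelV K r}) : Prop :=
  continuous_paths X /\
  {ae Pr, forall w, forall t : K, 0 <= t ->
    (X t w : 'cV[K]_r) = (X 0 w : 'cV[K]_r)
      + \col_i \int[lebesgue_measure]_(s in `[0, t])
                  (M *m (X s w : 'cV[K]_r)) i 0
      + B *m (W t w : 'cV[K]_r1)}.

(* The killing time at rate V along X: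
   the first time at which int_0^t V(X_s) ds reaches the clock xi. *)
Definition killing_time (r : nat) (V : 'cV[K]_r -> K)
    (X : K -> {mfun T >-> borelV K r}) (xi : T -> K) (w : T) : \bar K :=
  ereal_inf [set t%:E | t in
    [set t : K | 0 <= t /\
       xi w <= \int[lebesgue_measure]_(s in `[0, t]) V (X s w)]].

(* The clock xi of a killing along X: exponential with unit rate, independent
   of the path (X_s)_{s >= 0}. *)
Definition killing_clock (r : nat) (X : K -> {mfun T >-> borelV K r})
    (xi : {RV Pr >-> measurableTypeR K}) : Prop :=
  same_measure (distribution Pr xi) (exponential_prob 1) /\
  indep_systems (sigma_rv xi) (sigma_process `[0, +oo[ X).

(* X^c; None is the cemetery state *)
Definition killed_process (r : nat) (X : K -> {mfun T >-> borelV K r})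
    (tau : T -> \bar K) (t : K) (w : T) : option (borelV K r) :=
  if (t%:E < tau w)%E then Some (X t w) else None.

Definition cond_prob (E F : set T) : \bar K := (Pr (E `&` F) / Pr F)%E.

(* P(X^c_t in dx | tau > t) *)
Definition law_nonabsorbed (r : nat) (X : K -> {mfun T >-> borelV K r})
    (tau : T -> \bar K) (t : K) : set (borelV K r) -> \bar K :=
  fun C => cond_prob (killed_process X tau t @^-1` (Some @` C))
                     [set w | (t%:E < tau w)%E].

End processes.

(* Main.v *)
(* Idea. The noise is additive, so no stochastic calculus is needed. On the Euler
   chain with mesh h, tilting each increment N(0, h R) by exp(- x^T Q x / 2) is an
   exact Gaussian identity with coefficient L = (1 + h R Q)^-1. It turns the drift
   step 1 + h A into L (1 + h A) = 1 + h (A - R Q) + O(h^2), and by the Riccati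
   equation the quadratic form left over at each step is h S + O(h^2), that is the
   killing at rate x^T S x / 2. Letting h tend to 0 along almost every path gives
     E[h0(X_t) cos(u^T X_t + a) exp(- int_0^t V(X_s) ds)]
       = E[h0(X_t) exp(- int_0^t V(X_s) ds)] E cos(u^T Xh_t + a)
   for all u and a, and these transforms determine measures: the law of Xh_t is
   B_h0(eta_t).
   In the Gaussian case Ph_t = (1 + P_t Q)^-1 P_t and (1 + P_t Q)^-1 m_t solve the
   linear equations driven by A - R Q, so the law of Xh_t is Gaussian with these
   parameters; as N(m_t, P_t) and eta_t have the same image under B_h0, which is
   injective, they coincide. *)

Require Import Defs.
From HB Require Import structures.
From mathcomp Require Import all_boot all_order all_algebra.
From mathcomp Require Import all_classical all_reals all_analysis.
From mathcomp Require Import measurable_realfun ring lra.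

Set Implicit Arguments.
Unset Strict Implicit.
Unset Printing Implicit Defensive.

Import Order.TTheory GRing.Theory Num.Theory.
Import numFieldNormedType.Exports HBSimple HBNNSimple.

Local Open Scope classical_set_scope.
Local Open Scope ring_scope.

(** * Integration of bounded functions *)

(** Transforms are kept real: [cos (dot u x + a)] with a free phase [a] carries the information of a
    characteristic function. Every integrand on the probability space is bounded, so an arbitrary
    initial law causes no integrability problem and all limits there are bounded convergence.
    Covariances may be singular, so densities are used in dimension one only. A tilt by a rank-one
    form is computed on transforms instead: exp(- z^2 / 2) is itself the cosine transform of N(0,
    1), so the tilt shifts the frequency by an auxiliary normal multiple of a vector, over which one
    averages. A general Q is a sum of rank-one forms. The main obstacle is a sign: the form left
    over at each Euler step is h S + O(h^2) with S only semi-definite, so at fixed h it could be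
    indefinite and the weight unbounded. A correction of order h^2 of the drift, absorbed by the
    coercivity of Q, restores positivity. The normalising constants of the tilts stay implicit: the
    transform at frequency 0 recovers them. Integral equations and differential equations are both
    reduced to a uniform one-step error, [consistent], to which discrete Gronwall estimates
    apply. *)

Section bounded_integration.
Context d (T : measurableType d) (K : realType).
Implicit Types (P : probability T K) (f g : T -> K).

Lemma bounded_integrable P f (C : K) : measurable_fun setT f ->
  (forall x, `|f x| <= C) -> P.-integrable setT (EFin \o f).
Proof.
move=> mf fC; apply: measurable_bounded_integrable => //.
  exact: le_lt_trans (probability_le1 P measurableT) (ltry _).
exists C; split; first exact: num_real.
by move=> x Cx y _; exact: le_trans (fC y) (ltW Cx).
Qed.

Lemma EFin_Rintegral P f (C : K) : measurable_fun setT f ->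
  (forall x, `|f x| <= C) ->
  (\int[P]_x (f x)%:E = (\int[P]_x f x)%:E)%E.
Proof.
move=> mf fC; rewrite fineK//; apply: integrable_fin_num => //.
exact: bounded_integrable fC.
Qed.

Lemma Rintegral_probability_cst P (c : K) : \int[P]_x c = c.
Proof. by rewrite Rintegral_cst// [X in fine X](probability_setT P) mulr1. Qed.

Lemma le_norm_Rintegral P f (C : K) : measurable_fun setT f ->
  (forall x, `|f x| <= C) -> `|\int[P]_x f x| <= C.
Proof.
move=> mf fC; have fi := bounded_integrable P mf fC.
apply: le_trans (le_normr_Rintegral measurableT fi) _.
rewrite -[leRHS](Rintegral_probability_cst P); apply: le_Rintegral => //.
- exact: integrable_norm.
- apply: (@bounded_integrable _ _ `|C|) => //.
Qed.

(** The bound is asked for large [n] only, because the weights of the Euler chain are bounded by 1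
    only once the mesh is small; the sequence is shifted before dominated convergence is applied. *)
Lemma cvg_Rintegral_bounded P (f : nat -> T -> K) (g : T -> K) (C : K) :
  (forall n, measurable_fun setT (f n)) -> measurable_fun setT g ->
  (\forall n \near \oo, forall x, `|f n x| <= C) ->
  {ae P, forall x, f ^~ x @ \oo --> g x} ->
  \int[P]_x f n x @[n --> \oo] --> \int[P]_x g x.
Proof.
move=> mf mg [N _ fC] fg.
rewrite -(cvg_shiftn N).
have iC : P.-integrable setT (EFin \o cst C).
  by apply: (@bounded_integrable _ _ `|C|).
have fCN n x : `|f (n + N)%N x| <= C by apply: fC; exact: leq_addl.
have [ig _ cv] : [/\ P.-integrable setT (EFin \o g),
  (\int[P]_x `|(f (n + N)%N x)%:E - (g x)%:E| @[n --> \oo] --> 0)%E &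
  (\int[P]_x (f (n + N)%N x)%:E @[n --> \oo] --> \int[P]_x (g x)%:E)%E].
  apply: (@dominated_convergence _ _ _ P setT measurableT
    (fun n x => (f (n + N)%N x)%:E) (EFin \o g) (EFin \o cst C)) => //.
  - by move=> n; exact/measurable_EFinP.
  - exact/measurable_EFinP.
  - apply: filterS fg => x fx _; apply: cvg_EFin; first exact: nearW.
    by move: fx; rewrite -(cvg_shiftn N).
  - by apply: aeW => x n _; rewrite lee_fin fCN.
apply: fine_cvg; rewrite -/(Rintegral P setT g).
rewrite [X in _ --> X](_ : _ = \int[P]_x (g x)%:E)%E// fineK//.
exact: integrable_fin_num.
Qed.

End bounded_integration.

Section bounded_fubini.
Context d1 d2 (T1 : measurableType d1) (T2 : measurableType d2) (K : realType).
Variables (P1 : probability T1 K) (P2 : probability T2 K).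
Variables (f : T1 * T2 -> K) (C : K).
Hypothesis mf : measurable_fun setT f.
Hypothesis fC : forall x, `|f x| <= C.

Let f_integrable : (P1 \x P2)%E.-integrable setT (EFin \o f).
Proof. by apply: (bounded_integrable [the probability _ _ of (P1 \x P2)%E] mf). Qed.

Lemma measurable_Rintegral_section : measurable_fun setT (fun x => \int[P2]_y f (x, y)).
Proof.
apply/measurable_EFinP.
have := measurable_fubini_F f_integrable; apply: eq_measurable_fun => x _.
rewrite /fubini_F /= (EFin_Rintegral _ (C := C))//.
exact: measurableT_comp.
Qed.

Lemma Rintegral_fubini : \int[P1]_x \int[P2]_y f (x, y) = \int[P2]_y \int[P1]_x f (x, y).
Proof.
rewrite /Rintegral; congr fine.
have := Fubini f_integrable; rewrite /= => F.
transitivity (\int[P1]_x \int[P2]_y (f (x, y))%:E)%E.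
  apply: eq_integral => x _; rewrite fineK// (EFin_Rintegral _ (C := C))//.
  exact: measurableT_comp.
rewrite F; apply: eq_integral => y _; rewrite fineK// (EFin_Rintegral _ (C := C))//.
by apply: (measurableT_comp mf); exact: pair2_measurable.
Qed.

Lemma Rintegral_prod : \int[(P1 \x P2)%E]_z f z = \int[P1]_x \int[P2]_y f (x, y).
Proof.
rewrite /Rintegral; congr fine.
rewrite -[LHS](integral12_prod_meas1 f_integrable).
apply: eq_integral => x _; rewrite /fubini_F /= fineK// (EFin_Rintegral _ (C := C))//.
exact: measurableT_comp.
Qed.

End bounded_fubini.

(** Usual ladder: level sets of simple functions, where the claim is the hypothesis on [nu], then
    finite sums, then monotone limits on both sides. *)
Lemma integral_density d (T : measurableType d) (K : realType)
    (mu nu : {measure set T -> \bar K}) (h : T -> K) (f : T -> \bar K) :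
  measurable_fun setT h -> (forall x, 0 <= h x) ->
  (forall A, measurable A -> nu A = \int[mu]_(x in A) (h x)%:E)%E ->
  measurable_fun setT f -> (forall x, 0 <= f x)%E ->
  (\int[nu]_x f x = \int[mu]_x (f x * (h x)%:E))%E.
Proof.
move=> mh h0 nuE mf f0.
pose g := nnsfun_approx measurableT mf.
have mhE : measurable_fun setT (EFin \o h) by exact/measurable_EFinP.
have gE x : f x = lim ((g n x)%:E @[n --> \oo]).
  by apply/esym/cvg_lim => //; exact: cvg_nnsfun_approx.
transitivity (lim ((\int[nu]_x (g n x)%:E)%E @[n --> \oo])).
  under eq_integral do rewrite gE.
  apply: monotone_convergence => //.
  - by move=> n; exact/measurable_EFinP.
  - by move=> n x _; rewrite lee_fin.
  - by move=> x _ a b ab; rewrite lee_fin; exact/lefP/nd_nnsfun_approx.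
transitivity (lim ((\int[mu]_x ((g n x)%:E * (h x)%:E))%E @[n --> \oo])); last first.
  apply/esym.
  have fg x : (f x * (h x)%:E = lim (((g n x)%:E * (h x)%:E)%E @[n --> \oo]))%E.
    by apply/esym/cvg_lim => //; apply: cvgeZr => //; exact: cvg_nnsfun_approx.
  under eq_integral do rewrite fg.
  apply: monotone_convergence => //.
  - by move=> n; apply: emeasurable_funM => //; exact/measurable_EFinP.
  - by move=> n x _; rewrite mule_ge0// lee_fin.
  - move=> x _ a b ab; rewrite lee_wpmul2r ?lee_fin//.
    exact/lefP/nd_nnsfun_approx.
congr (lim (_ @ \oo)); apply/funext => n.
under eq_integral => x _.
  rewrite fimfunE -fsumEFin//; over.
rewrite ge0_integral_fsum//; last 2 first.
- move=> y; apply/measurable_EFinP; apply: measurable_funM => //.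
- by move=> y x _; exact: nnfun_muleindic_ge0.
under [RHS]eq_integral => x _.
  rewrite fimfunE -fsumEFin// ge0_mule_fsuml; last first.
    by move=> y; exact: nnfun_muleindic_ge0.
  over.
rewrite ge0_integral_fsum//; last 2 first.
- move=> y; apply: emeasurable_funM => //; apply/measurable_EFinP.
  exact: measurable_funM.
- move=> y x _; apply: mule_ge0; last by rewrite lee_fin.
  exact: nnfun_muleindic_ge0.
apply: eq_fsbigr => r rg.
have r0 : 0 <= r by move: rg; rewrite inE => -[x _ <-].
have mg : measurable (g n @^-1` [set r]) by exact: measurable_funPTI.
under eq_integral do rewrite EFinM.
rewrite integralZl_indic_nnsfun// integral_indic// setIT.
under [RHS]eq_integral do rewrite EFinM -muleA.
rewrite ge0_integralZl//; last 2 first.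
- by apply: emeasurable_funM => //; exact/measurable_EFinP.
- by move=> x _; rewrite mule_ge0// lee_fin.
congr (_ * _)%E; rewrite nuE// integral_mkcond; apply: eq_integral => x _.
by rewrite patchE indicE; case: ifPn => _; rewrite ?mul1e ?mul0e.
Qed.

Lemma Rintegral_density d (T : measurableType d) (K : realType)
    (mu : {measure set T -> \bar K}) (nu : probability T K) (h phi : T -> K) (C : K) :
  measurable_fun setT h -> (forall x, 0 <= h x) -> mu.-integrable setT (EFin \o h) ->
  (forall A, measurable A -> nu A = \int[mu]_(x in A) (h x)%:E)%E ->
  measurable_fun setT phi -> (forall x, `|phi x| <= C) ->
  \int[nu]_x phi x = \int[mu]_x (phi x * h x).
Proof.
move=> mh h0 ih nuE mphi.
wlog C0 : C / 0 <= C => [H phiC|phiC].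
  by apply: (H `|C|) => // x; apply: le_trans (phiC x) (ler_norm _).
have pos (psi : T -> K) : measurable_fun setT psi -> (forall x, 0 <= psi x) ->
    \int[nu]_x psi x = \int[mu]_x (psi x * h x).
  move=> mpsi psi0; congr fine.
  have mE : measurable_fun setT (EFin \o psi) by exact/measurable_EFinP.
  have pE x : (0 <= (EFin \o psi) x)%E by rewrite lee_fin.
  by rewrite (integral_density mh h0 nuE mE pE).
(* The signed case follows by writing [phi] as the difference of the nonnegative functions [phi + C]
   and [C]. *)
have m1 : measurable_fun setT (fun x => phi x + C) by exact: measurable_funD.
have p1 x : 0 <= phi x + C.
  by have := phiC x; rewrite ler_norml => /andP[+ _]; rewrite -subr_ge0 opprK.
have iM (psi : T -> K) c : measurable_fun setT psi -> (forall x, `|psi x| <= c) ->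
    mu.-integrable setT (EFin \o (fun x => psi x * h x)).
  move=> mpsi psic.
  apply: (@le_integrable _ _ _ mu setT measurableT _ (fun x => (c * h x)%:E)).
  - by apply/measurable_EFinP; exact: measurable_funM.
  - by move=> x _; rewrite /= lee_fin !normrM ler_wpM2r// (le_trans (psic x))// ler_norm.
  - exact: (integrableZl measurableT c ih).
have b1 x : `|phi x + C| <= C + C.
  by apply: le_trans (ler_normD _ _) _; rewrite lerD// ger0_norm.
have e1 : \int[nu]_x phi x = \int[nu]_x (phi x + C) - \int[nu]_x C.
  rewrite -RintegralB//; first by apply: eq_Rintegral => x _; rewrite addrK.
  - exact: bounded_integrable b1.
  - by apply: (@bounded_integrable _ _ _ _ _ `|C|).
have e2 : \int[mu]_x (phi x * h x) =
    \int[mu]_x ((phi x + C) * h x) - \int[mu]_x (C * h x).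
  rewrite -RintegralB//; first by apply: eq_Rintegral => x _; rewrite -mulrBl addrK.
  - exact: iM b1.
  - by apply: (iM _ C) => // _; rewrite ger0_norm.
by rewrite e1 e2 !pos.
Qed.

(** * Fourier transform of the normal law *)

(** Integration by parts on the whole line: the fundamental theorem on [-n, n], then domination by
    |h|. The intervals are indexed by [n.+1] in the computation so that they are nondegenerate. *)
Lemma Rintegral_derivative_eq0 (K : realType) (H h : K -> K) :
  (forall x : K, is_derive x (1 : K) H (h x)) -> continuous h ->
  lebesgue_measure.-integrable setT (EFin \o h) ->
  H n%:R @[n --> \oo] --> (0 : K) -> H (- n%:R) @[n --> \oo] --> (0 : K) ->
  \int[lebesgue_measure]_x h x = 0.
Proof.
move=> dH ch ih Hy HNy.
pose I n : set K := `[- n%:R, n%:R]%classic.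
have mh : measurable_fun setT h by exact: continuous_measurable_fun.
have cvI : (\int[lebesgue_measure]_x ((h \_ (I n)) x)%:E @[n --> \oo]
    --> \int[lebesgue_measure]_x (h x)%:E)%E.
  have [] // := @dominated_convergence _ _ _ lebesgue_measure setT measurableT
    (fun n x => ((h \_ (I n)) x)%:E) (EFin \o h) (abse \o (EFin \o h)).
  - move=> n; apply/measurable_EFinP.
    by apply: (measurable_restrictT h (measurable_itv _)).1 (measurable_funTS mh).
  - exact/measurable_EFinP.
  - apply: aeW => x _; apply: cvg_EFin; first exact: nearW.
    apply: cvg_near_cst; near=> n; rewrite /= patchE.
    case: ifPn => //; rewrite notin_setE /I /= in_itv /= => /negP; rewrite -ler_norml.
    have -> // : `|x| <= n%:R.
    apply: le_trans (ltW (archi_boundP (normr_ge0 x))) _; rewrite ler_nat.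
    by near: n; exact: nbhs_infty_ge.
  - exact: integrable_abse.
  - apply: aeW => x n _; rewrite /= patchE; case: ifPn => _; first by rewrite lee_fin.
    by rewrite normr0 lee_fin.
have fineI : \int[lebesgue_measure]_x (h \_ (I n)) x @[n --> \oo]
    --> \int[lebesgue_measure]_x h x.
  apply: fine_cvg; rewrite fineK//; exact: integrable_fin_num.
have HI n : \int[lebesgue_measure]_x (h \_ (I n.+1)) x = H n.+1%:R - H (- n.+1%:R).
  rewrite -Rintegral_mkcond /Rintegral.
  have lt : - n.+1%:R < n.+1%:R :> K by rewrite gtrN.
  rewrite (continuous_FTC2 lt (F := H))//.
  - by apply: continuous_subspaceT => x; exact: ch.
  - have cH : continuous H.
      by move=> x; apply/differentiable_continuous/derivable1_diffP; have [] := dH x.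
    split => [x _||]; first by have [] := dH x.
    + exact/cvg_at_right_filter/cH.
    + exact/cvg_at_left_filter/cH.
  - by move=> x _; rewrite derive1E; exact: derive_val.
have : \int[lebesgue_measure]_x (h \_ (I n.+1)) x @[n --> \oo] --> (0 : K).
  under eq_fun do rewrite HI.
  rewrite -(subr0 0); apply: cvgB.
    by rewrite (cvg_shiftS (fun n => H n%:R)).
  by rewrite (cvg_shiftS (fun n => H (- n%:R))).
rewrite (cvg_shiftS (fun n => \int[lebesgue_measure]_x (h \_ (I n)) x)) => h0.
exact: (cvg_unique _ fineI h0).
Unshelve. all: by end_near. Qed.

Lemma is_derive_cos_affine (K : realType) (a b x : K) :
  is_derive x (1 : K) (fun y => cos (y * a + b)) (- (sin (x * a + b) * a)).
Proof.
have h : is_derive x (1 : K) (fun y => y * a + b) a.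
  by apply: is_derive_eq; rewrite !scaler0 add0r scaler1 addr0.
by apply: is_derive_eq; rewrite /GRing.scale /= mulNr mulrC.
Qed.

Lemma is_derive_sin_affine (K : realType) (a b x : K) :
  is_derive x (1 : K) (fun y => sin (y * a + b)) (cos (x * a + b) * a).
Proof.
have h : is_derive x (1 : K) (fun y => y * a + b) a.
  by apply: is_derive_eq; rewrite !scaler0 add0r scaler1 addr0.
by apply: is_derive_eq; rewrite /GRing.scale /= mulrC.
Qed.

Lemma is_derive_normal_pdf (K : realType) (m s x : K) : s != 0 ->
  is_derive x (1 : K) (normal_pdf m s) (- ((x - m) / s ^+ 2 * normal_pdf m s x)).
Proof.
move=> s0; rewrite normal_pdfE// /normal_fun.
have h : is_derive x (1 : K) (fun y => - (y - m) ^+ 2 / (s ^+ 2 *+ 2))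
    (- (x - m) / s ^+ 2).
  apply: is_derive_eq; rewrite /GRing.scale /=.
  by field.
by apply: is_derive_eq; rewrite /GRing.scale /=; field.
Qed.

(** Half of the Gaussian exponent absorbs the linear factor, since |y| <= 1 + y^2 / 4 <= exp(y^2 /
    4). The other half is a normal density of deviation s sqrt 2, an integrable envelope for the
    derivative in the frequency. *)
Lemma normal_moment_bound (K : realType) (m s x : K) : s != 0 ->
  `|x - m| * normal_pdf m s x <=
  `|s| * Num.sqrt 2 * normal_pdf m (s * Num.sqrt 2) x.
Proof.
move=> s0; have s20 : s * Num.sqrt 2 != 0 by rewrite mulf_neq0// sqrtr_eq0 -ltNge.
rewrite !normal_pdfE// /normal_fun /normal_peak.
rewrite exprMn sqr_sqrtr//; move: (@pi K) (@pi_gt0 K) => p p0.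
set y := (x - m) / s.
have -> : - (x - m) ^+ 2 / (s ^+ 2 *+ 2) = - (y ^+ 2 / 2) by rewrite /y; field.
have -> : - (x - m) ^+ 2 / (s ^+ 2 * 2 *+ 2) = - (y ^+ 2 / 4) by rewrite /y; field.
have -> : x - m = s * y by rewrite /y mulrC divfK.
rewrite normrM.
have -> : s ^+ 2 * 2 * p *+ 2 = 2 * (s ^+ 2 * p *+ 2) by ring.
rewrite sqrtrM// invfM.
set k := (Num.sqrt (s ^+ 2 * p *+ 2))^-1.
have k0 : 0 <= k by rewrite invr_ge0 sqrtr_ge0.
have q0 : Num.sqrt 2 != 0 :> K by rewrite sqrtr_eq0 -ltNge.
have -> : `|s| * Num.sqrt 2 * ((Num.sqrt 2)^-1 * k * expR (- (y ^+ 2 / 4)))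
    = `|s| * k * expR (- (y ^+ 2 / 4)) by field.
have -> : `|s| * `|y| * (k * expR (- (y ^+ 2 / 2))) =
  `|s| * k * (`|y| * expR (- (y ^+ 2 / 2))) by ring.
rewrite ler_wpM2l ?mulr_ge0//.
have -> : - (y ^+ 2 / 2) = - (y ^+ 2 / 4) - (y ^+ 2 / 4) by field.
rewrite expRD mulrA ler_piMl ?expR_ge0// expRN ler_pdivrMr ?expR_gt0// mul1r.
apply: le_trans (expR_ge1Dx _).
have /= := sqr_ge0 (`|y| / 2 - 1).
rewrite sqrrB expr_div_n -normrX (ger0_norm (sqr_ge0 y)); lra.
Qed.

Lemma integrable_normal_weight (K : realType) (m s C : K) (f : K -> K) :
  measurable_fun setT f -> (forall x, `|f x| <= C * normal_pdf m s x) ->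
  lebesgue_measure.-integrable setT (EFin \o f).
Proof.
move=> mf fC.
apply: (@le_integrable _ _ _ lebesgue_measure setT measurableT _ (fun x => (C * normal_pdf m s x)%:E)).
- exact/measurable_EFinP.
- by move=> x _; rewrite /= lee_fin (le_trans (fC x))// ler_norm.
- under eq_fun do rewrite EFinM.
  by apply: integrableZl => //; exact: integrable_normal_pdf.
Qed.

Lemma measurable_cos_affine (K : realType) (a b : K) :
  measurable_fun setT (fun x : K => cos (a * x + b)).
Proof.
apply: measurableT_comp; first by apply: continuous_measurable_fun; exact: continuous_cos.
by apply: measurable_funD => //; exact: measurable_funM.
Qed.

Lemma measurable_sin_affine (K : realType) (a b : K) :
  measurable_fun setT (fun x : K => sin (a * x + b)).
Proof.
apply: measurableT_comp; first by apply: continuous_measurable_fun; exact: continuous_sin.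
by apply: measurable_funD => //; exact: measurable_funM.
Qed.

Lemma cvg_normal_pdf0 (K : realType) (m s : K) (u : nat -> K) : s != 0 ->
  (forall n, n%:R <= `|u n|) ->
  normal_pdf m s (u n) @[n --> \oo] --> (0 : K).
Proof.
move=> s0 un.
have s20 : s * Num.sqrt 2 != 0 by rewrite mulf_neq0// sqrtr_eq0 -ltNge.
pose C := `|s| * Num.sqrt 2 * normal_peak (s * Num.sqrt 2).
have C0 : 0 <= C by rewrite !mulr_ge0// normal_peak_ge0.
apply/cvgrPdist_le => e e0; near=> n.
rewrite sub0r normrN ger0_norm ?normal_pdf_ge0//.
have nm : C / e + `|m| <= n%:R.
  apply: le_trans (ltW (archi_boundP (addr_ge0 (divr_ge0 C0 (ltW e0)) (normr_ge0 m)))) _.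
  by rewrite ler_nat; near: n; exact: nbhs_infty_ge.
have := normal_moment_bound m (u n) s0.
have um : C / e <= `|u n - m|.
  rewrite -lerBrDr in nm; apply: le_trans nm _; apply: le_trans (lerB_dist _ _).
  by rewrite lerB.
move=> h.
have hC : `|u n - m| * normal_pdf m s (u n) <= C.
  apply: le_trans h _; rewrite /C ler_wpM2l ?mulr_ge0//.
  exact: normal_pdf_ub.
have Cp : 0 < C by rewrite !mulr_gt0 ?normr_gt0 ?normal_peak_gt0 ?sqrtr_gt0.
rewrite -(ler_pM2l Cp) -ler_pdivrMr//.
apply: le_trans hC; rewrite mulrAC ler_wpM2r// normal_pdf_ge0//.
Unshelve. all: by end_near. Qed.

(** Differentiation under the integral brings out a factor x - m, and (x - m) times the density is -
    s^2 times the derivative of the density; integrating by parts closes a linear differential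
    equation in [th]. *)
Lemma derive_cos_normal (K : realType) (m s a : K) (f := fun th x : K =>
    cos (th * (x - m) + a) * normal_pdf m s x)
    (F := fun th => \int[lebesgue_measure]_x f th x) (th : K) : s != 0 ->
  is_derive th (1 : K) F (- (s ^+ 2 * th * F th)).
Proof.
move=> s0.
have s20 : s * Num.sqrt 2 != 0 by rewrite mulf_neq0// sqrtr_eq0 -ltNge.
have mn := measurable_normal_pdf m s.
have mcos t : measurable_fun setT (fun x : K => cos (t * (x - m) + a)).
  rewrite (_ : (fun x => _) = fun x => cos (t * x + (a - t * m))).
    exact: measurable_cos_affine.
  by apply/funext => x; congr cos; ring.
have msin t : measurable_fun setT (fun x : K => sin (t * (x - m) + a)).
  rewrite (_ : (fun x => _) = fun x => sin (t * x + (a - t * m))).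
    exact: measurable_sin_affine.
  by apply/funext => x; congr sin; ring.
have mxm : measurable_fun setT (fun x : K => x - m) by exact: measurable_funB.
have fi t : lebesgue_measure.-integrable setT (EFin \o f t).
  apply: (@integrable_normal_weight _ m s 1).
    exact: measurable_funM.
  move=> x; rewrite normrM mul1r (ger0_norm (normal_pdf_ge0 _ _ _)).
  by rewrite ler_piMl ?normal_pdf_ge0// ler_norml cos_geN1 cos_le1.
have df t x : is_derive t (1 : K) (fun t => f t x)
    (- (sin (t * (x - m) + a) * (x - m)) * normal_pdf m s x).
  have := is_derive_cos_affine (x - m) a t => h.
  by apply: is_derive_eq; rewrite /GRing.scale /=; ring.
pose g x := - (sin (th * (x - m) + a) * (x - m)) * normal_pdf m s x.
have gi : lebesgue_measure.-integrable setT (EFin \o g).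
  apply: (@integrable_normal_weight _ m (s * Num.sqrt 2) (`|s| * Num.sqrt 2)).
    by apply: measurable_funM => //; apply: measurableT_comp => //; exact: measurable_funM.
  move=> x; apply: le_trans (normal_moment_bound m x s0).
  rewrite normrM normrN normrM (ger0_norm (normal_pdf_ge0 _ _ _)).
  by rewrite ler_wpM2r ?normal_pdf_ge0// ler_piMl// ler_norml sin_geN1 sin_le1.
have Gi : lebesgue_measure.-integrable setT
    (EFin \o (fun x => `|s| * Num.sqrt 2 * normal_pdf m (s * Num.sqrt 2) x)).
  apply: (@integrable_normal_weight _ m (s * Num.sqrt 2) (`|s| * Num.sqrt 2)).
    by apply: measurable_funM => //; exact: measurable_normal_pdf.
  by move=> x; rewrite ger0_norm// !mulr_ge0// normal_pdf_ge0.
have thI : `]th - 1, th + 1[%classic th by rewrite /= in_itv /= ltrBlDr !ltrDl ltr01.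
have Gb t x : `]th - 1, th + 1[%classic t -> setT x ->
    `|partial1of2 f t x| <= `|s| * Num.sqrt 2 * normal_pdf m (s * Num.sqrt 2) x.
  move=> _ _; rewrite partial1of2E derive_val.
  apply: le_trans (normal_moment_bound m x s0).
  rewrite normrM normrN normrM (ger0_norm (normal_pdf_ge0 _ _ _)).
  by rewrite ler_wpM2r ?normal_pdf_ge0// ler_piMl// ler_norml sin_geN1 sin_le1.
have G0 x : 0 <= `|s| * Num.sqrt 2 * normal_pdf m (s * Num.sqrt 2) x.
  by rewrite !mulr_ge0// normal_pdf_ge0.
have fiI (t : K) (_ : `]th - 1, th + 1[%classic t) := fi t.
have dfI (t x : K) (_ : `]th - 1, th + 1[%classic t) (_ : setT x) :
  derivable (f ^~ x) t 1 by have [] := df t x.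
have dd : derivable F th 1.
  exact: (@derivable_under_integral K _ _ lebesgue_measure f setT measurableT
    th (th - 1) (th + 1) thI fiI dfI _ G0 Gi Gb).
have dE : 'D_1 F th = \int[lebesgue_measure]_x g x.
  rewrite -derive1E (@differentiation_under_integral K _ _ lebesgue_measure f setT
    measurableT th (th - 1) (th + 1) thI fiI dfI _ G0 Gi Gb).
  by apply: eq_Rintegral => x _; rewrite partial1of2E derive_val.
apply: DeriveDef => //; rewrite dE.
(* [h] is the derivative of [H]; that its integral vanishes is the integration by parts. *)
pose H x := sin (th * (x - m) + a) * normal_pdf m s x.
pose h x := s ^- 2 * g x + th * f th x.
have dH (x : K) : is_derive x (1 : K) H (h x).
  have h1 : is_derive x (1 : K) (fun x => sin (th * (x - m) + a))
      (cos (th * (x - m) + a) * th).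
    have := is_derive_sin_affine th (a - th * m) x.
    rewrite (_ : (fun y => _) = fun x => sin (th * (x - m) + a)).
      by rewrite (_ : x * th + _ = th * (x - m) + a)//; ring.
    by apply/funext => y; congr sin; ring.
  have h2 := @is_derive_normal_pdf K m s x s0.
  by apply: is_derive_eq; rewrite /GRing.scale /= /h /g /f; field.
have ig1 : lebesgue_measure.-integrable setT (EFin \o (fun x => s ^- 2 * g x)).
  exact: (integrableZl measurableT _ gi).
have ig2 : lebesgue_measure.-integrable setT (EFin \o (fun x => th * f th x)).
  exact: (integrableZl measurableT _ (fi th)).
have : \int[lebesgue_measure]_x h x = 0.
  apply: (Rintegral_derivative_eq0 dH).
  - have cn : continuous (normal_pdf m s) by exact: continuous_normal_pdf.
    have cl t : continuous (fun x => t * (x - m) + a).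
      move=> x; apply: cvgD; last exact: cvg_cst.
      by apply: cvgM; [exact: cvg_cst|apply: cvgB; [exact: cvg_id|exact: cvg_cst]].
    move=> x; apply: cvgD; apply: cvgM.
    + exact: cvg_cst.
    + apply: cvgM; last exact: cn.
      apply: cvgN; apply: cvgM; last by apply: cvgB; [exact: cvg_id|exact: cvg_cst].
      by apply: (cvg_comp _ sin (cl th x)); exact: continuous_sin.
    + exact: cvg_cst.
    + apply: cvgM; last exact: cn.
      by apply: (cvg_comp _ cos (cl th x)); exact: continuous_cos.
  - exact: (integrableD measurableT ig1 ig2).
  - apply: (@squeeze_cvgr _ _ _ _ (fun n => - normal_pdf m s n%:R) (fun n => normal_pdf m s n%:R)).
    + apply: nearW => n; rewrite -ler_norml normrM (ger0_norm (normal_pdf_ge0 _ _ _)).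
      by rewrite ler_piMl ?normal_pdf_ge0// ler_norml sin_geN1 sin_le1.
    + by rewrite -oppr0; apply: cvgN; apply: cvg_normal_pdf0 => // n; rewrite ger0_norm.
    + by apply: cvg_normal_pdf0 => // n; rewrite ger0_norm.
  - apply: (@squeeze_cvgr _ _ _ _ (fun n => - normal_pdf m s (- n%:R)) (fun n => normal_pdf m s (- n%:R))).
    + apply: nearW => n; rewrite -ler_norml normrM (ger0_norm (normal_pdf_ge0 _ _ _)).
      by rewrite ler_piMl ?normal_pdf_ge0// ler_norml sin_geN1 sin_le1.
    + rewrite -oppr0; apply: cvgN; apply: (cvg_normal_pdf0 m s0 (u := fun n => - n%:R)) => n.
      by rewrite normrN ger0_norm.
    + apply: (cvg_normal_pdf0 m s0 (u := fun n => - n%:R)) => n.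
      by rewrite normrN ger0_norm.
rewrite /h RintegralD//.
rewrite !RintegralZl// -/(F th) => /eqP; rewrite addr_eq0 => /eqP e.
have -> : \int[lebesgue_measure]_x g x = s ^+ 2 * (s ^- 2 * \int[lebesgue_measure]_x g x).
  by rewrite mulrA divff ?mul1r// expf_neq0.
by rewrite e; ring.
Qed.

Lemma Rintegral_normal_lebesgue (K : realType) (m s C : K) (f : K -> K) :
  measurable_fun setT f -> (forall x, `|f x| <= C) ->
  \int[normal_prob m s]_x f x = \int[lebesgue_measure]_x (f x * normal_pdf m s x).
Proof.
move=> mf fC.
exact: (@Rintegral_density _ _ _ lebesgue_measure (normal_prob m s) (normal_pdf m s) f C
  (measurable_normal_pdf m s) (normal_pdf_ge0 m s) (integrable_normal_pdf m s)
  (fun _ _ => erefl) mf fC).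
Qed.

Lemma Rintegral_cos_normal (K : realType) (m s th a : K) : s != 0 ->
  \int[normal_prob m s]_x cos (th * x + a) =
  expR (- (s ^+ 2 * th ^+ 2 / 2)) * cos (th * m + a).
Proof.
move=> s0; rewrite (@Rintegral_normal_lebesgue _ m s 1); last 2 first.
- exact: measurable_cos_affine.
- by move=> x; rewrite ler_norml cos_geN1 cos_le1.
pose b := th * m + a.
pose F t := \int[lebesgue_measure]_x (cos (t * (x - m) + b) * normal_pdf m s x).
transitivity (F th).
  by apply: eq_Rintegral => x _; congr (cos _ * _); rewrite /b; ring.
(* The equation F' = - s^2 t F makes this product constant. *)
have dF (t : K) : is_derive t (1 : K) (fun t => expR (s ^+ 2 * t ^+ 2 / 2) * F t) 0.
  have h1 := derive_cos_normal m b t s0.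
  have h2 : is_derive t (1 : K) (fun t => s ^+ 2 * t ^+ 2 / 2) (s ^+ 2 * t).
    by apply: is_derive_eq; rewrite /GRing.scale /=; field.
  by apply: is_derive_eq; rewrite /GRing.scale /=; rewrite -/(F t); ring.
have /= := is_derive_0_is_cst th 0 dF.
rewrite expr0n /= mulr0 mul0r expR0 mul1r => e.
have -> : F th = expR (- (s ^+ 2 * th ^+ 2 / 2)) * F 0.
  by rewrite -e mulrA -expRD addNr expR0 mul1r.
congr (_ * _); rewrite /F.
under eq_Rintegral do rewrite mul0r add0r.
rewrite RintegralZl//; last exact: integrable_normal_pdf.
by rewrite /Rintegral integral_normal_pdf mulr1.
Qed.

(** * Uniqueness of the cosine transform *)

Definition dot (K : realType) (r : nat) (u x : 'cV[K]_r) : K := (u^T *m x) 0 0.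

Lemma dotE (K : realType) r (u x : 'cV[K]_r) : dot u x = \sum_i u i 0 * x i 0.
Proof. by rewrite /dot mxE; apply: eq_bigr => i _; rewrite mxE. Qed.

Lemma dotC (K : realType) r (u x : 'cV[K]_r) : dot u x = dot x u.
Proof. by rewrite !dotE; apply: eq_bigr => i _; rewrite mulrC. Qed.

Lemma dotDl (K : realType) r (u v x : 'cV[K]_r) : dot (u + v) x = dot u x + dot v x.
Proof. by rewrite /dot linearD /= mulmxDl mxE. Qed.

Lemma dotZl (K : realType) r a (u x : 'cV[K]_r) : dot (a *: u) x = a * dot u x.
Proof. by rewrite /dot linearZ /= -scalemxAl mxE. Qed.

Lemma dotNl (K : realType) r (u x : 'cV[K]_r) : dot (- u) x = - dot u x.
Proof. by rewrite -scaleN1r dotZl mulN1r. Qed.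

Lemma dotBl (K : realType) r (u v x : 'cV[K]_r) : dot (u - v) x = dot u x - dot v x.
Proof. by rewrite dotDl dotNl. Qed.

Lemma dotDr (K : realType) r (u x y : 'cV[K]_r) : dot u (x + y) = dot u x + dot u y.
Proof. by rewrite !(dotC u) dotDl. Qed.

Lemma dotZr (K : realType) r a (u x : 'cV[K]_r) : dot u (a *: x) = a * dot u x.
Proof. by rewrite !(dotC u) dotZl. Qed.

Lemma dotNr (K : realType) r (u x : 'cV[K]_r) : dot u (- x) = - dot u x.
Proof. by rewrite !(dotC u) dotNl. Qed.

Lemma dotBr (K : realType) r (u x y : 'cV[K]_r) : dot u (x - y) = dot u x - dot u y.
Proof. by rewrite !(dotC u) dotBl. Qed.

Lemma dot0l (K : realType) r (x : 'cV[K]_r) : dot 0 x = 0.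
Proof. by rewrite -(scale0r 0) dotZl mul0r. Qed.

Lemma dot0r (K : realType) r (x : 'cV[K]_r) : dot x 0 = 0.
Proof. by rewrite dotC dot0l. Qed.

Lemma dot_mulmx (K : realType) r s (M : 'M[K]_(s, r)) (u : 'cV[K]_s) (x : 'cV[K]_r) :
  dot u (M *m x) = dot (M^T *m u) x.
Proof. by rewrite /dot trmx_mul trmxK mulmxA. Qed.

Lemma qformE (K : realType) r (M : 'M[K]_r) (x : 'cV[K]_r) : qform M x = dot x (M *m x).
Proof. by rewrite /qform /dot mulmxA. Qed.

Lemma dot_delta (K : realType) r (i : 'I_r) (x : 'cV[K]_r) : dot (delta_mx i 0) x = x i 0.
Proof.
rewrite dotE (bigD1 i)//= big1 ?addr0 => [|j ji]; rewrite mxE.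
  by rewrite !eqxx mul1r.
by rewrite (negbTE ji) mul0r.
Qed.

(** The Borel structure is generated by all open sets, so an open set has to be exhibited as a
    countable union of boxes, each of which is a finite intersection of coordinate conditions. *)
Lemma measurable_borelV d (T : measurableType d) (K : realType) r
    (f : T -> borelV K r) :
  (forall i, measurable_fun setT (fun t => (f t : 'cV[K]_r) i 0 : K)) ->
  measurable_fun setT f.
Proof.
move=> mf; apply: (measurability (@open 'cV[K]_r : set (set (borelV K r)))) => //.
move=> _ [U oU <-]; rewrite setTI.
(* Boxes with rational centre and radius 1 / (k + 1); [F] keeps those contained in [U]. *)
pose B (q : 'cV[rat]_r * nat) : set 'cV[K]_r :=
  [set y | forall i, `|ratr (q.1 i 0) - y i 0| < q.2.+1%:R^-1].
pose F q : set 'cV[K]_r := if `[< B q `<=` U >] then B q else set0.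
have -> : U = \bigcup_q F q.
  rewrite eqEsubset; split => [x Ux|x [q _]]; last first.
    by rewrite /F; case: ifPn => // /asboolP BU /BU.
  have /nbhs_ballP [e /= e0 eU] : nbhs x U by apply: open_nbhs_nbhs.
  pose k := Num.bound (2 / e).
  have k0 : 0 < k.+1%:R^-1 :> K by [].
  have ke : k.+1%:R^-1 + k.+1%:R^-1 <= e.
    have : 2 / e < k.+1%:R.
      apply: lt_trans (archi_boundP _) _; first by rewrite divr_ge0// ltW.
      by rewrite ltr_nat.
    rewrite ltr_pdivrMr// => h.
    have -> : k.+1%:R^-1 + k.+1%:R^-1 = 2 / k.+1%:R :> K by ring.
    by rewrite ler_pdivrMr// mulrC ltW.
  have qx i : exists q : rat, `|ratr q - x i 0| < k.+1%:R^-1.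
    have /rat_in_itvoo[q] : x i 0 - k.+1%:R^-1 < x i 0 + k.+1%:R^-1.
      by rewrite ltrD2l gtrN.
    by rewrite in_itv /= -ltr_distl => qi; exists q.
  exists (\col_i xchoose (qx i), k) => //.
  have xB : B (\col_i xchoose (qx i), k) x.
    by move=> i /=; rewrite mxE; exact: (xchooseP (qx i)).
  rewrite /F; case: ifPn => // /asboolP nBU; case: nBU => y yB.
  apply: eU; split => // i j; rewrite (ord1 j) /ball /=.
  have := xB i; have := yB i; rewrite /= mxE => h1 h2.
  rewrite (_ : x i 0 - y i 0 = (ratr (xchoose (qx i)) - y i 0) -
    (ratr (xchoose (qx i)) - x i 0)); last by ring.
  by apply: le_lt_trans (ler_normB _ _) _; apply: lt_le_trans ke; exact: ltrD.
rewrite preimage_bigcup; apply: countable_bigcupT_measurable => // q.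
rewrite /F; case: ifPn => _; last by rewrite preimage_set0.
rewrite (_ : _ @^-1` _ = \bigcap_(i in [set: 'I_r])
    [set t | `|ratr (q.1 i 0) - (f t : 'cV[K]_r) i 0| < q.2.+1%:R^-1]).
  apply: fin_bigcap_measurable => // i _.
  have md : measurable_fun setT
      (fun t => `|ratr (q.1 i 0) - (f t : 'cV[K]_r) i 0| : K).
    by apply: measurableT_comp => //; exact: measurable_funB.
  have := md measurableT `]-oo, q.2.+1%:R^-1[%classic (measurable_itv _).
  by rewrite setTI; congr measurable; apply/seteqP; split => t /=; rewrite in_itv.
by apply/seteqP; split => [t tB i _|t tB i]; [exact: tB|exact: (tB i Logic.I)].
Qed.

Lemma measurable_coord (K : realType) r (i : 'I_r) :
  measurable_fun setT (fun x : borelV K r => (x : 'cV[K]_r) i 0 : K).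
Proof.
apply: (measurability _ (RGenInftyO.measurableE K)) => _ [_ [a ->] <-].
rewrite setTI; apply: sub_sigma_algebra.
apply: open_comp; last exact: interval_open.
by move=> x _; exact: coord_continuous.
Qed.

Lemma measurable_dot d (T : measurableType d) (K : realType) r (u : 'cV[K]_r)
    (f : T -> borelV K r) : measurable_fun setT f ->
  measurable_fun setT (fun t => dot u (f t)).
Proof.
move=> mf; rewrite (_ : (fun t => _) = fun t => \sum_i u i 0 * (f t : 'cV[K]_r) i 0).
  apply: measurable_sum => i; apply: measurable_funM => //.
  exact: (measurableT_comp (measurable_coord i)).
by apply/funext => t; rewrite dotE.
Qed.

Lemma measurable_mulmx d (T : measurableType d) (K : realType) r s
    (M : 'M[K]_(s, r)) (f : T -> borelV K r) : measurable_fun setT f ->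
  measurable_fun setT (fun t => M *m (f t : 'cV[K]_r) : borelV K s).
Proof.
move=> mf; apply: measurable_borelV => i.
rewrite (_ : (fun t => _) = fun t => dot (row i M)^T (f t)).
  exact: measurable_dot.
by apply/funext => t; rewrite /dot trmxK -row_mul [RHS]mxE.
Qed.

Lemma measurable_addmx d (T : measurableType d) (K : realType) r
    (f g : T -> borelV K r) : measurable_fun setT f -> measurable_fun setT g ->
  measurable_fun setT (fun t => (f t : 'cV[K]_r) + (g t : 'cV[K]_r) : borelV K r).
Proof.
move=> mf mg; apply: measurable_borelV => i.
rewrite (_ : (fun t => _) = fun t => (f t : 'cV[K]_r) i 0 + (g t : 'cV[K]_r) i 0).
  by apply: measurable_funD; exact: (measurableT_comp (measurable_coord i)).
by apply/funext => t; rewrite mxE.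
Qed.

Lemma measurable_submx d (T : measurableType d) (K : realType) r
    (f g : T -> borelV K r) : measurable_fun setT f -> measurable_fun setT g ->
  measurable_fun setT (fun t => (f t : 'cV[K]_r) - (g t : 'cV[K]_r) : borelV K r).
Proof.
move=> mf mg; apply: measurable_borelV => i.
rewrite (_ : (fun t => _) = fun t => (f t : 'cV[K]_r) i 0 - (g t : 'cV[K]_r) i 0).
  by apply: measurable_funB; exact: (measurableT_comp (measurable_coord i)).
by apply/funext => t; rewrite !mxE.
Qed.

Lemma measurable_qform d (T : measurableType d) (K : realType) r (M : 'M[K]_r)
    (f : T -> borelV K r) : measurable_fun setT f ->
  measurable_fun setT (fun t => qform M (f t)).
Proof.
move=> mf; rewrite (_ : (fun t => _) =
    fun t => \sum_i (f t : 'cV[K]_r) i 0 * (M *m (f t : 'cV[K]_r)) i 0).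
  apply: measurable_sum => i; apply: measurable_funM.
    exact: (measurableT_comp (measurable_coord i)).
  exact: (measurableT_comp (measurable_coord i) (measurable_mulmx M mf)).
by apply/funext => t; rewrite qformE dotE.
Qed.

Lemma measurable_cos (K : realType) : measurable_fun setT (@cos K).
Proof. by apply: continuous_measurable_fun; exact: continuous_cos. Qed.

Lemma measurable_cos_dot d (T : measurableType d) (K : realType) r
    (f : T -> borelV K r) u a : measurable_fun setT f ->
  measurable_fun setT (fun t => cos (dot u (f t) + a)).
Proof.
move=> mf; apply: (measurableT_comp (@measurable_cos K)).
by apply: measurable_funD => //; exact: measurable_dot.
Qed.

Lemma cos_norm_le1 (K : realType) (x : K) : `|cos x| <= 1.
Proof. by rewrite ler_norml cos_geN1 cos_le1. Qed.

(** * Functionals on bounded Borel functions and their multipliers *)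

Definition bounded_borel (K : realType) r (phi : 'cV[K]_r -> K) : Prop :=
  measurable_fun setT (phi : borelV K r -> K) /\ exists C, forall x, `|phi x| <= C.

Lemma bounded_borelD (K : realType) r (f g : 'cV[K]_r -> K) :
  bounded_borel f -> bounded_borel g -> bounded_borel (fun x => f x + g x).
Proof.
move=> [mf [C fC]] [mg [D gD]]; split; first exact: measurable_funD.
by exists (C + D) => x; apply: le_trans (ler_normD _ _) _; exact: lerD.
Qed.

Lemma bounded_borelM (K : realType) r (f g : 'cV[K]_r -> K) :
  bounded_borel f -> bounded_borel g -> bounded_borel (fun x => f x * g x).
Proof.
move=> [mf [C fC]] [mg [D gD]]; split; first exact: measurable_funM.
by exists (C * D) => x; rewrite normrM ler_pM.
Qed.

Lemma bounded_borel_cst (K : realType) r (c : K) : bounded_borel (fun _ : 'cV[K]_r => c).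
Proof. by split; [exact: measurable_cst|exists `|c|]. Qed.

Lemma bounded_borel_cos (K : realType) r (u : 'cV[K]_r) (a : K) :
  bounded_borel (fun x => cos (dot u x + a)).
Proof.
split; first exact: (measurable_cos_dot u a (@measurable_id _ (borelV K r) setT)).
by exists 1 => x; exact: cos_norm_le1.
Qed.

Lemma bounded_borel_cvg (K : realType) r (f : nat -> 'cV[K]_r -> K) g C :
  (forall n, bounded_borel (f n)) -> (forall n x, `|f n x| <= C) ->
  (forall x, f n x @[n --> \oo] --> g x) -> bounded_borel g.
Proof.
move=> bf fC fg; split.
  apply: (@measurable_fun_cvg _ (borelV K r) K setT f) => [n|x _]; last exact: fg.
  by have [] := bf n.
exists C => x; have h : `|f n x| @[n --> \oo] --> `|g x| by apply: cvg_norm; exact: fg.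
by rewrite -(cvg_lim _ h)//; apply: limr_le; [apply/cvg_ex; exists (`|g x|) | exact: nearW].
Qed.

(** The properties of a difference of two weighted integrals that the argument uses: linearity and
    continuity under bounded pointwise convergence. This replaces a theory of signed measures. *)
Definition bounded_functional (K : realType) r (I : ('cV[K]_r -> K) -> K) : Prop :=
  [/\ forall f g, bounded_borel f -> bounded_borel g ->
        I (fun x => f x + g x) = I f + I g,
      forall c f, bounded_borel f -> I (fun x => c * f x) = c * I f &
      forall (f : nat -> 'cV[K]_r -> K) g C, (forall n, bounded_borel (f n)) ->
        (forall n x, `|f n x| <= C) -> (forall x, f n x @[n --> \oo] --> g x) ->
        I (f n) @[n --> \oo] --> I g].

(** The phase [a] turns cosines into sines as well, so this says that the measure [phi] dI has zero
    Fourier transform. *)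
Definition kills_cos (K : realType) r (I : ('cV[K]_r -> K) -> K) phi : Prop :=
  forall u a, I (fun x => phi x * cos (dot u x + a)) = 0.

(* [I] is integration against a signed measure. Starting from cosines, the limits
   s = lim M sin (s / M) and 1_{s < 0} = lim exp (- n exp (n s)) show that
   indicators of half-spaces, hence of Borel sets, are multipliers. *)
Definition multiplier (K : realType) r (I : ('cV[K]_r -> K) -> K) psi : Prop :=
  bounded_borel psi /\ forall phi, bounded_borel phi -> kills_cos I phi ->
    kills_cos I (fun x => phi x * psi x).

Lemma multiplierM (K : realType) r (I : ('cV[K]_r -> K) -> K) f g :
  multiplier I f -> multiplier I g -> multiplier I (fun x => f x * g x).
Proof.
move=> [bf If] [bg Ig]; split; first exact: bounded_borelM.
move=> phi bphi Iphi; have := Ig _ (bounded_borelM bphi bf) (If _ bphi Iphi).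
by rewrite (_ : (fun x => _ * _) = fun x => phi x * (f x * g x))//; apply/funext => x; rewrite mulrA.
Qed.

Lemma multiplierD (K : realType) r (I : ('cV[K]_r -> K) -> K) f g :
  bounded_functional I ->
  multiplier I f -> multiplier I g -> multiplier I (fun x => f x + g x).
Proof.
move=> [ID _ _] [bf If] [bg Ig]; split; first exact: bounded_borelD.
move=> phi bphi Iphi u a.
rewrite (_ : (fun x => _) = fun x => phi x * f x * cos (dot u x + a)
    + phi x * g x * cos (dot u x + a)); last by apply/funext => x; ring.
rewrite ID ?If ?Ig ?addr0//; apply: bounded_borelM (bounded_borel_cos _ _);
  exact: bounded_borelM.
Qed.

Lemma multiplierZ (K : realType) r (I : ('cV[K]_r -> K) -> K) c f :
  bounded_functional I -> multiplier I f -> multiplier I (fun x => c * f x).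
Proof.
move=> [_ IZ _] [bf If]; split; first exact: (bounded_borelM (bounded_borel_cst _ _)).
move=> phi bphi Iphi u a.
rewrite (_ : (fun x => _) = fun x => c * (phi x * f x * cos (dot u x + a)));
  last by apply/funext => x; ring.
rewrite IZ ?If ?mulr0//; apply: bounded_borelM (bounded_borel_cos _ _).
exact: bounded_borelM.
Qed.

Lemma multiplier_cst (K : realType) r (I : ('cV[K]_r -> K) -> K) c :
  bounded_functional I -> multiplier I (fun=> c).
Proof.
move=> [_ IZ _]; split; first exact: bounded_borel_cst.
move=> phi bphi Iphi u a.
rewrite (_ : (fun x => _) = fun x => c * (phi x * cos (dot u x + a)));
  last by apply/funext => x; ring.
by rewrite IZ ?Iphi ?mulr0//; exact: bounded_borelM (bounded_borel_cos _ _).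
Qed.

(** Product-to-sum: a product of two cosines is half a sum of cosines of frequencies v + u and v -
    u, both killed. *)
Lemma multiplier_cos (K : realType) r (I : ('cV[K]_r -> K) -> K) v b :
  bounded_functional I -> multiplier I (fun x => cos (dot v x + b)).
Proof.
move=> [ID IZ _]; split; first exact: bounded_borel_cos.
move=> phi bphi Iphi u a.
rewrite (_ : (fun x => _) = fun x => 2^-1 * (phi x * cos (dot (v + u) x + (b + a))) +
    2^-1 * (phi x * cos (dot (v - u) x + (b - a)))).
  have bc w c : bounded_borel (fun x => phi x * cos (dot w x + c)).
    exact: bounded_borelM (bounded_borel_cos _ _).
  rewrite ID ?IZ ?Iphi ?mulr0 ?addr0//;
    exact: (bounded_borelM (bounded_borel_cst _ _)).
apply/funext => x; rewrite dotBl dotDl.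
rewrite (_ : dot v x + dot u x + (b + a) = (dot v x + b) + (dot u x + a)); last by ring.
rewrite (_ : dot v x - dot u x + (b - a) = (dot v x + b) - (dot u x + a)); last by ring.
by rewrite (cosB (dot v x + b)) (cosD (dot v x + b)); field.
Qed.

Lemma multiplier_cvg (K : realType) r (I : ('cV[K]_r -> K) -> K)
    (f : nat -> 'cV[K]_r -> K) g C :
  bounded_functional I -> (forall n, multiplier I (f n)) ->
  (forall n x, `|f n x| <= C) -> (forall x, f n x @[n --> \oo] --> g x) ->
  multiplier I g.
Proof.
move=> [_ _ Icvg] mf fC fg; split.
  by apply: (bounded_borel_cvg _ fC fg) => n; have [] := mf n.
move=> phi bphi Iphi u a.
have [mphi [D phiD]] := bphi.
have : I (fun x => phi x * f n x * cos (dot u x + a)) @[n --> \oo] -->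
    I (fun x => phi x * g x * cos (dot u x + a)).
  apply: (Icvg _ _ (D * C * 1)).
  - move=> n; apply: bounded_borelM (bounded_borel_cos _ _).
    by apply: bounded_borelM => //; have [] := mf n.
  - move=> n x; rewrite !normrM ler_pM ?mulr_ge0// ?cos_norm_le1//.
    by rewrite ler_pM.
  - move=> x; apply: cvgM; last exact: cvg_cst.
    by apply: cvgM; [exact: cvg_cst|exact: fg].
rewrite (_ : (fun n => _) = fun=> 0); last first.
  by apply/funext => n; have [_ ->] := mf n.
by move=> /(cvg_unique (@norm_hausdorff _ K) (cvg_cst (0 : K))) <-.
Qed.

(** A bound uniform in [n], so that partial sums of the exponential converge boundedly. *)
Lemma series_exp_coeff_le (K : realType) (x : K) n :
  `|series (exp_coeff x) n| <= expR `|x|.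
Proof.
rewrite /series /=; apply: le_trans (ler_norm_sum _ _ _) _.
have -> : \sum_(0 <= i < n) `|exp_coeff x i| = series (exp_coeff `|x|) n.
  rewrite /series /=; apply: eq_bigr => i _.
  by rewrite /exp_coeff normrM normfV normrX normr_nat.
apply: nondecreasing_cvgn_le; last exact: is_cvg_series_exp_coeff.
apply/nondecreasing_seqP => k; rewrite /series /= big_nat_recr//= lerDl.
exact: exp_coeff_ge0.
Qed.

(** The partial sums of the exponential series are polynomials in [f], hence multipliers, and
    converge boundedly. *)
Lemma multiplier_expR (K : realType) r (I : ('cV[K]_r -> K) -> K) f :
  bounded_functional I -> multiplier I f -> multiplier I (fun x => expR (f x)).
Proof.
move=> bI mf; have [[_ [C fC]] _] := mf.
apply: (@multiplier_cvg _ _ _ (fun n x => series (exp_coeff (f x)) n) _ (expR C)) => //.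
- elim=> [|n IH].
    rewrite (_ : (fun x => _) = fun=> 0); first exact: multiplier_cst.
    by apply/funext => x; rewrite /series /= big_geq.
  rewrite (_ : (fun x => _) = fun x => series (exp_coeff (f x)) n + n`!%:R^-1 * f x ^+ n).
    apply: multiplierD => //; apply: multiplierZ => //.
    elim: n {IH} => [|n IH]; first by under eq_fun do rewrite expr0; exact: multiplier_cst.
    by under eq_fun do rewrite exprS; exact: multiplierM.
  by apply/funext => x; rewrite /series /= big_nat_recr//= /exp_coeff mulrC.
- by move=> n x; apply: le_trans (series_exp_coeff_le _ _) _; rewrite ler_expR.
- by move=> x; exact: is_cvg_series_exp_coeff.
Qed.

Lemma cvg_scaled_sin (K : realType) (s : K) :
  n.+1%:R * sin (s / n.+1%:R) @[n --> \oo] --> s.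
Proof.
have h : is_derive (0 : K) (1 : K) (fun y => sin (y * s + 0)) (cos (0 * s + 0) * s).
  exact: is_derive_sin_affine.
have : h^-1 *: (sin ((h *: 1 + 0) * s + 0) - sin (0 * s + 0)) @[h --> (0 : K)^'] --> s.
  have [d dE] := h; move: dE; rewrite [in X in _ = X]mul0r addr0 cos0 mul1r => dE.
  by rewrite -[X in _ --> X]dE; exact: d.
move=> /cvgr_dnbhsP /(_ (fun n => n.+1%:R^-1)).
have -> : (fun n : nat => (n.+1%:R^-1 : K)^-1 *:
  (sin (((n.+1%:R^-1) *: 1 + 0) * s + 0) - sin (0 * s + 0))) =
  fun n => n.+1%:R * sin (s / n.+1%:R).
  apply/funext => n; rewrite invrK mul0r !addr0 sin0 subr0 /GRing.scale /= mulr1.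
  by rewrite (mulrC s).
apply; split => [n|]; first by rewrite invr_eq0 pnatr_eq0.
exact: cvg_harmonic.
Qed.

(** The limit is the indicator of the open half-line: for s >= 0, including s = 0, the exponent is
    at most -(n + 1). *)
Lemma cvg_double_exp (K : realType) (s : K) :
  expR (- n.+1%:R * expR (n.+1%:R * s)) @[n --> \oo] --> (((s < 0)%R : bool)%:R : K).
Proof.
have ninf : n.+1%:R^-1 @[n --> \oo] --> (0 : K) by exact: cvg_harmonic.
have [s0|s0] := ltP s 0.
  have : - (n.+1%:R * expR (n.+1%:R * s)) @[n --> \oo] --> (0 : K).
    rewrite -oppr0; apply: cvgN.
    apply: (@squeeze_cvgr _ _ _ _ (cst 0) (fun n => 2 / s ^+ 2 * n.+1%:R^-1)).
    - apply: nearW => n; rewrite /= mulr_ge0 ?expR_ge0//=.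
      have s20 : 0 < s ^+ 2 by rewrite exprn_even_gt0//= lt_eqF.
      (* For s < 0 the inequality exp(x) >= x^2 / 2 gives n exp(n s) <= 2 / (s^2 n). *)
      have h : (n.+1%:R * - s) ^+ 2 / 2 <= expR (n.+1%:R * - s).
        apply: le_trans (expR_ge1Dxn 1 _); first by rewrite lerDr.
        by rewrite mulr_ge0// oppr_ge0 ltW.
      rewrite -(opprK (n.+1%:R * s)) -mulrN expRN ler_pdivrMr ?expR_gt0//.
      have NE (N : K) : N != 0 -> N = 2 / s ^+ 2 * N^-1 * ((N * - s) ^+ 2 / 2).
        by move=> N0; field; rewrite ?N0 ?lt_eqF.
      rewrite [leLHS]NE ?pnatr_eq0//.
      by rewrite ler_wpM2l// !mulr_ge0// ?invr_ge0// ltW.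
    - exact: cvg_cst.
    - by rewrite -(mulr0 (2 / s ^+ 2)); apply: cvgM => //; exact: cvg_cst.
  move=> h; rewrite -[X in _ --> X]/(1 : K) -[X in _ --> X](@expR0 K); under eq_fun do rewrite mulNr.
  by apply: (cvg_comp _ expR h); exact: continuous_expR.
apply: (@squeeze_cvgr _ _ _ _ (cst 0) (fun n => n.+1%:R^-1)).
- apply: nearW => n; rewrite /= expR_ge0 /= mulNr expRN lef_pV2 ?posrE ?expR_gt0//.
  have : n.+1%:R <= n.+1%:R * expR (n.+1%:R * s).
    by rewrite ler_peMr// -[leLHS]expR0 ler_expR mulr_ge0.
  move=> h; apply: le_trans h _; apply: le_trans (expR_ge1Dx _).
  by rewrite lerDr.
- exact: cvg_cst.
- exact: ninf.
Qed.

(** The affine form [s] is unbounded, so it is reached only inside exp(- n exp(n s)), which stays in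
    [0, 1]: one lets [M] tend to infinity first, then [n]. *)
Lemma multiplier_halfspace (K : realType) r (I : ('cV[K]_r -> K) -> K) v c :
  bounded_functional I ->
  multiplier I (fun x => ((dot v x < c)%R : bool)%:R).
Proof.
move=> bI.
pose s x := dot v x - c.
have msin M : multiplier I (fun x => M.+1%:R * sin (s x / M.+1%:R)).
  apply: multiplierZ => //.
  (* A sine is a cosine with phase shifted by - pi / 2. *)
  rewrite (_ : (fun x => _) = fun x => cos (dot (M.+1%:R^-1 *: v) x +
    (- (c / M.+1%:R) - pi / 2))); first exact: multiplier_cos.
  by apply/funext => x; rewrite addrA cosBpihalf dotZl /s; congr sin; ring.
have mdexp n : multiplier I (fun x => expR (- n.+1%:R * expR (n.+1%:R * s x))).
  apply: (@multiplier_cvg _ _ _ (fun M x => expR (- n.+1%:R *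
      expR (n.+1%:R * (M.+1%:R * sin (s x / M.+1%:R))))) _ 1) => //.
  - move=> M; apply: multiplier_expR => //; apply: multiplierZ => //.
    by apply: multiplier_expR => //; apply: multiplierZ.
  - move=> M x; rewrite ger0_norm ?expR_ge0// -[leRHS]expR0 ler_expR mulNr oppr_le0.
  - move=> x; apply: (@cvg_comp _ _ _ _ expR); last exact: continuous_expR.
    apply: cvgM; first exact: cvg_cst.
    apply: (@cvg_comp _ _ _ _ expR); last exact: continuous_expR.
    by apply: cvgM; [exact: cvg_cst|exact: cvg_scaled_sin].
apply: (@multiplier_cvg _ _ _ (fun n x => expR (- n.+1%:R * expR (n.+1%:R * s x))) _ 1) => //.
- move=> n x; rewrite ger0_norm ?expR_ge0// -[leRHS]expR0 ler_expR mulNr oppr_le0.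
- by move=> x; have := @cvg_double_exp K (s x); rewrite /s subr_lt0.
Qed.

(** Multipliers are stable under products and bounded limits, so the sets whose indicator is a
    multiplier form a full sigma-algebra. *)
Lemma multiplier_indic (K : realType) r (I : ('cV[K]_r -> K) -> K) (D : set (borelV K r)) :
  bounded_functional I -> measurable D -> multiplier I (\1_D : 'cV[K]_r -> K).
Proof.
move=> bI mD.
pose S : set (set (borelV K r)) := [set E | multiplier I (\1_E : 'cV[K]_r -> K)].
have mC E : S E -> S (~` E).
  move=> SE; rewrite /S /=.
  rewrite (_ : \1_(~` E) = fun x : 'cV[K]_r => 1 + -1 * \1_E x).
    by apply: multiplierD => //; [exact: multiplier_cst|exact: multiplierZ].
  apply/funext => x; rewrite !indicE in_setC.
  by case: (x \in E) => /=; rewrite ?mulr1 ?mulr0 ?subrr ?addr0.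
have mI E F : S E -> S F -> S (E `&` F).
  move=> SE SF; rewrite /S /= indicI.
  exact: multiplierM.
have sS : sigma_algebra setT S.
  split.
  - by rewrite /S /= indic0; exact: multiplier_cst.
  - by move=> E SE; rewrite setTD; exact: mC.
  - move=> E SE.
    have SU n : S (\big[setU/set0]_(i < n) E i).
      elim: n => [|n IH]; first by rewrite big_ord0 /S /= indic0; exact: multiplier_cst.
      rewrite big_ord_recr /= -[X in S X]setCK setCU; by apply: (mC); apply: mI; exact: (mC).
    apply: (@multiplier_cvg _ _ _ (fun n => \1_(\big[setU/set0]_(i < n) E i)) _ 1) => //.
    + by move=> n x; rewrite indicE; case: (_ \in _); rewrite ?normr1 ?normr0.
    + move=> x; have [[k _ Ek]|nE] := pselect ((\bigcup_k E k) x).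
        apply: cvg_near_cst; exists k.+1 => // n /= kn.
        rewrite !indicE !mem_set//; first by exists k.
        by rewrite -bigcup_mkord; exists k.
      apply: cvg_near_cst; apply: nearW => n.
      rewrite !indicE !memNset// -bigcup_mkord => -[k _ Ek].
      by apply: nE; exists k.
(* Half-spaces orthogonal to the axes make every coordinate measurable for [S]; hence the identity
   is measurable from [S] to the Borel sets, which says that [S] contains all of them. *)
have mid : measurable_fun setT
    (fun x : g_sigma_algebraType S => (x : borelV K r)).
  apply: measurable_borelV => i.
  apply: (measurability _ (RGenInftyO.measurableE K)) => _ [_ [a ->] <-].
  rewrite setTI; apply: sub_sigma_algebra; rewrite /S /=.
  have := multiplier_halfspace (delta_mx i 0) a bI.
  congr multiplier; apply/funext => x; rewrite indicE.
  by rewrite dot_delta; congr ((_ : bool)%:R); apply/idP/idP; rewrite inE /= in_itv.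
have := mid measurableT D mD; rewrite setTI.
by rewrite [X in X -> _](_ : _ = S D)//; rewrite /measurable /= /sigma_algebra_id sigma_algebra_id.
Qed.

Theorem cos_transform_unique (K : realType) r d1 d2 (T1 : measurableType d1)
    (T2 : measurableType d2) (P1 : probability T1 K) (P2 : probability T2 K)
    (X1 : T1 -> borelV K r) (X2 : T2 -> borelV K r) (w1 : T1 -> K) (w2 : T2 -> K) C :
  measurable_fun setT X1 -> measurable_fun setT X2 ->
  measurable_fun setT w1 -> measurable_fun setT w2 ->
  (forall x, `|w1 x| <= C) -> (forall x, `|w2 x| <= C) ->
  (forall u a, \int[P1]_x (w1 x * cos (dot u (X1 x) + a)) =
               \int[P2]_x (w2 x * cos (dot u (X2 x) + a))) ->
  forall D : set (borelV K r), measurable D ->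
    \int[P1]_x (w1 x * \1_D (X1 x)) = \int[P2]_x (w2 x * \1_D (X2 x)).
Proof.
move=> mX1 mX2 mw1 mw2 w1C w2C E D mD.
pose J d (T : measurableType d) (P : probability T K) (w : T -> K) (X : T -> borelV K r)
  (phi : 'cV[K]_r -> K) := \int[P]_x (w x * phi (X x)).
have bJ d (T : measurableType d) (P : probability T K) w X :
    measurable_fun setT (w : T -> K) -> (forall x, `|w x| <= C) ->
    measurable_fun setT (X : T -> borelV K r) -> bounded_functional (@J d T P w X).
  move=> mw wC mX.
  have iJ phi : bounded_borel phi ->
      P.-integrable setT (EFin \o (fun x => w x * phi (X x))).
    move=> [mphi [B phiB]]; apply: (@bounded_integrable _ _ _ P _ (C * B)).
      by apply: measurable_funM => //; exact: (measurableT_comp mphi).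
    by move=> x; rewrite normrM ler_pM.
  split.
  - move=> f g bf bg; rewrite /J -RintegralD//; try exact: iJ.
    by apply: eq_Rintegral => x _; rewrite mulrDr.
  - move=> c f bf; rewrite /J -RintegralZl//; last exact: iJ.
    by apply: eq_Rintegral => x _; rewrite mulrCA.
  - move=> f g B bf fB fg; apply: (@cvg_Rintegral_bounded _ _ _ P _ _ (C * B)).
    + move=> n; apply: measurable_funM => //.
      by have [mf _] := bf n; exact: (measurableT_comp mf).
    + have [mg _] := bounded_borel_cvg bf fB fg.
      by apply: measurable_funM => //; exact: (measurableT_comp mg).
    + by apply: nearW => n x; rewrite normrM ler_pM.
    + by apply: aeW => x; apply: cvgM; [exact: cvg_cst|exact: fg].
pose I phi := J _ _ P1 w1 X1 phi - J _ _ P2 w2 X2 phi.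
have bI : bounded_functional I.
  have [D1 Z1 L1] := bJ _ _ P1 _ _ mw1 w1C mX1.
  have [D2 Z2 L2] := bJ _ _ P2 _ _ mw2 w2C mX2.
  split.
  - by move=> f g bf bg; rewrite /I D1// D2//; ring.
  - by move=> c f bf; rewrite /I Z1// Z2//; ring.
  - by move=> f g B bf fB fg; apply: cvgB; [exact: (L1 _ _ B)|exact: (L2 _ _ B)].
have [_ /(_ (fun=> 1) (bounded_borel_cst _ _))] := multiplier_indic bI mD.
(* The hypothesis says that the constant 1 is killed; multiplying by the indicator of [D] and
   evaluating at u = 0, a = 0 gives the claim. *)
have k1 : kills_cos I (fun=> 1).
  move=> u a; rewrite /I /J; under eq_Rintegral do rewrite mul1r.
  by rewrite E; under [X in _ - X]eq_Rintegral do rewrite mul1r; rewrite subrr.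
move=> /(_ k1 0 0); rewrite /I /J => /eqP; rewrite subr_eq0 => /eqP.
under eq_Rintegral do rewrite mul1r dot0l addr0 cos0 mulr1.
by under [in RHS]eq_Rintegral do rewrite mul1r dot0l addr0 cos0 mulr1.
Qed.

(** * Gaussian transforms and quadratic tilting *)

(** Completing the square turns weight times standard density into a multiple of a normal density,
    whose cosine transform is known. The bound [B] makes the integrand bounded. *)
Lemma Rintegral_gauss_weight (K : realType) (p b c a B : K) : 0 < 1 + p ->
  (forall x, expR (- (p * x ^+ 2 / 2) - b * x) <= B) ->
  \int[normal_prob 0 1]_x (expR (- (p * x ^+ 2 / 2) - b * x) * cos (c * x + a)) =
  (Num.sqrt (1 + p))^-1 * expR ((b ^+ 2 - c ^+ 2) / (1 + p) / 2)
    * cos (a - c * b / (1 + p)).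
Proof.
move=> p1 eB.
have sp : 0 < Num.sqrt (1 + p) by rewrite sqrtr_gt0.
have sp0 : Num.sqrt (1 + p) != 0 by rewrite gt_eqF.
have spi : (Num.sqrt (1 + p))^-1 != 0 by rewrite invr_eq0.
have me : measurable_fun setT (fun x : K => expR (- (p * x ^+ 2 / 2) - b * x)).
  apply: measurableT_comp => //; apply: measurable_funB; last exact: measurable_funM.
  by apply: measurableT_comp => //; apply: measurable_funM => //; exact: measurable_funM.
have mc := measurable_cos_affine c a.
rewrite (@Rintegral_normal_lebesgue _ 0 1 B); last 2 first.
- exact: measurable_funM.
- move=> x; rewrite normrM (ger0_norm (expR_ge0 _)) -[leRHS]mulr1.
  by apply: ler_pM => //; exact: cos_norm_le1.
(* Mean and deviation after completing the square, and the constant that factors out. *)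
pose m := - b / (1 + p); pose s := (Num.sqrt (1 + p))^-1.
pose C := s * expR (b ^+ 2 / (1 + p) / 2).
have peakE : normal_peak s = Num.sqrt (1 + p) * normal_peak 1 :> K.
  rewrite /normal_peak /s exprVn sqr_sqrtr ?ltW// expr1n mul1r.
  move: (@pi K) (@pi_gt0 K) => q q0.
  rewrite -mulrnAr sqrtrM ?invr_ge0 ?ltW// sqrtrV ?ltW// invfM invrK.
  by [].
transitivity (\int[lebesgue_measure]_x (C * (cos (c * x + a) * normal_pdf m s x))).
  apply: eq_Rintegral => x _.
  rewrite !normal_pdfE ?oner_neq0// /normal_fun peakE /C /s.
  rewrite exprVn sqr_sqrtr ?ltW//.
  set E := expR (- (p * _ / 2) - _); set F1 := expR (- (x - 0) ^+ 2 / _).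
  set D := expR (b ^+ 2 / _ / 2); set F2 := expR (- (x - m) ^+ 2 / _).
  have ef : E * F1 = D * F2.
    rewrite /E /F1 /D /F2 -!expRD; congr expR.
    by rewrite subr0 expr1n /m; field; rewrite gt_eqF.
  transitivity (cos (c * x + a) * normal_peak 1 * (E * F1)); first by ring.
  by rewrite ef; field.
rewrite RintegralZl//; last first.
  apply: (@integrable_normal_weight _ m s 1).
    by apply: measurable_funM => //; exact: measurable_normal_pdf.
  move=> x; rewrite normrM (ger0_norm (normal_pdf_ge0 _ _ _)) ler_wpM2r ?normal_pdf_ge0//.
  exact: cos_norm_le1.
rewrite -(@Rintegral_normal_lebesgue _ m s 1)//; last by move=> x; exact: cos_norm_le1.
rewrite Rintegral_cos_normal// /C /s exprVn sqr_sqrtr ?ltW//.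
rewrite mulrA -[_ * _ * expR _]mulrA -expRD; congr (_ * expR _ * cos _).
  by field; rewrite gt_eqF.
by rewrite /m; field; rewrite gt_eqF.
Qed.

(** Linearises a Gaussian factor in [z] (the Hubbard-Stratonovich trick): the right-hand side
    depends on [z] only through the frequency of a cosine. *)
Lemma expR_sqr_cos (K : realType) (z b : K) :
  expR (- (z ^+ 2 / 2)) * cos b = \int[normal_prob 0 1]_x cos (z * x + b).
Proof. by rewrite Rintegral_cos_normal ?oner_neq0// expr1n mul1r mulr0 add0r. Qed.

Lemma psdmx_form_sym (K : realType) r (P : 'M[K]_r) (u v : 'cV[K]_r) : P^T = P ->
  dot u (P *m v) = dot v (P *m u).
Proof. by move=> sP; rewrite dot_mulmx sP dotC. Qed.

Lemma qformD (K : realType) r (P : 'M[K]_r) (u v : 'cV[K]_r) : P^T = P ->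
  qform P (u + v) = qform P u + 2 * dot u (P *m v) + qform P v.
Proof.
move=> sP; rewrite !qformE mulmxDr dotDl !dotDr (psdmx_form_sym v u sP); ring.
Qed.

Lemma qformZ (K : realType) r (P : 'M[K]_r) a (u : 'cV[K]_r) :
  qform P (a *: u) = a ^+ 2 * qform P u.
Proof. by rewrite !qformE -scalemxAr dotZl dotZr mulrA expr2. Qed.

Lemma qformZl (K : realType) r (P : 'M[K]_r) a (u : 'cV[K]_r) :
  qform (a *: P) u = a * qform P u.
Proof. by rewrite !qformE -scalemxAl dotZr. Qed.

Lemma qformDl (K : realType) r (P Q : 'M[K]_r) (u : 'cV[K]_r) :
  qform (P + Q) u = qform P u + qform Q u.
Proof. by rewrite !qformE mulmxDl dotDr. Qed.

Lemma qformBl (K : realType) r (P Q : 'M[K]_r) (u : 'cV[K]_r) :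
  qform (P - Q) u = qform P u - qform Q u.
Proof. by rewrite !qformE mulmxBl dotBr. Qed.

Lemma outer_mulmx (K : realType) r (q x : 'cV[K]_r) : q *m q^T *m x = dot q x *: q.
Proof. by rewrite -mulmxA (mx11_scalar (q^T *m x)) -/(dot q x) mul_mx_scalar. Qed.

Lemma qform_outer (K : realType) r (q u : 'cV[K]_r) :
  qform (q *m q^T) u = dot q u ^+ 2.
Proof.
by rewrite qformE outer_mulmx dotZr (dotC u) expr2.
Qed.

Lemma qform_congr (K : realType) r s (P : 'M[K]_r) (M : 'M[K]_(s, r)) (u : 'cV[K]_s) :
  qform (M *m P *m M^T) u = qform P (M^T *m u).
Proof. by rewrite !qformE -!mulmxA dot_mulmx. Qed.

Lemma psdmx_Cauchy (K : realType) r (P : 'M[K]_r) (u v : 'cV[K]_r) : psdmx P ->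
  dot u (P *m v) ^+ 2 <= qform P u * qform P v.
Proof.
move=> [sP pP]; set b := dot u _.
have H t : 0 <= qform P u + 2 * t * b + t ^+ 2 * qform P v.
  have := pP (u + t *: v); rewrite qformD// qformZ -scalemxAr dotZr -/b.
  by rewrite mulrA.
have [v0|v0] := eqVneq (qform P v) 0.
  have [->|b0] := eqVneq b 0; first by rewrite expr0n /= v0 mulr0.
  (* When the quadratic coefficient vanishes the form is affine in [t]; this [t] would give it the
     value -1. *)
  have := H (- (qform P u + 1) / (2 * b)); rewrite v0 mulr0 addr0.
  have -> : qform P u + 2 * (- (qform P u + 1) / (2 * b)) * b = -1 by field.
  by rewrite ler0N1.
have vp : 0 < qform P v by rewrite lt_neqAle eq_sym v0 pP.
have := H (- b / qform P v).
have -> : qform P u + 2 * (- b / qform P v) * b + (- b / qform P v) ^+ 2 * qform P v =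
  (qform P u * qform P v - b ^+ 2) / qform P v by field.
by rewrite pmulr_lge0 ?invr_gt0// subr_ge0.
Qed.

(** The image under [X] of the measure [w] dPr is [c] times N(m, P), stated on transforms so that
    [P] may be singular. *)
Definition gaussian_transform (K : realType) r d (T : measurableType d)
    (Pr : probability T K) (X : T -> borelV K r) (w : T -> K) (c : K)
    (m : 'cV[K]_r) (P : 'M[K]_r) : Prop :=
  forall u a, \int[Pr]_x (w x * cos (dot u (X x) + a)) =
    c * (expR (- (qform P u / 2)) * cos (dot u m + a)).

(** Linearising the square with a standard normal variable y changes the frequency into u + y q;
    Fubini and a one-dimensional Gaussian integral in y give the new parameters, a rank-one update
    as in Kalman filtering. *)
Lemma gaussian_transform_tilt1 (K : realType) r d (T : measurableType d)
    (Pr : probability T K) (X : T -> borelV K r) (w : T -> K) (c C : K)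
    (m q : 'cV[K]_r) (P : 'M[K]_r) (p := qform P q) :
  measurable_fun setT X -> measurable_fun setT w -> (forall x, `|w x| <= C) ->
  psdmx P -> gaussian_transform Pr X w c m P ->
  gaussian_transform Pr X (fun x => w x * expR (- (dot q (X x) ^+ 2 / 2)))
    (c * ((Num.sqrt (1 + p))^-1 * expR (- (dot q m ^+ 2 / (1 + p) / 2))))
    (m - (dot q m / (1 + p)) *: (P *m q))
    (P - (1 + p)^-1 *: (P *m q *m (P *m q)^T)).
Proof.
move=> mX mw wC [sP pP] G u a.
have p0 : 0 < 1 + p by rewrite /p ltr_pwDl.
pose g := [the probability _ _ of @normal_prob K 0 1].
pose f (z : T * measurableTypeR K) := w z.1 * cos (dot q (X z.1) * z.2 + (dot u (X z.1) + a)).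
have mf : measurable_fun setT f.
  apply: measurable_funM; first exact: (measurableT_comp mw).
  apply: (measurableT_comp (@measurable_cos K)); apply: measurable_funD.
    by apply: measurable_funM => //; exact: (measurableT_comp (measurable_dot q mX)).
  by apply: measurable_funD => //; exact: (measurableT_comp (measurable_dot u mX)).
have fC z : `|f z| <= C.
  by rewrite /f normrM -[leRHS]mulr1 ler_pM// cos_norm_le1.
transitivity (\int[Pr]_x \int[g]_y f (x, y)).
  apply: eq_Rintegral => x _; rewrite -mulrA expR_sqr_cos /f /= RintegralZl//.
  apply: (@bounded_integrable _ _ _ g _ 1); last by move=> y; exact: cos_norm_le1.
  exact: measurable_cos_affine.
rewrite (@Rintegral_fubini _ _ _ _ _ Pr g f C mf fC).
pose b := dot u (P *m q).
transitivity (\int[g]_y (c * expR (- (qform P u / 2)) *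
    (expR (- (p * y ^+ 2 / 2) - b * y) * cos (dot q m * y + (dot u m + a))))).
  apply: eq_Rintegral => y _.
  transitivity (c * (expR (- (qform P (u + y *: q) / 2)) * cos (dot (u + y *: q) m + a))).
    rewrite -G; apply: eq_Rintegral => x _; rewrite /f /=; congr (_ * cos _).
    by rewrite dotDl dotZl; ring.
  rewrite -!mulrA; congr (c * _); rewrite [RHS]mulrA -expRD; congr (expR _ * cos _).
    by rewrite qformD// qformZ -scalemxAr dotZr -/b -/p; field.
  by rewrite dotDl dotZl; ring.
(* This is the positivity of [qform P] at u + y q. *)
have eB y : expR (- (p * y ^+ 2 / 2) - b * y) <= expR (qform P u / 2).
  have := pP (u + y *: q); rewrite qformD// qformZ -scalemxAr dotZr -/b -/p => h.
  rewrite ler_expR; lra.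
rewrite RintegralZl//; last first.
  apply: (@bounded_integrable _ _ _ g _ (expR (qform P u / 2))).
    apply: measurable_funM; last exact: measurable_cos_affine.
    apply: measurableT_comp => //; apply: measurable_funB; last exact: measurable_funM.
    by apply: measurableT_comp => //; apply: measurable_funM => //; exact: measurable_funM.
  move=> y; rewrite normrM (ger0_norm (expR_ge0 _)) -[leRHS]mulr1.
  by apply: ler_pM => //; exact: cos_norm_le1.
rewrite (Rintegral_gauss_weight _ _ p0 eB).
rewrite qformBl qformZl qform_outer (dotC _ u) -/b dotBr dotZr -/b.
set e1 := expR _; set e2 := expR _; set e3 := expR _; set e4 := expR _.
have ee : e1 * e2 = e3 * e4.
  by rewrite /e1 /e2 /e3 /e4 -!expRD; congr expR; field; rewrite gt_eqF.
have -> : dot u m + a - dot q m * b / (1 + p) = dot u m - dot q m / (1 + p) * b + a by ring.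
set cc := cos _; set ss := (Num.sqrt _)^-1.
transitivity (c * ss * (e1 * e2) * cc); first by ring.
by rewrite ee; ring.
Qed.

Lemma psdmx_tilt1 (K : realType) r (P : 'M[K]_r) (q : 'cV[K]_r) : psdmx P ->
  psdmx (P - (1 + qform P q)^-1 *: (P *m q *m (P *m q)^T)).
Proof.
move=> pP; have [sP P0] := pP; split.
  by rewrite linearB /= linearZ /= trmx_mul trmxK sP.
move=> u; have p0 : 0 < 1 + qform P q by rewrite ltr_pwDl.
rewrite qformBl qformZl qform_outer subr_ge0 mulrC ler_pdivrMr// dotC.
apply: le_trans (psdmx_Cauchy u q pP) _.
by rewrite ler_wpM2l// lerDr.
Qed.

Lemma psdmx_outer (K : realType) r (q : 'cV[K]_r) : psdmx (q *m q^T).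
Proof.
split; first by rewrite trmx_mul trmxK.
by move=> x; rewrite qform_outer sqr_ge0.
Qed.

Lemma psdmxD (K : realType) r (P Q : 'M[K]_r) : psdmx P -> psdmx Q -> psdmx (P + Q).
Proof.
move=> [sP pP] [sQ pQ]; split; first by rewrite linearD /= sP sQ.
by move=> x; rewrite qformDl addr_ge0.
Qed.

Lemma psdmx0 (K : realType) r : psdmx (0 : 'M[K]_r).
Proof. by split; [rewrite trmx0|move=> x; rewrite qformE mul0mx dot0r]. Qed.

Lemma psdmx_sum_outer (K : realType) r (s : seq 'cV[K]_r) :
  psdmx (\sum_(q <- s) q *m q^T).
Proof.
elim: s => [|q s IH]; first by rewrite big_nil; exact: psdmx0.
by rewrite big_cons; apply: psdmxD => //; exact: psdmx_outer.
Qed.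

(** Cholesky elimination: each step subtracts one outer product and clears one more row, the
    remainder staying positive semi-definite by Cauchy-Schwarz. *)
Lemma psdmx_decomposition (K : realType) r (P : 'M[K]_r) : psdmx P ->
  exists s : seq 'cV[K]_r, P = \sum_(q <- s) q *m q^T.
Proof.
suff H k : (k <= r)%N -> psdmx P -> exists s : seq 'cV[K]_r,
    psdmx (P - \sum_(q <- s) q *m q^T) /\
    forall i j : 'I_r, (i < k)%N -> (P - \sum_(q <- s) q *m q^T) i j = 0.
  move=> pP; have [s [_ s0]] := H r (leqnn r) pP; exists s.
  by apply/eqP; rewrite -subr_eq0; apply/eqP/matrixP => i j; rewrite s0 ?mxE.
elim: k => [|k IH] kr pP.
  by exists [::]; rewrite big_nil subr0.
have [s [pS s0]] := IH (ltnW kr) pP.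
set N := P - _ in pS s0.
pose i := Ordinal kr; pose e : 'cV[K]_r := delta_mx i 0.
have [sN N0] := pS.
have Ne j : (N *m e) j 0 = N j i by rewrite -colE mxE.
have Nij j : N j i = N i j by rewrite -[in LHS]sN mxE.
have qN : qform N e = N i i by rewrite qformE dot_delta Ne.
(* If the pivot is zero, Cauchy-Schwarz forces its whole row to vanish, so nothing has to be
   subtracted. *)
have [Nii|Nii] := eqVneq (N i i) 0.
  exists s; split => // i' j; rewrite ltnS leq_eqVlt => /orP[/eqP ik|]; last exact: s0.
  have -> : i' = i by apply: val_inj.
  have := psdmx_Cauchy (delta_mx j 0) e pS.
  by rewrite dot_delta Ne qN Nii mulr0 Nij => h; apply/eqP; rewrite -sqrf_eq0 eq_le h sqr_ge0.
have Np : 0 < N i i by rewrite lt_neqAle eq_sym Nii -qN N0.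
pose q := (Num.sqrt (N i i))^-1 *: (N *m e).
have qq : q *m q^T = (N i i)^-1 *: (N *m e *m (N *m e)^T).
  rewrite /q linearZ /= -scalemxAl -scalemxAr scalerA -invfM -expr2 sqr_sqrtr//.
  exact: ltW.
exists (q :: s); rewrite big_cons opprD addrCA addrC -/N; split.
  split; first by rewrite linearB /= sN qq linearZ /= trmx_mul trmxK.
  move=> x; rewrite qformBl qq qformZl qform_outer subr_ge0 mulrC ler_pdivrMr//.
  by rewrite dotC -qN; exact: psdmx_Cauchy.
move=> i' j i'k.
have NE : (N - q *m q^T) i' j = N i' j - (N i i)^-1 * (N i' i * N j i).
  have oE (a : 'cV[K]_r) k1 k2 : (a *m a^T) k1 k2 = a k1 0 * a k2 0.
    by rewrite mxE big_ord1 mxE.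
  by rewrite qq [LHS]mxE [X in _ + X]mxE [X in _ - X]mxE oE !Ne.
rewrite NE; move: i'k; rewrite ltnS leq_eqVlt => /orP[/eqP ik|ik].
  have -> : i' = i by apply: val_inj.
  by rewrite mulrA mulVf// mul1r Nij subrr.
by rewrite !(s0 i')// mul0r mulr0 subrr.
Qed.

Lemma psdmx_qform0 (K : realType) r (P : 'M[K]_r) (x : 'cV[K]_r) : psdmx P ->
  qform P x = 0 -> P *m x = 0.
Proof.
move=> pP x0; apply/matrixP => i j; rewrite (ord1 j) -dot_delta mxE.
have := psdmx_Cauchy (delta_mx i 0) x pP; rewrite x0 mulr0 => h.
by apply/eqP; rewrite -sqrf_eq0 eq_le h sqr_ge0.
Qed.

Lemma unitmx_ker0 (K : fieldType) r (M : 'M[K]_r) :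
  (forall x : 'cV[K]_r, M *m x = 0 -> x = 0) -> M \in unitmx.
Proof.
move=> h; rewrite -unitmx_tr -row_free_unit -kermx_eq0.
apply/eqP/row_matrixP => i; rewrite row0.
apply: trmx_inj; rewrite trmx0; apply: h.
apply: trmx_inj; rewrite trmx_mul !trmxK trmx0.
by apply/sub_kermxP; rewrite row_sub.
Qed.

(** If x = - P Q x, then P evaluated at Q x equals - x^T Q x <= 0, so P Q x = 0 and x = 0. *)
Lemma unitmx_1DPQ (K : realType) r (P Q : 'M[K]_r) : psdmx P -> psdmx Q ->
  1%:M + P *m Q \in unitmx.
Proof.
move=> pP pQ; apply: unitmx_ker0 => x.
rewrite mulmxDl mul1mx -mulmxA => /eqP; rewrite addr_eq0 => /eqP xE.
have [sP P0] := pP; have [sQ Q0] := pQ.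
suff Px : qform P (Q *m x) = 0 by rewrite xE (psdmx_qform0 pP Px) oppr0.
apply/eqP; rewrite eq_le P0 andbT.
by have := Q0 x; rewrite qformE {1}xE dotNl oppr_ge0 dotC -qformE.
Qed.

(** Tilting N(m, P) by exp(- x^T Q x / 2) gives, up to a factor, the Gaussian with mean
    [tiltmx P Q *m m] and covariance [tiltmx P Q *m P]. *)
Definition tiltmx (K : realType) r (P Q : 'M[K]_r) : 'M[K]_r := invmx (1%:M + P *m Q).

(** The transpose is the inverse of 1 + Q P, and Q passes through by (1 + Q P) Q = Q (1 + P Q). *)
Lemma tiltmx_tr (K : realType) r (P Q : 'M[K]_r) : psdmx P -> psdmx Q ->
  (tiltmx P Q)^T = 1%:M - Q *m tiltmx P Q *m P.
Proof.
move=> pP pQ; have [sP _] := pP; have [sQ _] := pQ.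
have U := unitmx_1DPQ pP pQ; have U' := unitmx_1DPQ pQ pP.
rewrite /tiltmx trmx_inv linearD /= trmx1 trmx_mul sP sQ.
apply: (can_inj (mulKmx U')); rewrite mulmxV//.
have e : (1%:M + Q *m P) *m Q = Q *m (1%:M + P *m Q).
  by rewrite mulmxDl mulmxDr mul1mx mulmx1 mulmxA.
by rewrite mulmxBr mulmx1 !mulmxA e -(mulmxA Q) mulmxV// mulmx1 addrK.
Qed.

(** With L the tilt, L P = L (P + P Q P) L^T is a congruence of a positive semi-definite matrix. *)
Lemma psdmx_tilt (K : realType) r (P Q : 'M[K]_r) : psdmx P -> psdmx Q ->
  psdmx (tiltmx P Q *m P).
Proof.
move=> pP pQ; have [sP P0] := pP; have [sQ Q0] := pQ.
have U := unitmx_1DPQ pP pQ.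
have E : tiltmx P Q *m P = tiltmx P Q *m (P + P *m Q *m P) *m (tiltmx P Q)^T.
  have -> : P + P *m Q *m P = P *m (1%:M + P *m Q)^T.
    by rewrite linearD /= trmx1 trmx_mul sP sQ mulmxDr mulmx1 mulmxA.
  rewrite -!mulmxA -trmx_mul mulVmx//.
  by rewrite trmx1 mulmx1.
rewrite E; split.
  by rewrite !trmx_mul trmxK linearD /= !trmx_mul sP sQ !mulmxA.
move=> x; rewrite qform_congr qformDl addr_ge0//.
by rewrite -{2}sP qform_congr.
Qed.

(** Induction on a decomposition of [Q] into outer products. The constant [k], equal to det(1 + P
    Q)^(-1/2), is quantified before the mean and the space: along a chain the same factor must come
    out at every state. *)
Theorem gaussian_transform_tilt (K : realType) r (P Q : 'M[K]_r) :
  psdmx P -> psdmx Q -> exists2 k : K, 0 < k &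
  forall d (T : measurableType d) (Pr : probability T K) (X : T -> borelV K r)
    (w : T -> K) (c C : K) (m : 'cV[K]_r),
  measurable_fun setT X -> measurable_fun setT w -> (forall x, `|w x| <= C) ->
  gaussian_transform Pr X w c m P ->
  gaussian_transform Pr X (fun x => w x * h0 Q (X x))
    (c * (k * expR (- (qform (Q *m tiltmx P Q) m / 2))))
    (tiltmx P Q *m m) (tiltmx P Q *m P).
Proof.
move=> pP pQ; have [s sQ] := psdmx_decomposition pQ.
elim: s P Q pP pQ sQ => [|q s IH] P Q pP pQ sQ.
  exists 1 => // d T Pr X w c C m mX mw wC G u a.
  have Q0 : Q = 0 by rewrite sQ big_nil.
  have t1 : tiltmx P Q = 1%:M by rewrite /tiltmx Q0 mulmx0 addr0 invmx1.
  rewrite t1 !mul1mx Q0 mul0mx qformE mul0mx dot0r mul0r oppr0 expR0 !mulr1 -G.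
  apply: eq_Rintegral => x _.
  by rewrite /h0 qformE mul0mx dot0r mul0r oppr0 expR0 mulr1.
set Q2 := \sum_(q <- s) q *m q^T.
have QE : Q = q *m q^T + Q2 by rewrite sQ big_cons.
have pQ2 : psdmx Q2 by exact: psdmx_sum_outer.
set p := qform P q.
have p0 : 0 < 1 + p by rewrite /p ltr_pwDl//; have [_] := pP.
have pP' := psdmx_tilt1 q pP.
set P' := P - _ in pP'.
have [k k0 Hk] := IH P' Q2 pP' pQ2 erefl.
(* Sherman-Morrison inverse of 1 + P q q^T, the tilt by q q^T alone. *)
pose L1 := 1%:M - (1 + p)^-1 *: (P *m q *m q^T).
pose L2 := tiltmx P' Q2.
have [sP _] := pP; have [sP' _] := pP'.
have qPq : q^T *m (P *m q) = p%:M.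
  by rewrite [LHS]mx11_scalar /p qformE.
have LP : L1 *m P = P'.
  by rewrite /L1 mulmxBl mul1mx -scalemxAl /P' trmx_mul sP !mulmxA.
have L1E : (1%:M + P *m (q *m q^T)) *m L1 = 1%:M.
  have e : P *m (q *m q^T) *m (P *m q *m q^T) = p *: (P *m q *m q^T).
    rewrite !mulmxA -(mulmxA (P *m q)) -(mulmxA (P *m q)).
    by rewrite -[q^T *m P *m q]mulmxA qPq mul_mx_scalar -scalemxAl.
  rewrite /L1 mulmxBr mulmx1 -scalemxAr mulmxDl mul1mx e mulmxA.
  rewrite -[X in _ *: (X + _)]scale1r -scalerDl scalerA mulVf ?gt_eqF//.
  by rewrite scale1r addrK.
(* Successive tilts compose: 1 + P Q factors as (1 + P q q^T) (1 + P' Q2), where [P'] is the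
   covariance after the first tilt. *)
have LE : tiltmx P Q = L2 *m L1.
  have U := unitmx_1DPQ pP pQ.
  apply: (can_inj (mulKmx U)); rewrite /tiltmx mulmxV//.
  have NE : 1%:M + P *m Q = (1%:M + P *m (q *m q^T)) *m (1%:M + P' *m Q2).
    rewrite mulmxDr mulmx1 -LP -!mulmxA (mulmxA _ L1) L1E mul1mx QE mulmxDr addrA.
    by [].
  rewrite NE (mulmxA _ L2) -(mulmxA _ _ L2) /L2 /tiltmx mulmxV ?unitmx_1DPQ// mulmx1.
  by rewrite L1E.
exists ((Num.sqrt (1 + p))^-1 * k).
  by rewrite mulr_gt0// invr_gt0 sqrtr_gt0.
move=> d T Pr X w c C m mX mw wC G.
have G1 := gaussian_transform_tilt1 q mX mw wC pP G.
rewrite -/p -/P' in G1.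
have m1E : m - (dot q m / (1 + p)) *: (P *m q) = L1 *m m.
  rewrite /L1 mulmxBl mul1mx -scalemxAl -(mulmxA P) -[P *m _ *m m]mulmxA.
  by rewrite outer_mulmx -scalemxAr scalerA mulrC.
rewrite m1E in G1.
have mw1 : measurable_fun setT (fun x => w x * expR (- (dot q (X x) ^+ 2 / 2))).
  apply: measurable_funM => //; apply: measurableT_comp => //; apply: measurableT_comp => //.
  by apply: measurable_funM => //; apply: measurable_funX; exact: measurable_dot.
have wC1 x : `|w x * expR (- (dot q (X x) ^+ 2 / 2))| <= C.
  rewrite normrM (ger0_norm (expR_ge0 _)) -[leRHS]mulr1 ler_pM ?expR_ge0//.
  by rewrite -[leRHS]expR0 ler_expR oppr_le0 divr_ge0 ?sqr_ge0.
have G2 := Hk _ _ _ _ _ _ _ _ mX mw1 wC1 G1.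
have eP : L2 *m P' = tiltmx P Q *m P by rewrite -LP mulmxA -LE.
have em : L2 *m (L1 *m m) = tiltmx P Q *m m by rewrite mulmxA -LE.
rewrite -/L2 eP em in G2.
have hE x : w x * expR (- (dot q (X x) ^+ 2 / 2)) * h0 Q2 (X x) = w x * h0 Q (X x).
  rewrite -mulrA /h0 -expRD QE qformDl qform_outer; congr (_ * expR _); ring.
(* The exponents of the two successive normalising factors add up to that of the full tilt; [y] is
   the mean after both tilts. *)
have eE : dot q m ^+ 2 / (1 + p) + qform (Q2 *m L2) (L1 *m m) = qform (Q *m tiltmx P Q) m.
  pose y := L2 *m (L1 *m m); pose z := Q2 *m y.
  have yE : y = L1 *m m - P' *m z.
    have := congr1 (fun M => M *m (L1 *m m)) (mulmxV (unitmx_1DPQ pP' pQ2)).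
    rewrite mul1mx -mulmxA -/(tiltmx P' Q2) -/L2 -/y mulmxDl mul1mx -mulmxA -/z => <-.
    by rewrite addrK.
  have qPz : dot q (P *m z) = dot (P *m q) z by rewrite dot_mulmx sP.
  have qy : dot q y = (dot q m - dot (P *m q) z) / (1 + p).
    rewrite yE -m1E !dotBr dotZr -qformE -/p /P' mulmxBl dotBr -scalemxAl dotZr.
    rewrite outer_mulmx.
    by rewrite dotZr -qformE -/p qPz; field; rewrite gt_eqF.
  rewrite !qformE LE -!mulmxA -/y -/z QE mulmxDl dotDr -/z outer_mulmx dotZr qy.
  rewrite -m1E dotBl dotZl (dotC m q); field; rewrite gt_eqF//.
move=> u a; have := G2 u a; under eq_Rintegral do rewrite hE.
move=> ->; rewrite -eE -mulrA.
have -> : expR (- ((dot q m ^+ 2 / (1 + p) + qform (Q2 *m L2) (L1 *m m)) / 2)) =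
  expR (- (dot q m ^+ 2 / (1 + p) / 2)) * expR (- (qform (Q2 *m L2) (L1 *m m) / 2)).
  by rewrite -expRD; congr expR; ring.
ring.
Qed.

(** * Gaussian vectors *)

Definition mfun_of d d' (T : measurableType d) (T' : measurableType d') (f : T -> T')
    (mf : measurable_fun setT f) : {mfun T >-> T'} :=
  HB.pack f (isMeasurableFun.Build _ _ _ _ f mf).

Lemma Rintegral_distribution d d' (T : measurableType d) (T' : measurableType d')
    (K : realType) (Pr : probability T K) (X : {mfun T >-> T'}) (f : T' -> K) C :
  measurable_fun setT f -> (forall x, `|f x| <= C) ->
  \int[distribution Pr X]_y f y = \int[Pr]_x f (X x).
Proof.
move=> mf fC; rewrite /Rintegral integral_distribution//.
  exact/measurable_EFinP.
apply: (@bounded_integrable _ _ _ Pr (f \o X) C) => [|x]; last exact: fC.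
exact: (measurableT_comp mf (@measurable_funPT _ _ _ _ X)).
Qed.

Lemma same_measure_Rintegral d (T : measurableType d) (K : realType)
    (P1 P2 : probability T K) (f : T -> K) :
  same_measure P1 P2 -> \int[P1]_x f x = \int[P2]_x f x.
Proof.
by move=> P12; congr fine; apply: eq_measure_integral => A mA _; exact: P12.
Qed.

Lemma Rintegral_dirac d (T : measurableType d) (K : realType) (a : T) (f : T -> K) :
  measurable_fun setT f -> \int[\d_a]_x f x = f a.
Proof.
move=> mf; rewrite /Rintegral integral_dirac//; last exact/measurable_EFinP.
by rewrite diracT mul1e.
Qed.

Lemma Rintegral_cos_normal_law (K : realType) (m v th a : K)
    (N : probability (measurableTypeR K) K) : 0 <= v -> same_measure N (normal_law m v) ->
  \int[N]_y cos (th * y + a) = expR (- (v * th ^+ 2 / 2)) * cos (th * m + a).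
Proof.
rewrite /normal_law => v0; case: eqP => [->|/eqP vn0] NE.
  rewrite (same_measure_Rintegral _ (P2 := \d_(m : measurableTypeR K)))//.
  by rewrite Rintegral_dirac; [rewrite mul0r mul0r oppr0 expR0 mul1r|exact: measurable_cos_affine].
rewrite (same_measure_Rintegral _ (P2 := [the probability _ _ of normal_prob m (Num.sqrt v)]))//.
rewrite Rintegral_cos_normal ?sqr_sqrtr//.
by rewrite sqrtr_eq0 -ltNge lt_neqAle eq_sym vn0.
Qed.

Lemma is_gaussian_transform (K : realType) r d (T : measurableType d)
    (Pr : probability T K) (X : {mfun T >-> borelV K r}) (m : 'cV[K]_r) (P : 'M[K]_r) :
  is_gaussian m P (pushforward Pr X) -> gaussian_transform Pr X (fun=> 1) 1 m P.
Proof.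
move=> [[_ P0] G] u a; rewrite mul1r.
have mY : measurable_fun setT ((fun t => dot u (X t)) : T -> measurableTypeR K).
  exact: measurable_dot.
have H := @Rintegral_cos_normal_law K (dot u m) (qform P u) 1 a
  [the probability _ _ of distribution Pr (mfun_of mY)] (P0 u) (G u).
transitivity (\int[distribution Pr (mfun_of mY)]_y cos (1 * y + a)).
  rewrite (Rintegral_distribution _ _ (C := 1)).
  - by apply: eq_Rintegral => x _; rewrite !mul1r.
  - exact: measurable_cos_affine.
  - by move=> y; exact: cos_norm_le1.
by rewrite H expr1n mulr1 mul1r.
Qed.

Lemma measurable_scalar_mx (K : realType) :
  measurable_fun setT (fun y : measurableTypeR K => y%:M : borelV K 1).
Proof.
apply: measurable_borelV => i; rewrite (_ : (fun t => _) = id) //.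
by apply/funext => y; rewrite mxE (ord1 i) eqxx.
Qed.

Lemma dot_scalar (K : realType) (u : 'cV[K]_1) (y : K) : dot u y%:M = u 0 0 * y.
Proof. by rewrite dotE big_ord1 [X in _ * X]mxE eqxx. Qed.

(** Each linear functional has the transform of a one-dimensional normal law; uniqueness is applied
    after embedding scalars as 1 x 1 vectors. *)
Lemma gaussian_transform_is_gaussian (K : realType) r d (T : measurableType d)
    (Pr : probability T K) (X : {mfun T >-> borelV K r}) (m : 'cV[K]_r) (P : 'M[K]_r) :
  psdmx P -> gaussian_transform Pr X (fun=> 1) 1 m P -> is_gaussian m P (pushforward Pr X).
Proof.
move=> pP G; split => // u D mD.
have [_ P0] := pP.
have mY : measurable_fun setT ((fun t => dot u (X t)) : T -> measurableTypeR K).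
  exact: measurable_dot.
pose D1 : set (borelV K 1) := [set v : 'cV[K]_1 | D (v 0 0)].
have mD1 : measurable D1.
  rewrite -[D1]setTI; exact: (@measurable_coord K 1 ord0 measurableT D mD).
(* Stated for any reference law [N], so that the Dirac and the nondegenerate case of [normal_law]
   share the argument. *)
have key (N : probability (measurableTypeR K) K) :
    (forall th a, \int[N]_y cos (th * y + a) =
      expR (- (qform P u * th ^+ 2 / 2)) * cos (th * dot u m + a)) ->
    (Pr ((fun t => dot u (X t)) @^-1` D) = N D)%E.
  move=> HN.
  have := @cos_transform_unique K 1 _ _ T (measurableTypeR K) Pr N
    (fun t => (dot u (X t))%:M) (fun y => y%:M) (fun=> 1) (fun=> 1) 1
    (measurableT_comp (@measurable_scalar_mx K) mY) (@measurable_scalar_mx K)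
    (measurable_cst _) (measurable_cst _).
  have n1 : forall S (x : S), `|1 : K| <= 1 by move=> *; rewrite normr1.
  move=> /(_ (n1 _) (n1 _)) H.
  have HC u' a : \int[Pr]_x (1 * cos (dot u' (dot u (X x))%:M + a)) =
      \int[N]_x (1 * cos (dot u' x%:M + a)).
    under eq_Rintegral do rewrite mul1r dot_scalar.
    under [RHS]eq_Rintegral do rewrite mul1r dot_scalar.
    rewrite HN; have := G (u' 0 0 *: u) a.
    under eq_Rintegral do rewrite mul1r dotZl.
    by move=> ->; rewrite mul1r qformZ dotZl (mulrC (_ ^+ 2)).
  have {H} := H HC D1 mD1.
  have iE dS (S : measurableType dS) (Q : probability S K) (f : S -> 'cV[K]_1) :
      measurable (f @^-1` D1) ->
      \int[Q]_x (1 * (\1_D1 : 'cV[K]_1 -> K) (f x)) = fine (Q (f @^-1` D1)).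
    move=> mf; under eq_Rintegral do rewrite mul1r.
    rewrite /Rintegral (_ : (fun x => _) = EFin \o \1_(f @^-1` D1)).
      by rewrite integral_indic// setIT.
    by apply/funext => x; rewrite /= !indicE; congr (_%:R%:E); apply/idP/idP; rewrite !inE.
  have pE : (fun t => (dot u (X t))%:M) @^-1` D1 = (fun t => dot u (X t)) @^-1` D.
    by apply/seteqP; split => t; rewrite /D1 /= mxE eqxx.
  have pE2 : (fun y : K => y%:M) @^-1` D1 = D.
    by apply/seteqP; split => t; rewrite /D1 /= mxE eqxx.
  have mpre : measurable ((fun t => dot u (X t)) @^-1` D).
    by have := mY measurableT D mD; rewrite setTI.
  rewrite !iE ?pE ?pE2// => H.
  rewrite -(fineK (fin_num_measure Pr _ mpre)).
  by rewrite -[RHS](fineK (fin_num_measure N _ mD)) H.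
rewrite /pushforward /normal_law; have [v0|v0] := eqVneq (qform P u) 0; apply: (key _) => th a.
  rewrite (@Rintegral_dirac _ (measurableTypeR K)); last exact: measurable_cos_affine.
  by rewrite v0 mul0r mul0r oppr0 expR0 mul1r.
by rewrite Rintegral_cos_normal ?sqr_sqrtr// sqrtr_eq0 -ltNge lt_neqAle eq_sym v0 P0.
Qed.

(** The vector is m plus independent standard normal multiples of the vectors of a decomposition of
    [P], the space being enlarged by one factor at a time. *)
Lemma gaussian_vector_exists (K : realType) r (m : 'cV[K]_r) (P : 'M[K]_r) : psdmx P ->
  exists d (T : measurableType d) (Pr : probability T K) (X : {mfun T >-> borelV K r}),
    gaussian_transform Pr X (fun=> 1) 1 m P.
Proof.
move=> /psdmx_decomposition [s ->]; elim: s => [|q s [d [T [Pr [X G]]]]].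
  exists _, (borelV K r), [the probability _ _ of \d_(m : borelV K r)].
  exists (mfun_of (@measurable_id _ (borelV K r) setT)) => u a /=.
  under eq_Rintegral do rewrite mul1r.
  rewrite (@Rintegral_dirac _ (borelV K r)); last first.
    exact: (measurable_cos_dot u a (@measurable_id _ (borelV K r) setT)).
  by rewrite big_nil qformE mul0mx dot0r mul0r oppr0 expR0 !mul1r.
pose g := [the probability _ _ of @normal_prob K 0 1].
have mX : measurable_fun setT (fun z : T * measurableTypeR K =>
    (X z.1 : 'cV[K]_r) + z.2 *: q : borelV K r).
  apply: measurable_borelV => i.
  rewrite (_ : (fun t => _) = fun z : T * measurableTypeR K =>
      (X z.1 : 'cV[K]_r) i 0 + z.2 * q i 0); last by apply/funext => z; rewrite !mxE.
  apply: measurable_funD; last exact: measurable_funM.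
  by apply: (measurableT_comp (measurable_coord i)); exact: measurableT_comp.
exists _, _, [the probability _ _ of (Pr \x g)%E], (mfun_of mX) => u a.
under eq_Rintegral do rewrite mul1r.
have mf : measurable_fun setT (fun z : T * measurableTypeR K =>
    cos (dot u ((X z.1 : 'cV[K]_r) + z.2 *: q) + a)).
  exact: (measurable_cos_dot u a mX).
rewrite (@Rintegral_prod _ _ _ _ _ Pr g _ 1 mf); last by move=> z; exact: cos_norm_le1.
transitivity (\int[Pr]_x (expR (- (dot u q ^+ 2 / 2)) * (1 * cos (dot u (X x) + a)))).
  apply: eq_Rintegral => x _; rewrite mul1r expR_sqr_cos; apply: eq_Rintegral => y _ /=.
  by congr cos; rewrite dotDr dotZr; ring.
rewrite RintegralZl//; last first.
  apply: (@bounded_integrable _ _ _ Pr _ 1).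
    by apply: measurable_funM => //; exact: measurable_cos_dot.
  by move=> x; rewrite mul1r cos_norm_le1.
rewrite G !mul1r mulrA -expRD big_cons qformDl qform_outer (dotC q).
by congr (expR _ * _); field.
Qed.

Lemma gaussian_measure_exists (K : realType) r (m : 'cV[K]_r) (P : 'M[K]_r) : psdmx P ->
  exists N : probability (borelV K r) K,
    gaussian_transform N id (fun=> 1) 1 m P.
Proof.
move=> /(gaussian_vector_exists m)[d [T [Pr [X G]]]].
exists [the probability _ _ of distribution Pr X] => u a; rewrite -G.
under eq_Rintegral do rewrite mul1r.
rewrite (@Rintegral_distribution _ _ _ (borelV K r) _ _ _ _ 1).
- by under [RHS]eq_Rintegral do rewrite mul1r.
- exact: (measurable_cos_dot u a (@measurable_id _ (borelV K r) setT)).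
- by move=> x; exact: cos_norm_le1.
Qed.

Lemma boltzmann_inv d (T : measurableType d) (K : realType)
    (eta nu : probability T K) (g : T -> K) (Z : \bar K) :
  measurable_fun setT g -> (forall x, 0 < g x) -> (0 < Z < +oo)%E ->
  (forall C, measurable C -> nu C = (\int[eta]_(x in C) (g x)%:E) / Z)%E ->
  forall C, measurable C -> (\int[nu]_(x in C) ((g x)^-1)%:E = eta C / Z)%E.
Proof.
move=> mg g0; case: Z => [z| |] /=; rewrite ?ltxx ?andbF// ltry andbT lte_fin => z0 nuE C mC.
have mgV : measurable_fun setT (fun x => (g x)^-1).
  (* The inverse of a positive function is exp(- ln g), a composition of measurable maps. *)
  rewrite (_ : (fun x => _) = expR \o (fun x => - ln (g x))).
    apply: measurableT_comp => //; apply: measurableT_comp => //.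
    by apply: (measurableT_comp (@measurable_ln K)).
  by apply/funext => x; rewrite /= expRN lnK ?posrE.
have nuE' A : measurable A -> (nu A = \int[eta]_(x in A) (g x / z)%:E)%E.
  move=> mA; rewrite nuE// inver gt_eqF//.
  under [RHS]eq_integral do rewrite EFinM.
  rewrite ge0_integralZr ?lee_fin ?invr_ge0 ?ltW//.
  - apply/measurable_EFinP; exact: measurable_funTS.
  - by move=> x _; rewrite lee_fin ltW.
rewrite integral_mkcond.
have mI : measurable_fun setT ((fun x => ((g x)^-1)%:E) \_ C).
  apply: (measurable_restrictT _ mC).1; apply/measurable_EFinP.
  exact: measurable_funTS.
rewrite (@integral_density _ _ _ eta nu (fun x => g x / z))//.
- rewrite muleC; have -> : eta C = (\int[eta]_x (\1_C x)%:E)%E by rewrite integral_indic// setIT.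
  rewrite -ge0_integralZl//=.
  + apply: eq_integral => x _; rewrite patchE indicE; case: (x \in C).
      rewrite inver gt_eqF//= mule1 -?EFinM; congr (_%:E).
      by field; rewrite !gt_eqF.
    by rewrite mule0 ?mul0e ?mul0r.
  + by apply/measurable_EFinP.
  + by rewrite inver gt_eqF// lee_fin invr_ge0 ltW.
- exact: measurable_funM.
- by move=> x; rewrite divr_ge0 ?ltW.
- by move=> x; rewrite patchE; case: ifP => // _; rewrite lee_fin invr_ge0 ltW.
Qed.

(** * Independence, Riemann sums and killing *)

Lemma indep_Rintegral d d1 d2 (T : measurableType d) (T1 : measurableType d1)
    (T2 : measurableType d2) (K : realType) (Pr : probability T K)
    (Y : {mfun T >-> T1}) (Z : {mfun T >-> T2}) (f : T1 * T2 -> K) C :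
  (forall A B, measurable A -> measurable B ->
    (Pr (Y @^-1` A `&` Z @^-1` B) = Pr (Y @^-1` A) * Pr (Z @^-1` B))%E) ->
  measurable_fun setT f -> (forall z, `|f z| <= C) ->
  \int[Pr]_t f (Y t, Z t) = \int[Pr]_t \int[distribution Pr Z]_z f (Y t, z).
Proof.
move=> ind mf fC.
have mYZ : measurable_fun setT (fun t => (Y t, Z t)) by exact: measurable_fun_pair.
pose PY := [the probability _ _ of distribution Pr Y].
pose PZ := [the probability _ _ of distribution Pr Z].
transitivity (\int[distribution Pr (mfun_of mYZ)]_z f z).
  by rewrite (Rintegral_distribution _ _ mf fC).
rewrite (@same_measure_Rintegral _ _ _ [the probability _ _ of distribution Pr (mfun_of mYZ)]
    [the probability _ _ of (PY \x PZ)%E]).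
  rewrite (Rintegral_prod PY PZ mf fC) (@Rintegral_distribution _ _ _ _ _ _ _ _ C)//.
    exact: measurable_Rintegral_section mf fC.
  move=> x; apply: le_norm_Rintegral => //.
  exact: measurableT_comp.
move=> A mA; apply/esym/product_measure_unique => // B D mB mD.
Qed.

(** The first variable is the identity of [T] towards its own coarser sigma-algebra. This plays the
    role of conditioning on the past: the integrand may depend on it in any measurable way. *)
Lemma indep_Rintegral_sub d d2 (T : measurableType d)
    (T2 : measurableType d2) (K : realType) (Pr : probability T K)
    (G : set_system T) (Z : {mfun T >-> T2})
    (f : g_sigma_algebraType G * T2 -> K) C :
  G `<=` measurable -> indep_systems Pr <<s G >> (sigma_rv Z) ->
  measurable_fun setT f -> (forall z, `|f z| <= C) ->
  \int[Pr]_t f (t, Z t) = \int[Pr]_t \int[distribution Pr Z]_z f (t, z).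
Proof.
move=> Gm ind mf fC.
have mid : measurable_fun setT (id : T -> g_sigma_algebraType G).
  move=> _ A mA; rewrite setTI preimage_id.
  exact: (smallest_sub (@sigma_algebra_measurable _ T) Gm).
apply: (indep_Rintegral (Y := mfun_of mid) _ mf fC) => A B mA mB.
by apply: ind => //; exists B => //; rewrite setTI.
Qed.

Lemma sigma_process_sub d (T : measurableType d) (K : realType) n (I : set K)
    (X : K -> {mfun T >-> borelV K n}) : sigma_process I X `<=` measurable.
Proof.
apply: smallest_sub; first exact: sigma_algebra_measurable.
by move=> A [s _ [B mB <-]]; exact: measurable_funP.
Qed.

Lemma sigma_rv_sub d d' (T : measurableType d) (T' : measurableType d')
    (Y : {mfun T >-> T'}) : sigma_rv Y `<=` measurable.
Proof. by move=> A [B mB <-]; exact: measurable_funP. Qed.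

Lemma sigma_process_mono d (T : measurableType d) (K : realType) n (I J : set K)
    (X : K -> {mfun T >-> borelV K n}) : I `<=` J ->
  sigma_process I X `<=` sigma_process J X.
Proof.
move=> IJ; apply: smallest_sub; first exact: smallest_sigma_algebra.
by move=> A [s Is sA]; apply: sub_sigma_algebra; exists s => //; exact: IJ.
Qed.

Lemma measurable_increment d (T : measurableType d) (K : realType) n
    (X : K -> {mfun T >-> borelV K n}) s t : measurable_fun setT (increment X s t).
Proof. exact: measurable_submx. Qed.

(** The increment is independent of the past of [W], and [X0] of all of [W]; together they give
    independence from the joint past, which is tested on intersections of one event of each kind. *)
Lemma indep_join d d1 (T : measurableType d) (T1 : measurableType d1) (K : realType)
    (Pr : probability T K) n (X0 : {mfun T >-> T1}) (W : K -> {mfun T >-> borelV K n})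
    (s t : K) : 0 <= s -> s <= t ->
  indep_systems Pr (sigma_rv X0) (sigma_process `[0, +oo[ W) ->
  indep_systems Pr (sigma_process `[0, s] W) (sigma_rv (increment W s t)) ->
  indep_systems Pr <<s sigma_rv X0 `|` sigma_process `[0, s] W >>
    (sigma_rv (increment W s t)).
Proof.
move=> s0 st ind0 indW A D AG sD.
have WD : sigma_process `[0, +oo[ W D.
  pose TW := g_sigma_algebraType (\bigcup_(u in `[0, +oo[%classic) sigma_rv (W u)).
  have mW u : 0 <= u -> measurable_fun setT (W u : TW -> borelV K n).
    move=> u0 _ B mB; apply: sub_sigma_algebra; exists u; last by exists B.
    by rewrite /= in_itv /= u0.
  have mI : measurable_fun setT (increment W s t : TW -> borelV K n).
    by apply: measurable_submx; apply: mW => //; exact: le_trans st.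
  by have [B mB <-] := sD; exact: mI.
have mD : measurable D by exact: sigma_process_sub WD.
pose p := fine (Pr D).
have p0 : 0 <= p by exact: fine_ge0.
have pE : Pr D = p%:E by rewrite fineK// fin_num_measure.
pose H : set_system T := [set A `&` E | A in sigma_rv X0 & E in sigma_process `[0, s] W].
have sub0 : sigma_process `[0, s] W `<=` sigma_process `[0, +oo[ W.
  by apply: sigma_process_mono => u /=; rewrite !in_itv /= => /andP[->].
have s0T : sigma_rv X0 setT by exists setT => //; rewrite preimage_setT setTI.
have sWT : sigma_process `[0, s] W setT.
  have [h1 h2 _] := smallest_sigma_algebra setT (\bigcup_(u in `[0, s]%classic) sigma_rv (W u)).
  by have := h2 _ h1; rewrite setD0.
have HT : H setT by exists setT => //; exists setT => //; rewrite setTI.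
have Hm : H `<=` measurable.
  move=> _ [B sB [E sE <-]]; apply: measurableI.
    exact: sigma_rv_sub sB.
  exact: sigma_process_sub sE.
have HI : setI_closed H.
  move=> _ _ [B1 [C1 mC1 <-] [E1 sE1 <-]] [B2 [C2 mC2 <-] [E2 sE2 <-]].
  exists (setT `&` X0 @^-1` (C1 `&` C2)); first by exists (C1 `&` C2) => //; exact: measurableI.
  exists (E1 `&` E2).
    exact: (@measurableI _ (g_sigma_algebraType (\bigcup_(u in `[0, s]%classic) sigma_rv (W u)))).
  by rewrite !setTI preimage_setI setIACA.
have key B : <<s H >> B -> (Pr (B `&` D) = Pr B * Pr D)%E.
  move=> HB.
  (* The finite measures A -> Pr(A and D) and Pr(D) Pr agree on the intersection-stable class [H],
     hence on the sigma-algebra that it generates. *)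
  have := @g_sigma_algebra_measure_unique _ _ T H Hm (fun=> setT) (fun=> HT) _
    [the measure _ _ of mrestr Pr mD] [the measure _ _ of mscale (NngNum p0) Pr] HI.
  rewrite bigcup_const; last by exists 0%N.
  move=> /(_ erefl); rewrite /= /mrestr /mscale /= => h.
  rewrite h// ?pE 1?muleC//.
  - move=> _ [B1 sB1 [E1 sE1 <-]].
    rewrite -setIA ind0//; last first.
      apply: (@measurableI _ (g_sigma_algebraType (\bigcup_(u in `[0, +oo[%classic) sigma_rv (W u)))) => //.
      exact: sub0.
    rewrite indW// ind0//; last exact: sub0.
    by rewrite -pE muleA muleC.
  - by move=> k; apply: le_lt_trans (ltry 1); apply: probability_le1; exact: measurableI.
apply: key; move: A AG; apply: smallest_sub; first exact: smallest_sigma_algebra.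
move=> A [AX|AW]; apply: sub_sigma_algebra.
  by exists A => //; exists setT => //; rewrite setIT.
by exists setT => //; exists A => //; rewrite setTI.
Qed.

Lemma exponential_tail (K : realType) (c : K) : 0 <= c ->
  exponential_prob 1 `]c, +oo[%classic = (expR (- c))%:E.
Proof.
move=> c0.
pose E' := [the probability _ _ of @exponential_prob K 1].
pose E := E' ltr01.
have neg : E `]-oo, 0[%classic = 0%E.
  rewrite /= /exponential_prob; under eq_integral => x.
    rewrite inE /= in_itv /= => x0; rewrite lt0_exponential_pdf//.
    over.
  by rewrite integral0.
have cE : E `]-oo, c]%classic = (1 - expR (- c))%:E.
  have -> : `]-oo, c]%classic = `]-oo, 0[%classic `|` `[0, c]%classic :> set K.
    by rewrite -itv_bndbnd_setU// bnd_simp.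
  rewrite measureU//=; last first.
    apply/seteqP; split => x //= []; rewrite !in_itv /= => x0 /andP[].
    by rewrite leNgt x0.
  rewrite -[exponential_prob 1 `]-oo, 0[%classic]/(E _) neg add0e.
  move: c0; rewrite le_eqVlt => /predU1P[<-|c0].
    rewrite set_itv1 /exponential_prob integral_set1 oppr0 expR0 subrr//.
  by rewrite exponential_prob_itv0c// mulN1r EFinB.
have -> : `]c, +oo[%classic = ~` `]-oo, c]%classic :> set K by rewrite setCitvl.
have := @probability_setC _ _ _ E `]-oo, c]%classic (measurable_itv _).
rewrite cE => ->; rewrite -EFinB; congr (_%:E); ring.
Qed.

Lemma within_continuousP (K : realType) (V : normedModType K) (f : K -> V) (A : set K) :
  {within A, continuous f} -> forall x, A x -> forall e, 0 < e ->
  exists2 d, 0 < d & forall y, A y -> `|x - y| < d -> `|f x - f y| < e.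
Proof.
move=> /subspace_continuousP cf x Ax e e0.
have /cvgrPdist_lt /(_ e e0) := cf x Ax.
rewrite /within /= => /nbhs_ballP[d /= d0 H]; exists d => // y Ay xy.
by apply: H.
Qed.

(** Heine's theorem, by compactness of [0, t], with the filter of radii tending to 0 from the
    right. *)
Lemma unif_continuous_itv (K : realType) (V : normedModType K) (f : K -> V) (t : K) :
  {within `[0, +oo[, continuous f} -> forall e, 0 < e ->
  exists2 d, 0 < d & forall x y, 0 <= x <= t -> 0 <= y <= t -> `|x - y| < d ->
    `|f x - f y| <= e.
Proof.
move=> cf e e0.
pose A : set K := `[0, t]%classic.
have AP x : A x <-> 0 <= x <= t by rewrite /A /= in_itv.
pose P (d x : K) := A x -> forall y, A y -> `|x - y| < d -> `|f x - f y| <= e.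
have : \forall d \near (0 : K)^'+, forall x, A x -> P d x.
  have cA : compact A by exact: segment_compact.
  have := (compact_near_coveringP A).1 cA K (0 : K)^'+ P _; apply => x Ax.
  have Ax0 : (`[0, +oo[%classic : set K) x.
    by move/AP : Ax => /andP[x0 _]; rewrite /= in_itv /= x0.
  have [d d0 fd] := within_continuousP cf Ax0 (divr_gt0 e0 (ltr0n K 2)).
  exists (ball x (d / 2), [set d' | d' < d / 2]) => /=.
    split; first by apply: nbhsx_ballx; rewrite divr_gt0.
    by apply: nbhs_right_lt; rewrite divr_gt0.
  move=> [x' d'] /= [xx' d'd] Ax' y Ay x'y.
  have A0 z : A z -> (`[0, +oo[%classic : set K) z.
    by move/AP => /andP[z0 _]; rewrite /= in_itv /= z0.
  have h1 : `|f x - f x'| < e / 2.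
    apply: fd; first exact: A0.
    by apply: lt_le_trans xx' _; lra.
  have h2 : `|f x - f y| < e / 2.
    apply: fd; first exact: A0.
    rewrite (_ : x - y = (x - x') + (x' - y)); last by ring.
    apply: le_lt_trans (ler_normD _ _) _; rewrite [ltRHS](splitr d).
    by apply: ltrD => //; exact: lt_trans d'd.
  rewrite (_ : f x' - f y = (f x - f y) - (f x - f x')); last first.
    by rewrite opprB [RHS]addrC addrA subrK.
  apply: le_trans (ler_normB _ _) _; rewrite [leRHS](splitr e).
  by apply: lerD; exact: ltW.
move=> H.
have [d [d0 Pd]] := filter_ex (filterI (nbhs_right_gt (0 : K)) H).
by exists d => // x y /AP Ax /AP Ay; exact: Pd.
Qed.

Lemma continuous_itv_integrable (K : realType) (f : K -> K) (t : K) :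
  {within `[0, +oo[, continuous f} ->
  lebesgue_measure.-integrable `[0, t] (EFin \o f).
Proof.
move=> cf; apply: continuous_compact_integrable; first exact: segment_compact.
apply: continuous_subspaceW cf => x /=; rewrite !in_itv /= => /andP[->//].
Qed.

(** The one estimate on primitives behind the Riemann sums, the right continuity of the accumulated
    killing and the consistency of integral equations. *)
Lemma Rintegral_increment (K : realType) (f : K -> K) (a b c e : K) :
  {within `[0, +oo[, continuous f} -> 0 <= a -> a <= b ->
  (forall x, a <= x <= b -> `|f x - c| <= e) ->
  `|\int[lebesgue_measure]_(x in `[0, b]) f x - \int[lebesgue_measure]_(x in `[0, a]) f x
     - (b - a) * c| <= (b - a) * e.
Proof.
move=> cf a0 ab fe.
have fi := continuous_itv_integrable b cf.
rewrite (Rintegral_itvB fi) ?bnd_simp//.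
have mI : measurable (`]a, b]%classic : set (measurableTypeR K)) by [].
have muI : fine (lebesgue_measure (`]a, b]%classic : set (measurableTypeR K))) = b - a.
  rewrite lebesgue_measure_itv /= lte_fin; case: ltP => // ba.
  by have -> : a = b; [apply/eqP; rewrite eq_le ab ba|rewrite subrr].
have fi' : lebesgue_measure.-integrable `]a, b] (EFin \o f).
  apply: integrableS fi => // x /=; rewrite !in_itv /= => /andP[ax ->].
  by rewrite andbT (le_trans a0 (ltW ax)).
have ci (k : K) : lebesgue_measure.-integrable `]a, b] (EFin \o cst k).
  have kI : lebesgue_measure.-integrable `[a, b] (EFin \o cst k).
    apply: continuous_compact_integrable; first exact: segment_compact.
    by apply: continuous_subspaceT => x; exact: cst_continuous.
  apply: integrableS kI => // x /=; rewrite !in_itv /= => /andP[ax ->].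
  by rewrite andbT ltW.
rewrite -muI (mulrC _ c) -Rintegral_cst// -RintegralB//; last exact: ci.
apply: le_trans (le_normr_Rintegral _ _) _ => //.
  by apply: (integrableB mI fi' (ci c)).
rewrite (mulrC _ e) -Rintegral_cst//; apply: le_Rintegral => //.
- by apply: integrable_norm; exact: (integrableB mI fi' (ci c)).
- exact: ci.
- by move=> x /=; rewrite in_itv /= => /andP[ax xb]; apply: fe; rewrite xb ltW.
Qed.

(** With [n.+1] steps every [n] gives a genuine partition of [0, t]. *)
Definition mesh (K : realType) (t : K) (n : nat) : K := t / n.+1%:R.

Lemma mesh_ge0 (K : realType) (t : K) n : 0 <= t -> 0 <= mesh t n.
Proof. by move=> t0; rewrite divr_ge0. Qed.

Lemma mesh_mul (K : realType) (t : K) n : n.+1%:R * mesh t n = t.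
Proof. by rewrite /mesh mulrC divfK. Qed.

Lemma mesh_le (K : realType) (t : K) n k : 0 <= t -> (k <= n.+1)%N ->
  0 <= k%:R * mesh t n <= t.
Proof.
move=> t0 kn; rewrite mulr_ge0 ?mesh_ge0//= -[leRHS](mesh_mul t n).
by rewrite ler_wpM2r ?mesh_ge0// ler_nat.
Qed.

Lemma cvg_mesh (K : realType) (t : K) : mesh t n @[n --> \oo] --> (0 : K).
Proof. by rewrite -(mulr0 t); apply: cvgM; [exact: cvg_cst|exact: cvg_harmonic]. Qed.

(** The nodal values [u n k] need only be uniformly close to those of [f], so the sum may be taken
    along an approximating chain. *)
Lemma Rintegral_riemann (K : realType) (f : K -> K) (u : nat -> nat -> K) (t : K) :
  {within `[0, +oo[, continuous f} -> 0 <= t ->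
  (forall e, 0 < e -> \forall n \near \oo, forall k, (k <= n)%N ->
    `|u n k - f (k%:R * mesh t n)| <= e) ->
  mesh t n * (\sum_(k < n.+1) u n k) @[n --> \oo] -->
    \int[lebesgue_measure]_(x in `[0, t]) f x.
Proof.
move=> cf t0 uf; apply/cvgrPdist_le => e e0.
(* Each unit of time costs one [e1] for the oscillation of [f] and one for [u]; t + 1 instead of t
   allows t = 0. *)
pose e1 := e / (2 * (t + 1)).
have e10 : 0 < e1 by rewrite divr_gt0// mulr_gt0// ltr_wpDl.
have [d d0 fd] := unif_continuous_itv t cf e10.
have md : \forall n \near \oo, mesh t n < d.
  have /cvgr0Pnorm_lt /(_ d d0) := cvg_mesh t.
  by apply: filterS => n; apply: le_lt_trans; exact: ler_norm.
have uf1 := uf _ e10.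
near=> n.
have dn : mesh t n < d by near: n.
have un : forall k, (k <= n)%N -> `|u n k - f (k%:R * mesh t n)| <= e1 by near: n.
pose F x := \int[lebesgue_measure]_(s in `[0, x]) f s.
have step k : (k <= n.+1)%N ->
    `|F (k%:R * mesh t n) - mesh t n * \sum_(i < k) u n i| <= k%:R * mesh t n * (2 * e1).
  elim: k => [|k IH] kn.
    by rewrite mul0r big_ord0 mulr0 subr0 mul0r /F set_itv1 Rintegral_set1 normr0.
  have := IH (ltnW kn) => {}IH.
  have hk := mesh_le t0 (ltnW kn); have hk1 := mesh_le t0 kn.
  have dk : k.+1%:R * mesh t n - k%:R * mesh t n = mesh t n by rewrite -natr1; ring.
  have := @Rintegral_increment K f (k%:R * mesh t n) (k.+1%:R * mesh t n)
    (f (k%:R * mesh t n)) e1 cf.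
  rewrite dk -!/(F _); move/andP : (hk) => [hk0 _].
  have le1 : k%:R * mesh t n <= k.+1%:R * mesh t n by rewrite ler_wpM2r ?mesh_ge0// ler_nat.
  move=> /(_ hk0 le1) H.
  have {}H := H _; have {H} : `|F (k.+1%:R * mesh t n) - F (k%:R * mesh t n) -
      mesh t n * f (k%:R * mesh t n)| <= mesh t n * e1.
    apply: H => x /andP[x1 x2]; apply: fd => //.
      by rewrite (le_trans hk0 x1)//; move/andP: hk1 => [_]; exact: le_trans.
    rewrite ger0_norm ?subr_ge0//; apply: le_lt_trans dn.
    by rewrite -[leRHS]dk lerB.
  move=> H; have kn' : (k <= n)%N by [].
  have := un k kn' => uk.
  rewrite big_ord_recr /= mulrDr.
  set a := F (k.+1%:R * _) in H *; set b := F _ in H IH; set s := \sum_(i < k) _ in IH *.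
  set m := mesh t n in H IH uk *; set fk := f _ in H uk.
  have m0 : 0 <= m by exact: mesh_ge0.
  rewrite (_ : a - (m * s + m * u n k) = (b - m * s) + (a - b - m * fk) - m * (u n k - fk));
    last by ring.
  apply: le_trans (ler_normB _ _) _.
  apply: le_trans (lerD (ler_normD _ _) (lexx _)) _.
  rewrite normrM (ger0_norm m0).
  have h := ler_wpM2l m0 uk.
  have -> : k.+1%:R * m * (2 * e1) = k%:R * m * (2 * e1) + m * e1 + m * e1.
    by rewrite -natr1; ring.
  by apply: lerD => //; exact: lerD.
have := step n.+1 (leqnn _); rewrite mesh_mul => h; apply: le_trans h _.
rewrite /e1 (_ : t * (2 * (e / (2 * (t + 1)))) = e * (t / (t + 1))); last first.
  by field; rewrite gt_eqF// ltr_wpDl.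
by rewrite ler_piMr ?ltW// ltr_pdivrMr ?ltr_wpDl// mul1r ltrDl.
Unshelve. all: by end_near. Qed.

(** The killing accumulated up to time [t], to be compared with the exponential clock. *)
Definition killing_rate (K : realType) r (T : Type) (S : 'M[K]_r)
    (X : K -> T -> 'cV[K]_r) (t : K) (w : T) : K :=
  \int[lebesgue_measure]_(s in `[0, t]) potential S (X s w).

Lemma mx_norm_le (K : realType) m n (M : 'M[K]_(m, n)) e : 0 <= e ->
  (forall i j, `|M i j| <= e) -> `|M| <= e.
Proof. by move=> e0 Me; rewrite [`|M|]mx_normrE; apply: bigmax_le => // -[i j] _. Qed.

Lemma le_mx_norm (K : realType) m n (M : 'M[K]_(m, n)) i j : `|M i j| <= `|M|.
Proof.
rewrite [leRHS]mx_normrE.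
exact: (le_bigmax _ (fun ij : 'I_m * 'I_n => `|M ij.1 ij.2|) (i, j)).
Qed.

Lemma cvg_entry (K : realType) m n (U : Type) (F : set_system U) {FF : Filter F}
    (y : U -> 'M[K]_(m, n)) (a : 'M[K]_(m, n)) i j :
  y @ F --> a -> y k i j @[k --> F] --> a i j.
Proof. by move=> ya; exact: (cvg_comp _ _ ya (@coord_continuous K m n i j a)). Qed.

Lemma cvg_mx (K : realType) m n (U : Type) (F : set_system U) {FF : Filter F}
    (y : U -> 'M[K]_(m, n)) (a : 'M[K]_(m, n)) :
  (forall i j, y k i j @[k --> F] --> a i j) -> y @ F --> a.
Proof.
move=> cy; apply/cvgrPdist_le => e e0.
have H (ij : 'I_m * 'I_n) : \forall k \near F, `|a ij.1 ij.2 - y k ij.1 ij.2| <= e.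
  by have /cvgrPdist_le := cy ij.1 ij.2; exact.
have : \forall k \near F, forall ij : 'I_m * 'I_n, `|a ij.1 ij.2 - y k ij.1 ij.2| <= e.
  exact: filter_forall.
apply: filterS => k Hk.
by apply: mx_norm_le => [|i j]; [exact: ltW|rewrite !mxE; exact: (Hk (i, j))].
Qed.

Lemma cvg_mulmx (K : realType) r m n (U : Type) (F : set_system U) {FF : Filter F}
    (y : U -> 'M[K]_(m, r)) (z : U -> 'M[K]_(r, n)) (a : 'M[K]_(m, r)) (b : 'M[K]_(r, n)) :
  y @ F --> a -> z @ F --> b -> y k *m z k @[k --> F] --> a *m b.
Proof.
move=> ya zb; apply: cvg_mx => i j; rewrite mxE.
rewrite (_ : (fun k => _) = fun k => \sum_l y k i l * z k l j); last first.
  by apply/funext => k; rewrite mxE.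
elim: (index_enum _) => [|l s IH].
  rewrite big_nil (_ : (fun n => _) = cst 0); first exact: cvg_cst.
  by apply/funext => k; rewrite big_nil.
rewrite big_cons (_ : (fun n => _) = fun k => y k i l * z k l j + \sum_(l <- s) y k i l * z k l j).
  by apply: cvgD => //; apply: cvgM; exact: cvg_entry.
by apply/funext => k; rewrite big_cons.
Qed.

Lemma cvg_trmx (K : realType) m n (U : Type) (F : set_system U) {FF : Filter F}
    (y : U -> 'M[K]_(m, n)) (a : 'M[K]_(m, n)) :
  y @ F --> a -> (y k)^T @[k --> F] --> a^T.
Proof.
by move=> ya; apply: cvg_mx => i j; rewrite mxE; under eq_fun do rewrite mxE; exact: cvg_entry.
Qed.

Lemma cvg_dot (K : realType) r (U : Type) (F : set_system U) {FF : Filter F}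
    (y z : U -> 'cV[K]_r) (a b : 'cV[K]_r) :
  y @ F --> a -> z @ F --> b -> dot (y i) (z i) @[i --> F] --> dot a b.
Proof.
move=> ya zb; apply: cvg_entry; apply: cvg_mulmx => //.
exact: cvg_trmx.
Qed.

Lemma cvg_qform (K : realType) r (U : Type) (F : set_system U) {FF : Filter F}
    (M : 'M[K]_r) (y : U -> 'cV[K]_r) (a : 'cV[K]_r) :
  y @ F --> a -> qform M (y i) @[i --> F] --> qform M a.
Proof.
move=> ya; under eq_fun do rewrite qformE; rewrite qformE.
by apply: cvg_dot => //; apply: cvg_mulmx => //; exact: cvg_cst.
Qed.

Lemma continuous_mulmx_fun (K : realType) r m n (y : K -> 'M[K]_(m, r))
    (z : K -> 'M[K]_(r, n)) (A : set K) :
  {within A, continuous y} -> {within A, continuous z} ->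
  {within A, continuous (fun s => y s *m z s)}.
Proof. by move=> cy cz s; apply: cvg_mulmx; [exact: cy|exact: cz]. Qed.

Lemma continuous_trmx_fun (K : realType) m n (y : K -> 'M[K]_(m, n)) (A : set K) :
  {within A, continuous y} -> {within A, continuous (fun s => (y s)^T)}.
Proof. by move=> cy s; apply: cvg_trmx; exact: cy. Qed.

Lemma continuous_entry_fun (K : realType) m n (x : K -> 'M[K]_(m, n)) (A : set K) i j :
  {within A, continuous x} -> {within A, continuous (fun s => x s i j)}.
Proof. by move=> cx s; apply: cvg_entry; exact: cx. Qed.

Lemma continuous_qform_fun (K : realType) r (M : 'M[K]_r) (x : K -> 'cV[K]_r) (A : set K) :
  {within A, continuous x} -> {within A, continuous (fun s => qform M (x s))}.
Proof. by move=> cx s; apply: cvg_qform; exact: cx. Qed.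

Section killing.
Context (K : realType) (d : measure_display) (T : measurableType d)
  (Pr : probability T K) (r : nat) (S : 'M[K]_r) (X : K -> {mfun T >-> borelV K r}).

Lemma continuous_potential w : continuous_paths X ->
  {within `[0, +oo[, continuous (fun s => potential S (X s w))}.
Proof.
move=> cX s; apply: cvgM; last exact: cvg_cst.
exact: (@continuous_qform_fun _ _ S (fun s => X s w) _ (cX w)).
Qed.

(** Measurability is with respect to the path alone, since the clock is independent of that
    sigma-algebra; the integral is a limit of Riemann sums of the path. *)
Lemma measurable_killing_rate (t : K) : continuous_paths X -> 0 <= t ->
  measurable_fun setT (killing_rate S (fun s => X s) t :
    g_sigma_algebraType (\bigcup_(s in `[0, +oo[%classic) sigma_rv (X s)) -> K).
Proof.
move=> cX t0.
pose TX := g_sigma_algebraType (\bigcup_(s in `[0, +oo[%classic) sigma_rv (X s)).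
apply: (@measurable_fun_cvg _ TX K setT (fun n (w : TX) => mesh t n *
    \sum_(k < n.+1) potential S (X (k%:R * mesh t n) w))).
  move=> n; apply: measurable_funM => //; apply: measurable_sum => k.
  apply: measurable_funM => //; apply: measurable_qform.
  move=> _ B mB; apply: sub_sigma_algebra; exists (k%:R * mesh t n); last by exists B.
  by rewrite /= in_itv /= andbT mulr_ge0// mesh_ge0.
move=> w _; apply: (@Rintegral_riemann _ (fun s => potential S (X s w))
    (fun n k => potential S (X (k%:R * mesh t n) w))) => //.
  exact: continuous_potential.
by move=> e e0; apply: nearW => n k _; rewrite subrr normr0 ltW.
Qed.

Lemma measurable_killing_rateT (t : K) : continuous_paths X -> 0 <= t ->
  measurable_fun setT (killing_rate S (fun s => X s) t).
Proof.
move=> cX t0 _ V mV; have := measurable_killing_rate cX t0 measurableT mV.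
apply: (smallest_sub (@sigma_algebra_measurable _ T)).
by move=> E [s _]; exact: sigma_rv_sub.
Qed.

Lemma killing_rate_ge0 t w : psdmx S -> 0 <= killing_rate S (fun s => X s) t w.
Proof.
by move=> [_ S0]; apply: Rintegral_ge0 => s _; rewrite divr_ge0.
Qed.

Lemma killing_rate_mono w s t : psdmx S -> continuous_paths X -> 0 <= s -> s <= t ->
  killing_rate S (fun s => X s) s w <= killing_rate S (fun s => X s) t w.
Proof.
move=> [_ S0] cX s0 st; rewrite -subr_ge0 /killing_rate.
rewrite Rintegral_itvB ?bnd_simp//; first by apply: Rintegral_ge0 => u _; rewrite divr_ge0.
exact: continuous_itv_integrable (continuous_potential cX).
Qed.

(** From right to left, the accumulated killing must stay below the clock for some time after [t],
    since the killing time is an infimum. *)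
Lemma killing_time_gt (xi : T -> K) t w : psdmx S -> continuous_paths X -> 0 <= t ->
  (t%:E < killing_time (potential S) X xi w)%E <->
  killing_rate S (fun s => X s) t w < xi w.
Proof.
move=> pS cX t0; split.
  move=> lt; rewrite ltNge; apply/negP => le; move: lt; rewrite ltNge => /negP; apply.
  by apply: ereal_inf_lbound; exists t.
move=> lt.
have cf := continuous_potential (w := w) cX.
pose f s := potential S (X s w).
have tI : (`[0, +oo[%classic : set K) t by rewrite /= in_itv /= t0.
have [d0 d00 fd] := within_continuousP cf tI (@ltr01 K).
pose g := xi w - killing_rate S (fun s => X s) t w.
have g0 : 0 < g by rewrite subr_gt0.
pose M := `|f t| + 1.
have M0 : 0 < M by rewrite ltr_wpDl.
(* Up to time t + h the potential is at most [M + 1], so the accumulated killing grows by less than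
   the remaining gap [g]. *)
pose h := Num.min (d0 / 2) (g / (2 * (M + 1))).
have h0 : 0 < h by rewrite lt_min !divr_gt0// mulr_gt0// ltr_wpDl// ltW.
apply: (@lt_le_trans _ _ (t + h)%:E); first by rewrite lte_fin ltrDl.
apply: le_ereal_inf_tmp => _ [s [s0 les] <-]; rewrite lee_fin leNgt; apply/negP => sth.
have [st|ts] := leP s t.
  have := killing_rate_mono w pS cX s0 st.
  by move=> /(le_trans les); rewrite leNgt lt.
have := @Rintegral_increment _ f t s 0 (M + 1) cf t0 (ltW ts).
move=> H; have {}H := H _; have {H} : `|killing_rate S (fun s => X s) s w -
    killing_rate S (fun s => X s) t w - (s - t) * 0| <= (s - t) * (M + 1).
  apply: H => x /andP[tx xs]; rewrite subr0.
  have : `|f t - f x| < 1.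
    apply: fd; first by rewrite /= in_itv /= (le_trans t0 tx).
    rewrite distrC ger0_norm ?subr_ge0// ltrBlDl.
    apply: le_lt_trans xs _; apply: lt_trans sth _; rewrite ltrD2l.
    have hd : h <= d0 / 2 by rewrite /h ge_min lexx.
    by apply: le_lt_trans hd _; lra.
  rewrite distrC => fx; rewrite -[f x](subrK (f t)).
  apply: le_trans (ler_normD _ _) _; rewrite /M; have := ltW fx; lra.
rewrite mulr0 subr0 => H.
have : (s - t) * (M + 1) < g.
  have : (s - t) < g / (2 * (M + 1)).
    rewrite ltrBlDl; apply: lt_le_trans sth _; rewrite lerD2l.
    by rewrite ge_min lexx orbT.
  rewrite ltr_pdivlMr; last by rewrite mulr_gt0// ltr_wpDl// ltW.
  have : 0 <= (s - t) * (M + 1) by rewrite mulr_ge0// ?subr_ge0 ?addr_ge0// ltW.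
  lra.
move=> /(le_lt_trans H) /(le_lt_trans (ler_norm _)); rewrite /g ltrD2r.
by rewrite ltNge les.
Qed.

(** Freezing the path and averaging over the independent clock replaces the survival indicator by
    the exponential tail at the accumulated killing. *)
Lemma Rintegral_killing (xi : {RV Pr >-> measurableTypeR K}) (t C : K) (phi : 'cV[K]_r -> K) :
  psdmx S -> continuous_paths X -> 0 <= t -> killing_clock X xi ->
  measurable_fun setT (phi : borelV K r -> K) -> (forall x, `|phi x| <= C) ->
  \int[Pr]_w (phi (X t w) * \1_[set w | (t%:E < killing_time (potential S) X xi w)%E] w) =
  \int[Pr]_w (phi (X t w) * expR (- killing_rate S (fun s => X s) t w)).
Proof.
move=> pS cX t0 [xiE ind] mphi phiC.
pose G : set_system T := \bigcup_(s in `[0, +oo[%classic) sigma_rv (X s).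
pose TG := g_sigma_algebraType G.
pose L := killing_rate S (fun s => X s) t.
have mL : measurable_fun setT (L : TG -> K) by exact: measurable_killing_rate.
have Gm : G `<=` measurable by move=> A [s _]; exact: sigma_rv_sub.
have ind' : indep_systems Pr <<s G >> (sigma_rv xi).
  by move=> A B GA xB; rewrite setIC ind// muleC.
pose f (z : TG * measurableTypeR K) := phi (X t z.1) * ((L z.1 < z.2)%R : bool)%:R.
have mXt : measurable_fun setT (X t : TG -> borelV K r).
  move=> _ B mB; apply: sub_sigma_algebra; exists t; last by exists B.
  by rewrite /= in_itv /= t0.
have mb : measurable_fun setT (fun z : TG * measurableTypeR K => (L z.1 < z.2)%R).
  apply: measurable_fun_ltr; last exact: measurable_snd.
  exact: (measurableT_comp mL measurable_fst).
have mf : measurable_fun setT f.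
  apply: measurable_funM; first exact: (measurableT_comp mphi (measurableT_comp mXt measurable_fst)).
  exact: (measurableT_comp (f := fun b : bool => b%:R : K)).
have fC z : `|f z| <= C.
  rewrite /f normrM -[leRHS]mulr1 ler_pM//.
  by case: (_ < _); rewrite ?normr1 ?normr0.
transitivity (\int[Pr]_w f (w, xi w)).
  apply: eq_Rintegral => w _; rewrite /f /= indicE; congr (_ * (nat_of_bool _)%:R).
  apply/idP/idP; first by rewrite inE /= => /killing_time_gt; exact.
  by move=> h; rewrite inE /=; apply/killing_time_gt.
rewrite (@indep_Rintegral_sub _ _ T _ K Pr G xi f C Gm ind' mf fC).
apply: eq_Rintegral => w _; rewrite /f /=.
rewrite RintegralZl//; last first.
  apply: (@bounded_integrable _ _ _ [the probability _ _ of distribution Pr xi] _ 1).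
    have mb' : measurable_fun setT (fun z : measurableTypeR K => (L w < z)%R).
      exact: measurable_fun_ltr.
    exact: (measurableT_comp (f := fun b : bool => b%:R : K)).
  by move=> z; case: (_ < _); rewrite ?normr1 ?normr0.
congr (_ * _).
rewrite /Rintegral (_ : (fun x => _) = EFin \o \1_(`]L w, +oo[%classic)); last first.
  apply/funext => z /=; rewrite indicE; congr ((nat_of_bool _)%:R%:E).
  by apply/idP/idP; rewrite inE /= in_itv /= andbT.
rewrite integral_indic// setIT.
transitivity (fine (expR (- L w))%:E) => //; congr fine.
apply: etrans (xiE _ (measurable_itv _)) _.
by apply: exponential_tail; exact: killing_rate_ge0.
Qed.

End killing.

(** * Euler chains *)

(** Driven by an arbitrary path [p], so that the same recursion serves for laws and for limits along
    a fixed path. *)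
Fixpoint euler (K : realType) r r1 (a : 'M[K]_r) (B : 'M[K]_(r, r1)) (p : K -> 'cV[K]_r1)
    (h : K) (y0 : 'cV[K]_r) (k : nat) : 'cV[K]_r :=
  if k is k'.+1 then
    a *m euler a B p h y0 k' + B *m (p (k'.+1%:R * h) - p (k'%:R * h))
  else y0.

Lemma psdmxZ (K : realType) r (c : K) (P : 'M[K]_r) : 0 <= c -> psdmx P -> psdmx (c *: P).
Proof.
move=> c0 [sP P0]; split; first by rewrite linearZ /= sP.
by move=> x; rewrite qformZl mulr_ge0.
Qed.

Lemma psdmx_mulmx_tr (K : realType) r r1 (B : 'M[K]_(r, r1)) : psdmx (B *m B^T).
Proof.
split; first by rewrite trmx_mul trmxK.
move=> x; rewrite qformE -mulmxA dot_mulmx dotE.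
by apply: sumr_ge0 => i _; rewrite -expr2 sqr_ge0.
Qed.

Lemma posdefmx_psd (K : realType) r (Q : 'M[K]_r) : posdefmx Q -> psdmx Q.
Proof.
move=> [sQ Q0]; split => // x; have [->|/Q0/ltW//] := eqVneq x 0.
by rewrite qformE dot0l.
Qed.

Lemma h0_ge0 (K : realType) r (Q : 'M[K]_r) x : 0 <= h0 Q x.
Proof. exact: expR_ge0. Qed.

Lemma h0_gt0 (K : realType) r (Q : 'M[K]_r) x : 0 < h0 Q x.
Proof. exact: expR_gt0. Qed.

Lemma h0_le1 (K : realType) r (Q : 'M[K]_r) x : psdmx Q -> h0 Q x <= 1.
Proof. by move=> [_ Q0]; rewrite -expR0 ler_expR oppr_le0 divr_ge0. Qed.

Lemma h0_norm_le1 (K : realType) r (Q : 'M[K]_r) x : psdmx Q -> `|h0 Q x| <= 1.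
Proof. by move=> pQ; rewrite ger0_norm ?h0_ge0// h0_le1. Qed.

Lemma measurable_h0 d (T : measurableType d) (K : realType) r (Q : 'M[K]_r)
    (f : T -> borelV K r) : measurable_fun setT f ->
  measurable_fun setT (fun t => h0 Q (f t)).
Proof.
move=> mf; rewrite /h0; apply: (@measurableT_comp _ _ _ _ _ _ expR) => //.
apply: measurableT_comp => //; apply: measurable_funM => //.
exact: measurable_qform.
Qed.

Lemma qform_scalar (K : realType) r (c : K) (u : 'cV[K]_r) : qform c%:M u = c * dot u u.
Proof. by rewrite qformE mul_scalar_mx dotZr. Qed.

Lemma gaussian_transform_affine (K : realType) r r1 d (T : measurableType d)
    (Pr : probability T K) (Z : {mfun T >-> borelV K r1}) (B : 'M[K]_(r, r1)) (h : K)
    (y : 'cV[K]_r) : is_gaussian 0 h%:M (pushforward Pr Z) ->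
  gaussian_transform (distribution Pr Z) (fun z => y + B *m z) (fun=> 1) 1 y
    (h *: (B *m B^T)).
Proof.
move=> /is_gaussian_transform G u a.
have mX : measurable_fun setT (fun z : borelV K r1 => y + B *m (z : 'cV[K]_r1) : borelV K r).
  apply: measurable_addmx => //.
  exact: (measurable_mulmx B (@measurable_id _ (borelV K r1) setT)).
under eq_Rintegral do rewrite mul1r.
rewrite (@Rintegral_distribution _ _ _ (borelV K r1) _ _ _ _ 1).
- have qE : qform (B *m B^T) u = dot (B^T *m u) (B^T *m u).
    by rewrite qformE -mulmxA dot_mulmx.
  rewrite qformZl qE.
  have := G (B^T *m u) (dot u y + a); rewrite dot0r add0r qform_scalar => e.
  transitivity (\int[Pr]_x (1 * cos (dot (B^T *m u) (Z x) + (dot u y + a)))).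
    apply: eq_Rintegral => x _; rewrite mul1r; congr cos.
    by rewrite dotDr dot_mulmx; ring.
  by rewrite e.
- exact: (measurable_cos_dot u a mX).
- by move=> x; exact: cos_norm_le1.
Qed.

(** One step of the Markov property: the new increment is integrated out while the past, [psi] and
    [Y], is frozen. *)
Lemma Rintegral_step (K : realType) r1 d (T : measurableType d) (Pr : probability T K)
    (G : set_system T) (Z : {mfun T >-> borelV K r1}) (r : nat)
    (a : 'M[K]_r) (B : 'M[K]_(r, r1)) (Y : T -> borelV K r) (psi : T -> K)
    (phi : 'cV[K]_r -> K) (C D : K) :
  G `<=` measurable -> indep_systems Pr <<s G >> (sigma_rv Z) ->
  measurable_fun setT (Y : g_sigma_algebraType G -> borelV K r) ->
  measurable_fun setT (psi : g_sigma_algebraType G -> K) -> (forall x, `|psi x| <= C) ->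
  measurable_fun setT (phi : borelV K r -> K) -> (forall x, `|phi x| <= D) ->
  \int[Pr]_t (psi t * phi (a *m (Y t : 'cV[K]_r) + B *m (Z t : 'cV[K]_r1))) =
  \int[Pr]_t (psi t * \int[distribution Pr Z]_z phi (a *m (Y t : 'cV[K]_r) + B *m (z : 'cV[K]_r1))).
Proof.
move=> Gm ind mY mpsi psiC mphi phiD.
pose TG := g_sigma_algebraType G.
have mX : measurable_fun setT (fun z : TG * borelV K r1 =>
    a *m (Y z.1 : 'cV[K]_r) + B *m (z.2 : 'cV[K]_r1) : borelV K r).
  apply: measurable_addmx.
    by apply: measurable_mulmx; exact: (measurableT_comp mY measurable_fst).
  by apply: measurable_mulmx; exact: measurable_snd.
pose f (z : TG * borelV K r1) :=
  psi z.1 * phi (a *m (Y z.1 : 'cV[K]_r) + B *m (z.2 : 'cV[K]_r1)).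
have mf : measurable_fun setT f.
  apply: measurable_funM; last exact: (measurableT_comp mphi mX).
  exact: (measurableT_comp mpsi measurable_fst).
have fC z : `|f z| <= C * D by rewrite /f normrM ler_pM.
rewrite (@indep_Rintegral_sub _ _ T _ K Pr G Z f _ Gm ind mf fC).
apply: eq_Rintegral => t _; rewrite /f /= RintegralZl//.
apply: (@bounded_integrable _ _ _ [the probability _ _ of distribution Pr Z] _ D); last by [].
apply: (measurableT_comp mphi); apply: measurable_addmx => //.
exact: (measurable_mulmx B (@measurable_id _ (borelV K r1) setT)).
Qed.

Lemma euler_measurable (K : realType) r r1 d (T : measurableType d)
    (W : K -> T -> borelV K r1) (X0 : T -> borelV K r) (a : 'M[K]_r) (B : 'M[K]_(r, r1))
    (h s : K) k : 0 <= h -> k%:R * h <= s ->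
  measurable_fun setT X0 -> (forall u, 0 <= u <= s -> measurable_fun setT (W u)) ->
  measurable_fun setT (fun t => euler a B (fun u => W u t) h (X0 t) k : borelV K r).
Proof.
move=> h0 ks mX mW; elim: k ks => [//|k IH] ks /=.
have kk : k%:R * h <= k.+1%:R * h by rewrite ler_wpM2r// ler_nat.
apply: measurable_addmx.
  by apply: measurable_mulmx; apply: IH; exact: le_trans ks.
apply: measurable_mulmx; apply: measurable_submx; apply: mW.
  by rewrite ks mulr_ge0.
by rewrite (le_trans kk ks) mulr_ge0.
Qed.

Section chain.
Context (K : realType) (d : measure_display) (T : measurableType d)
  (Pr : probability T K) (r r1 : nat) (W : K -> {mfun T >-> borelV K r1})
  (X0 : {mfun T >-> borelV K r}) (a : 'M[K]_r) (B : 'M[K]_(r, r1)) (h : K).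
Hypothesis h_ge0 : 0 <= h.
Hypothesis hW : brownian_motion Pr W.
Hypothesis hX0W : indep_systems Pr (sigma_rv X0) (sigma_process `[0, +oo[ W).

Let Y k t : borelV K r := euler a B (fun u => W u t) h (X0 t) k.
(** Covariance of one noise increment: in this section the time step is included in [R]. *)
Let R := h *: (B *m B^T).
Let G k : set_system T := sigma_rv X0 `|` sigma_process `[0, k%:R * h] W.

Let psdR : psdmx R.
Proof. by apply: psdmxZ => //; exact: psdmx_mulmx_tr. Qed.

Let dW k : {mfun T >-> borelV K r1} :=
  mfun_of (measurable_increment W (k%:R * h) (k.+1%:R * h)).

Let Gm k : G k `<=` measurable.
Proof. by move=> A [/sigma_rv_sub|/sigma_process_sub]. Qed.

Let kh_ge0 k : 0 <= k%:R * h.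
Proof. exact: mulr_ge0. Qed.

Let kh_le k : k%:R * h <= k.+1%:R * h.
Proof. by rewrite ler_wpM2r// ler_nat. Qed.

Let indG k : indep_systems Pr <<s G k >> (sigma_rv (dW k)).
Proof.
have [_ _ _ ind] := hW.
exact: (indep_join (kh_ge0 k) (kh_le k) hX0W (ind _ _ (kh_ge0 k) (kh_le k))).
Qed.

Let gauss_dW k : is_gaussian 0 h%:M (pushforward Pr (dW k)).
Proof.
have [_ _ g _] := hW; have := g _ _ (kh_ge0 k) (kh_le k).
by rewrite (_ : _ - _ = h)//; rewrite -natr1; ring.
Qed.

Let measurable_G k j : (j <= k)%N ->
  measurable_fun setT (Y j : g_sigma_algebraType (G k) -> borelV K r).
Proof.
move=> jk; apply: (@euler_measurable _ _ _ _ (g_sigma_algebraType (G k)) W X0 a B h (k%:R * h)) => //.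
- by rewrite ler_wpM2r// ler_nat.
- by move=> _ A mA; apply: sub_sigma_algebra; left; exists A.
- move=> u u0 _ A mA; apply: sub_sigma_algebra; right.
  by apply: sub_sigma_algebra; exists u; [rewrite /= in_itv|exists A].
Qed.

(** Integrating out the last increment contributes its Gaussian factor at [u] and pulls the
    frequency back to [a^T *m u]. *)
Lemma Rintegral_cos_euler j u al :
  \int[Pr]_t cos (dot u (Y j t) + al) =
  expR (- ((\sum_(i < j) qform R (iter i (mulmx a^T) u)) / 2)) *
    \int[Pr]_t cos (dot (iter j (mulmx a^T) u) (X0 t) + al).
Proof.
elim: j u => [|j IH] u; first by rewrite big_ord0 mul0r oppr0 expR0 mul1r.
pose phi (x : 'cV[K]_r) := cos (dot u x + al).
have mphi : measurable_fun setT (phi : borelV K r -> K).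
  exact: (measurable_cos_dot u al (@measurable_id _ (borelV K r) setT)).
have := @Rintegral_step K r1 d T Pr (G j) (dW j) r a B (Y j) (fun=> 1) phi 1 1
  (@Gm j) (@indG j) (measurable_G (leqnn j)) (measurable_cst _) _ mphi.
move=> /(_ (fun x => _)) H.
transitivity (\int[Pr]_t (1 * phi (a *m (Y j t : 'cV[K]_r) + B *m (dW j t : 'cV[K]_r1)))).
  by apply: eq_Rintegral => t _; rewrite mul1r.
rewrite H; [|by rewrite normr1|by move=> x; exact: cos_norm_le1].
transitivity (\int[Pr]_t (expR (- (qform R u / 2)) * cos (dot (a^T *m u) (Y j t) + al))).
  apply: eq_Rintegral => t _; rewrite mul1r -dot_mulmx.
  have := gaussian_transform_affine B (a *m (Y j t : 'cV[K]_r)) (gauss_dW j) u al.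
  by under eq_Rintegral do rewrite mul1r; rewrite mul1r => ->.
rewrite RintegralZl//; last first.
  apply: (@bounded_integrable _ _ _ Pr _ 1); last by move=> x; exact: cos_norm_le1.
  apply: measurable_cos_dot.
  by apply: (@euler_measurable _ _ _ _ T W X0 a B h (j%:R * h)).
rewrite IH mulrA -expRD -iterSr big_ord_recl /=.
congr (expR _ * _); rewrite mulrDl opprD; congr (_ - _ / 2).
by apply: eq_bigr => i _; congr (qform _ _); rewrite -iterSr.
Qed.

(* Each noise increment is tilted by [h0 Q], which turns the drift [a] into [L a];
   the quadratic form left over from the state is compensated by [D]. *)
Lemma Rintegral_h0_euler (Q : 'M[K]_r) (L := tiltmx R Q) (D := Q - a^T *m (Q *m L) *m a) :
  psdmx Q -> psdmx D -> exists2 k : K, 0 < k & forall j u al,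
  \int[Pr]_t (h0 Q (Y j t) * cos (dot u (Y j t) + al) *
     expR (- ((\sum_(i < j) qform D (Y i t)) / 2))) =
  k ^+ j * expR (- ((\sum_(i < j) qform (L *m R) (iter i (mulmx (L *m a)^T) u)) / 2)) *
    \int[Pr]_t (h0 Q (X0 t) * cos (dot (iter j (mulmx (L *m a)^T) u) (X0 t) + al)).
Proof.
move=> pQ pD; have [k k0 Hk] := gaussian_transform_tilt psdR pQ; exists k => //.
have mYT j : measurable_fun setT (Y j : T -> borelV K r).
  by apply: (@euler_measurable _ _ _ _ T W X0 a B h (j%:R * h)).
have psiM dd (TT : measurableType dd) (y : nat -> TT -> borelV K r) j :
    (forall i, (i < j)%N -> measurable_fun setT (y i)) ->
    measurable_fun setT (fun t => expR (- ((\sum_(i < j) qform D (y i t)) / 2))).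
  move=> my; apply: measurableT_comp => //; apply: measurableT_comp => //.
  apply: measurable_funM => //; apply: measurable_sum => i.
  by apply: measurable_qform; exact: my.
have psiC j t : `|expR (- ((\sum_(i < j) qform D (Y i t)) / 2))| <= 1.
  rewrite ger0_norm ?expR_ge0// -[leRHS]expR0 ler_expR oppr_le0 divr_ge0//.
  by apply: sumr_ge0 => i _; have [_] := pD.
elim=> [|j IH] u al.
  rewrite big_ord0 expr0 mul1r mul0r oppr0 expR0 mul1r.
  by apply: eq_Rintegral => t _; rewrite big_ord0 mul0r oppr0 expR0 mulr1.
pose phi (x : 'cV[K]_r) := h0 Q x * cos (dot u x + al).
have mid := @measurable_id _ (borelV K r) setT.
have mphi : measurable_fun setT (phi : borelV K r -> K).
  by apply: measurable_funM; [exact: (measurable_h0 Q mid)|exact: (measurable_cos_dot u al mid)].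
have phi1 x : `|phi x| <= 1.
  by rewrite normrM -[leRHS]mulr1 ler_pM ?h0_norm_le1 ?cos_norm_le1.
pose psi t := expR (- ((\sum_(i < j.+1) qform D (Y i t)) / 2)).
have mpsi : measurable_fun setT (psi : g_sigma_algebraType (G j) -> K).
  by apply: (psiM _ (g_sigma_algebraType (G j)) Y) => i ij; exact: measurable_G.
transitivity (\int[Pr]_t (psi t * phi (a *m (Y j t : 'cV[K]_r) + B *m (dW j t : 'cV[K]_r1)))).
  by apply: eq_Rintegral => t _; rewrite mulrC.
rewrite (@Rintegral_step K r1 d T Pr (G j) (dW j) r a B (Y j) psi phi 1 1
  (@Gm j) (@indG j) (measurable_G (leqnn j)) mpsi (psiC j.+1) mphi phi1).
transitivity (\int[Pr]_t (k * expR (- (qform (L *m R) u / 2)) *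
    (h0 Q (Y j t) * cos (dot ((L *m a)^T *m u) (Y j t) + al) *
     expR (- ((\sum_(i < j) qform D (Y i t)) / 2))))).
  apply: eq_Rintegral => t _.
  set y := a *m (Y j t : 'cV[K]_r).
  have mX : measurable_fun setT (fun z : borelV K r1 => y + B *m (z : 'cV[K]_r1) : borelV K r).
    by apply: measurable_addmx => //; exact: (measurable_mulmx B (@measurable_id _ (borelV K r1) setT)).
  have n1 (z : borelV K r1) : `|1 : K| <= 1 by rewrite normr1.
  have := Hk _ _ [the probability _ _ of distribution Pr (dW j)] _ (fun=> 1) 1 1 y mX
    (measurable_cst _) n1 (gaussian_transform_affine B y (gauss_dW j)) u al.
  under eq_Rintegral do rewrite mul1r; move=> ->.
  rewrite mul1r -/L -dot_mulmx -mulmxA -/y.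
  (* The exponent left by the tilt and the last term of the running sum recombine into [h0 Q] at the
     previous state, which is what the induction hypothesis expects. *)
  have e : h0 Q (Y j t) = expR (- (qform (Q *m L) y / 2)) * expR (- (qform D (Y j t) / 2)).
    rewrite -expRD /h0; congr expR.
    have -> : qform D (Y j t) = qform Q (Y j t) - qform (Q *m L) y.
      by rewrite /D qformBl -{2}[a]trmxK qform_congr trmxK.
    ring.
  rewrite /psi big_ord_recr /= mulrDl opprD expRD e; ring.
rewrite RintegralZl//; last first.
  apply: (@bounded_integrable _ _ _ Pr _ 1).
    apply: measurable_funM; last by apply: (psiM _ T Y).
    by apply: measurable_funM; [exact: measurable_h0|exact: measurable_cos_dot].
  move=> t; rewrite normrM -[leRHS]mulr1 ler_pM//.
  by rewrite normrM -[leRHS]mulr1 ler_pM ?h0_norm_le1 ?cos_norm_le1.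
rewrite IH -iterSr big_ord_recl /= mulrDl opprD expRD exprS.
have sE : \sum_(i < j) qform (L *m R) ((L *m a)^T *m iter (0 + i) (mulmx (L *m a)^T) u) =
    \sum_(i < j) qform (L *m R) (iter i (mulmx (L *m a)^T) ((L *m a)^T *m u)).
  by apply: eq_bigr => i _; congr (qform _ _); rewrite -iterSr.
rewrite sE; ring.
Qed.

End chain.

(** * Expansions in the time step *)

(** The matrix norm is the largest absolute entry, whence the dimension factors here and in later
    bounds. *)
Lemma mulmx_norm (K : realType) m n p (A : 'M[K]_(m, n)) (B : 'M[K]_(n, p)) :
  `|A *m B| <= n%:R * (`|A| * `|B|).
Proof.
apply: mx_norm_le => [|i j]; first by rewrite !mulr_ge0.
rewrite mxE; apply: le_trans (ler_norm_sum _ _ _) _.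
have -> : n%:R * (`|A| * `|B|) = \sum_(k < n) `|A| * `|B|.
  by rewrite sumr_const card_ord mulr_natl.
by apply: ler_sum => k _; rewrite normrM ler_pM ?le_mx_norm.
Qed.

Lemma trmx_norm (K : realType) m n (A : 'M[K]_(m, n)) : `|A^T| = `|A|.
Proof.
have H p q (M : 'M[K]_(p, q)) : `|M^T| <= `|M|.
  by apply: mx_norm_le => // i j; rewrite mxE le_mx_norm.
by apply/eqP; rewrite eq_le H -{1}[A]trmxK H.
Qed.

Lemma dot_norm (K : realType) r (x y : 'cV[K]_r) : `|dot x y| <= r%:R * (`|x| * `|y|).
Proof.
rewrite dotE; apply: le_trans (ler_norm_sum _ _ _) _.
have -> : r%:R * (`|x| * `|y|) = \sum_(k < r) `|x| * `|y|.
  by rewrite sumr_const card_ord mulr_natl.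
by apply: ler_sum => k _; rewrite normrM ler_pM ?le_mx_norm.
Qed.

Lemma qform_norm (K : realType) r (M : 'M[K]_r) (x : 'cV[K]_r) :
  `|qform M x| <= r%:R ^+ 2 * `|M| * `|x| ^+ 2.
Proof.
rewrite qformE; apply: le_trans (dot_norm _ _) _.
have := mulmx_norm M x => h.
apply: le_trans (ler_wpM2l _ (ler_wpM2l _ h)) _ => //.
by rewrite le_eqVlt; apply/orP; left; apply/eqP; ring.
Qed.

Lemma qform_dot (K : realType) r (M : 'M[K]_r) (x : 'cV[K]_r) :
  `|qform M x| <= r%:R * `|M| * dot x x.
Proof.
rewrite qformE dotE; apply: le_trans (ler_norm_sum _ _ _) _.
have H i : `|x i 0 * (M *m x) i 0| <= \sum_j `|M| * ((x i 0 ^+ 2 + x j 0 ^+ 2) / 2).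
  rewrite normrM mxE.
  apply: le_trans (ler_wpM2l _ (ler_norm_sum _ _ _)) _ => //.
  rewrite mulr_sumr; apply: ler_sum => j _; rewrite normrM mulrCA.
  apply: ler_pM => //; first exact: le_mx_norm.
  have := sqr_ge0 (`|x i 0| - `|x j 0|).
  rewrite sqrrB !real_normK ?num_real//; lra.
apply: le_trans (ler_sum _ (fun i _ => H i)) _.
rewrite le_eqVlt; apply/orP; left; apply/eqP.
rewrite dotE -[in RHS](eq_bigr _ (fun i _ => expr2 (x i 0))).
set s := \sum_i x i 0 ^+ 2.
rewrite (eq_bigr (fun i => r%:R * `|M| / 2 * x i 0 ^+ 2 + `|M| * (s / 2))).
  rewrite big_split /= sumr_const card_ord -[_ *+ r]mulr_natl -mulr_sumr -/s.
  by field.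
move=> i _; rewrite /s mulr_suml; rewrite (eq_bigr (fun j => `|M| * x i 0 ^+ 2 / 2 + `|M| * (x j 0 ^+ 2 / 2))).
  by rewrite big_split /= sumr_const card_ord -mulr_natl -mulr_sumr; ring.
by move=> j _; ring.
Qed.

Lemma dot_ge0 (K : realType) r (x : 'cV[K]_r) : 0 <= dot x x.
Proof. by rewrite dotE; apply: sumr_ge0 => i _; rewrite -expr2 sqr_ge0. Qed.

Lemma dot_eq0 (K : realType) r (x : 'cV[K]_r) : dot x x = 0 -> x = 0.
Proof.
rewrite dotE => /eqP; rewrite psumr_eq0 => [/allP h|i _]; last by rewrite -expr2 sqr_ge0.
apply/matrixP => i j; rewrite (ord1 j) mxE.
by have := h i (mem_index_enum i); rewrite /= -expr2 sqrf_eq0 => /eqP.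
Qed.

Lemma posdefmx_unit (K : realType) r (Q : 'M[K]_r) : posdefmx Q -> Q \in unitmx.
Proof.
move=> [_ Q0]; apply: unitmx_ker0 => x Qx; apply/eqP/negPn/negP => /Q0.
by rewrite qformE Qx dot0r ltxx.
Qed.

(** Cauchy-Schwarz for Q between Q^-1 x and x gives |x|^4 <= (x^T Q^-1 x) (x^T Q x), and the first
    factor is at most a multiple of |x|^2. *)
Lemma posdefmx_coercive (K : realType) r (Q : 'M[K]_r) : posdefmx Q ->
  exists2 C, 0 < C & forall x, dot x x <= C * qform Q x.
Proof.
move=> pQ; have U := posdefmx_unit pQ; have psQ := posdefmx_psd pQ.
have [sQ Q0] := psQ.
exists (r%:R * `|invmx Q| + 1); first by rewrite ltr_wpDl// mulr_ge0.
move=> x; have [x0|x0] := eqVneq (dot x x) 0.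
  by rewrite x0 mulr_ge0// addr_ge0// mulr_ge0.
have xp : 0 < dot x x by rewrite lt_neqAle eq_sym x0 dot_ge0.
have := psdmx_Cauchy (invmx Q *m x) x psQ.
have -> : dot (invmx Q *m x) (Q *m x) = dot x x.
  by rewrite dot_mulmx sQ mulmxA mulmxV// mul1mx.
have -> : qform Q (invmx Q *m x) = qform (invmx Q) x.
  by rewrite !qformE mulmxA mulmxV// mul1mx dotC.
move=> h.
have h2 : dot x x ^+ 2 <= (r%:R * `|invmx Q| + 1) * dot x x * qform Q x.
  apply: le_trans h _; rewrite ler_wpM2r//.
  apply: le_trans (ler_norm _) _; apply: le_trans (qform_dot _ _) _.
  by rewrite mulrDl mul1r lerDl ltW.
by rewrite -(ler_pM2l xp) -expr2; apply: le_trans h2 _; rewrite mulrCA mulrA.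
Qed.

Lemma expr1D_le_expR (K : realType) (c h t : K) k : 0 <= c -> 0 <= h -> k%:R * h <= t ->
  (1 + c * h) ^+ k <= expR (c * t).
Proof.
move=> c0 h0 kt; apply: (@le_trans _ _ (expR (c * h) ^+ k)).
  by rewrite lerXn2r ?nnegrE ?expR_ge0 ?expR_ge1Dx// addr_ge0// mulr_ge0.
by rewrite -expRM_natl ler_expR mulrCA ler_wpM2l.
Qed.

Lemma discrete_gronwall (K : realType) (e : nat -> K) (c h eta t : K) N :
  0 <= c -> 0 <= h -> 0 <= eta -> e 0%N = 0 -> N%:R * h <= t ->
  (forall k, (k < N)%N -> e k.+1 <= (1 + c * h) * e k + h * eta) ->
  forall k, (k <= N)%N -> e k <= t * eta * expR (c * t).
Proof.
move=> c0 h0 eta0 e0 Nt eS k kN.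
have ch : 1 <= 1 + c * h by rewrite lerDl mulr_ge0.
have H : e k <= k%:R * h * eta * (1 + c * h) ^+ k.
  elim: k kN => [|k IH] kN; first by rewrite e0 mul0r mul0r mul0r.
  apply: le_trans (eS k kN) _.
  have := IH (ltnW kN) => {}IH.
  apply: le_trans (lerD (ler_wpM2l _ IH) (lexx _)) _; first exact: le_trans ch.
  have E1 : 1 <= (1 + c * h) ^+ k.+1 by rewrite exprn_ege1.
  have -> : k.+1%:R * h * eta * (1 + c * h) ^+ k.+1 =
    (1 + c * h) * (k%:R * h * eta * (1 + c * h) ^+ k) + h * eta * (1 + c * h) ^+ k.+1.
    by rewrite -natr1 exprS; ring.
  by rewrite lerD2l ler_peMr// mulr_ge0.
have kt : k%:R * h <= t by apply: le_trans Nt; rewrite ler_wpM2r// ler_nat.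
apply: le_trans H _; apply: ler_pM.
- by rewrite !mulr_ge0.
- by rewrite exprn_ge0// (le_trans _ ch).
- by rewrite ler_wpM2r.
- exact: expr1D_le_expR.
Qed.

(** f(h) = F0 + h F1 + O(h^2) at 0+. Over t / h steps the quadratic errors sum to O(h), so only F0
    and F1 survive in the limit. *)
Definition expands (K : realType) m n (f : K -> 'M[K]_(m, n)) (F0 F1 : 'M[K]_(m, n)) : Prop :=
  exists C : K, exists2 h1 : K, 0 < h1 &
    forall h, 0 <= h -> h <= h1 -> `|f h - F0 - h *: F1| <= C * h ^+ 2.

Lemma expands_bounded (K : realType) m n (f : K -> 'M[K]_(m, n)) F0 F1 : expands f F0 F1 ->
  exists C : K, exists2 h1 : K, 0 < h1 & forall h, 0 <= h -> h <= h1 -> `|f h| <= C.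
Proof.
move=> [C [h1 h10 H]]; exists (`|C| * h1 ^+ 2 + `|F0| + h1 * `|F1|), h1 => // h h0 hh1.
rewrite -[f h](subrK F0) -[f h - F0](subrK (h *: F1)).
apply: le_trans (ler_normD _ _) _.
rewrite [leRHS]addrAC; apply: le_trans (lerD (ler_normD _ _) (lexx _)) _.
apply: lerD; last by [].
apply: lerD; last by rewrite normrZ ger0_norm// ler_wpM2r.
apply: le_trans (H _ h0 hh1) _; apply: le_trans (ler_norm _) _.
by rewrite normrM ler_wpM2l// ger0_norm ?exprn_ge0// lerXn2r ?nnegrE// (le_trans h0).
Qed.

Lemma expandsM (K : realType) m n p (f : K -> 'M[K]_(m, n)) (g : K -> 'M[K]_(n, p))
    F0 F1 G0 G1 : expands f F0 F1 -> expands g G0 G1 ->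
  expands (fun h => f h *m g h) (F0 *m G0) (F0 *m G1 + F1 *m G0).
Proof.
move=> ef eg; have [Bg [hb hb0 gB]] := expands_bounded eg.
have [Cf [hf hf0 fC]] := ef; have [Cg [hg hg0 gC]] := eg.
have hm0 : 0 < Num.min hb (Num.min hf hg) by rewrite !lt_min hb0 hf0 hg0.
exists (n%:R * (`|Cf| * `|Bg|) + n%:R * ((`|F0| + hf * `|F1|) * `|Cg|) + `|F1 *m G1|),
  (Num.min hb (Num.min hf hg)) => // h h0; rewrite !le_min => /andP[hhb /andP[hhf hhg]].
have -> : f h *m g h - F0 *m G0 - h *: (F0 *m G1 + F1 *m G0) =
  (f h - F0 - h *: F1) *m g h + (F0 + h *: F1) *m (g h - G0 - h *: G1) + h ^+ 2 *: (F1 *m G1).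
  rewrite -(addrA (f h)) -(addrA (g h)) -!opprD mulmxBl mulmxBr addrA subrK.
  rewrite mulmxDl !mulmxDr -!scalemxAl -!scalemxAr scalerA -expr2 scalerDr.
  by rewrite !opprD !addrA subrK.
apply: le_trans (ler_normD _ _) _; rewrite [leRHS]mulrDl; apply: lerD; last first.
  by rewrite normrZ ger0_norm ?exprn_ge0// mulrC.
apply: le_trans (ler_normD _ _) _; rewrite mulrDl; apply: lerD.
  apply: le_trans (mulmx_norm _ _) _; rewrite -mulrA ler_wpM2l// mulrAC ler_pM//.
    apply: le_trans (fC _ h0 hhf) _; rewrite ler_wpM2r ?exprn_ge0// ler_norm//.
  by apply: le_trans (gB _ h0 hhb) _; exact: ler_norm.
apply: le_trans (mulmx_norm _ _) _; rewrite -mulrA ler_wpM2l// -mulrA ler_pM//.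
  apply: le_trans (ler_normD _ _) _; rewrite lerD2l normrZ ger0_norm// ler_wpM2r//.
apply: le_trans (gC _ h0 hhg) _; rewrite ler_wpM2r ?exprn_ge0// ler_norm//.
Qed.

Lemma expands_cst (K : realType) m n (M : 'M[K]_(m, n)) : expands (fun=> M) M 0.
Proof.
exists 0, 1 => // h _ _.
by rewrite subrr sub0r scaler0 oppr0 normr0 mul0r.
Qed.

Lemma expands_linear (K : realType) m n (M N : 'M[K]_(m, n)) :
  expands (fun h => M + h *: N) M N.
Proof.
exists 0, 1 => // h _ _.
by rewrite (addrC M) addrK subrr normr0 mul0r.
Qed.

Lemma expands_tr (K : realType) m n (f : K -> 'M[K]_(m, n)) F0 F1 : expands f F0 F1 ->
  expands (fun h => (f h)^T) F0^T F1^T.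
Proof.
move=> [C [h1 h10 H]]; exists C, h1 => // h h0 hh.
by rewrite -linearZ -!linearB /= trmx_norm H.
Qed.

Lemma expandsZ2 (K : realType) m n (f : K -> 'M[K]_(m, n)) F0 F1 (c : K) : expands f F0 F1 ->
  expands (fun h => (1 - c * h ^+ 2) *: f h) F0 F1.
Proof.
move=> ef; have [B [hb hb0 fB]] := expands_bounded ef.
have [C [h1 h10 H]] := ef.
exists (C + `|c| * B), (Num.min hb h1); first by rewrite lt_min hb0.
move=> h h0; rewrite le_min => /andP[hhb hh1].
rewrite scalerBl scale1r.
have -> : f h - (c * h ^+ 2) *: f h - F0 - h *: F1 =
  (f h - F0 - h *: F1) - (c * h ^+ 2) *: f h.
  by apply/matrixP => i j; rewrite !mxE; ring.
apply: le_trans (ler_normB _ _) _; rewrite mulrDl lerD ?H//.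
rewrite normrZ normrM (ger0_norm (exprn_ge0 _ _))// mulrAC ler_wpM2r ?exprn_ge0//.
by rewrite ler_wpM2l// fB.
Qed.

(** Substituting L = 1 - h R Q L into itself leaves the remainder h^2 (R Q)^2 L, so a bound on L for
    small h suffices. *)
Lemma expands_tiltmx (K : realType) r (R Q : 'M[K]_r) : psdmx R -> psdmx Q ->
  expands (fun h => tiltmx (h *: R) Q) 1%:M (- (R *m Q)).
Proof.
move=> pR pQ.
have LE h : 0 <= h -> tiltmx (h *: R) Q = 1%:M - h *: (R *m Q *m tiltmx (h *: R) Q).
  move=> h0; have U := unitmx_1DPQ (psdmxZ h0 pR) pQ.
  have := mulmxV U; rewrite -/(tiltmx (h *: R) Q) mulmxDl mul1mx -!scalemxAl => <-.
  by rewrite addrK.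
pose c := r%:R * `|R *m Q|.
have c0 : 0 <= c by rewrite mulr_ge0.
(* Then h c <= 1/2, and |L| <= 1 + h c |L| yields |L| <= 2. *)
pose h1 := (2 * (c + 1))^-1.
have h10 : 0 < h1 by rewrite invr_gt0 mulr_gt0// ltr_wpDl.
have LB h : 0 <= h -> h <= h1 -> `|tiltmx (h *: R) Q| <= 2.
  move=> h0 hh1; set L := tiltmx _ _.
  have : `|L| <= 1 + h * (c * `|L|).
    rewrite {1}/L LE// -/L; apply: le_trans (ler_normB _ _) _; apply: lerD.
      apply: mx_norm_le => // i j; rewrite mxE.
      by case: (i == j); rewrite ?normr1 ?normr0.
    rewrite normrZ ger0_norm// ler_wpM2l//; apply: le_trans (mulmx_norm _ _) _.
    by rewrite /c mulrA.
  have : h * c <= 2^-1.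
    apply: le_trans (ler_wpM2r c0 hh1) _; rewrite /h1 invfM -mulrA ler_piMr ?invr_ge0//.
    by rewrite mulrC ler_pdivrMr ?ltr_wpDl// mul1r lerDl.
  move=> hc hL; have : h * c * `|L| <= 2^-1 * `|L| by rewrite ler_wpM2r.
  move: hL; rewrite mulrA; lra.
exists (c * c * 2), h1 => // h h0 hh1.
have -> : tiltmx (h *: R) Q - 1%:M - h *: - (R *m Q) =
    h ^+ 2 *: (R *m Q *m (R *m Q *m tiltmx (h *: R) Q)).
  rewrite {1}LE// [1%:M - _ - _]addrAC subrr add0r scalerN opprK {1}LE//.
  by rewrite mulmxBr mulmx1 scalerBr opprB subrK -scalemxAr scalerA -expr2.
rewrite normrZ ger0_norm ?exprn_ge0// mulrC ler_wpM2r ?exprn_ge0//.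
apply: le_trans (mulmx_norm _ _) _; rewrite mulrA -/c -mulrA ler_wpM2l//.
apply: le_trans (mulmx_norm _ _) _; rewrite mulrA -/c ler_wpM2l//.
exact: LB.
Qed.

Lemma expands_norm (K : realType) m n (f : K -> 'M[K]_(m, n)) F0 F1 : expands f F0 F1 ->
  exists2 C : K, 0 <= C & exists2 h1 : K, 0 < h1 & forall h, 0 <= h -> h <= h1 ->
    `|f h - F0| <= C * h.
Proof.
move=> [C [h1 h10 H]]; exists (`|C| * h1 + `|F1|); first by rewrite addr_ge0// mulr_ge0// ltW.
exists h1 => // h h0 hh1.
rewrite -[f h - F0](subrK (h *: F1)); apply: le_trans (ler_normD _ _) _.
rewrite mulrDl; apply: lerD; last by rewrite normrZ ger0_norm// mulrC.
apply: le_trans (H _ h0 hh1) _; apply: le_trans (ler_norm _) _.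
rewrite normrM [`|h ^+ 2|]ger0_norm ?exprn_ge0// -mulrA ler_wpM2l// expr2.
by rewrite ler_wpM2r.
Qed.

(** Stability: each step multiplies the norm by at most 1 + O(h), and (1 + c h)^k <= exp(c t). *)
Lemma expands_iter_bounded (K : realType) r (f : K -> 'M[K]_r) F1 (t : K) :
  expands f 1%:M F1 -> 0 <= t ->
  exists2 C : K, 0 <= C & \forall n \near \oo, forall (u : 'cV[K]_r) k, (k <= n.+1)%N ->
    `|iter k (mulmx (f (mesh t n))) u| <= C * `|u|.
Proof.
move=> /expands_norm [C C0 [h1 h10 H]] t0.
exists (expR (r%:R * C * t)); first exact: expR_ge0.
have : \forall n \near \oo, `|mesh t n| < h1.
  by have /cvgr0Pnorm_lt /(_ h1 h10) := cvg_mesh t.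
apply: filterS => n nh u k kn.
have hn0 := mesh_ge0 n t0.
have hn1 : mesh t n <= h1 by apply: le_trans (ltW nh); exact: ler_norm.
have ch : 0 <= r%:R * C * mesh t n by rewrite !mulr_ge0.
have step (v : 'cV[K]_r) : `|f (mesh t n) *m v| <= (1 + r%:R * C * mesh t n) * `|v|.
  rewrite -[f (mesh t n)](subrK 1%:M) mulmxDl mul1mx addrC mulrDl mul1r.
  apply: le_trans (ler_normD _ _) _; rewrite lerD2l.
  apply: le_trans (mulmx_norm _ _) _; rewrite mulrA ler_wpM2r// -mulrA ler_wpM2l//.
  exact: H.
have : `|iter k (mulmx (f (mesh t n))) u| <= (1 + r%:R * C * mesh t n) ^+ k * `|u|.
  elim: k {kn} => [|k IH]; first by rewrite expr0 mul1r.
  rewrite /= exprS -[leRHS]mulrA; apply: le_trans (step _) _.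
  by rewrite ler_wpM2l// addr_ge0.
move=> h; apply: le_trans h _; rewrite ler_wpM2r//.
by apply: expr1D_le_expR; rewrite ?mulr_ge0//; have /andP[] := mesh_le t0 kn.
Qed.

(* The factor [1 - kappa h^2], invisible in the limit, makes the discrete
   Riccati remainder [dissipation] positive semi-definite. *)
Definition drift_step (K : realType) r (A : 'M[K]_r) (kappa h : K) : 'M[K]_r :=
  (1 - kappa * h ^+ 2) *: (1%:M + h *: A).

Definition dissipation (K : realType) r (A R Q : 'M[K]_r) (kappa h : K) : 'M[K]_r :=
  Q - (drift_step A kappa h)^T *m (Q *m tiltmx (h *: R) Q) *m drift_step A kappa h.

Lemma expands_drift_step (K : realType) r (A : 'M[K]_r) kappa :
  expands (drift_step A kappa) 1%:M A.
Proof. exact: (expandsZ2 kappa (expands_linear 1%:M A)). Qed.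

Lemma expands_tilted_drift (K : realType) r (A R Q : 'M[K]_r) kappa :
  psdmx R -> psdmx Q ->
  expands (fun h => tiltmx (h *: R) Q *m drift_step A kappa h) 1%:M (A - R *m Q).
Proof.
move=> pR pQ.
have := expandsM (expands_tiltmx pR pQ) (expands_drift_step A kappa).
by rewrite !mul1mx mulmx1.
Qed.

(** The first-order coefficient is A^T Q + Q A - Q R Q, which is - S by the Riccati equation. *)
Lemma expands_quadratic (K : realType) r (A R S Q : 'M[K]_r) (f : K -> 'M[K]_r) :
  psdmx R -> psdmx Q -> riccati_eq A R S Q -> expands f 1%:M A ->
  expands (fun h => (f h)^T *m (Q *m tiltmx (h *: R) Q) *m f h) Q (- S).
Proof.
move=> pR pQ ric ef.
have e1 := expandsM (expands_cst Q) (expands_tiltmx pR pQ).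
have e2 := expandsM (expandsM (expands_tr ef) e1) ef.
move: e2; rewrite trmx1 !mul1mx !mulmx1 addr0.
rewrite (_ : _ + _ = - S) //.
apply/eqP; rewrite -subr_eq0 opprK -[X in _ == X]ric; apply/eqP.
rewrite mulmxN (mulmxA Q).
by apply/matrixP => i j; rewrite [LHS]mxE [RHS]mxE [in LHS]mxE [in RHS]mxE; congr (_ + _); rewrite !mxE; ring.
Qed.

(** With the plain drift the form is h S + O(h^2). Coercivity of Q bounds the error by kappa h^2 Q,
    and the factor 1 - kappa h^2 in the drift compensates exactly such an error. *)
Lemma dissipation_psd (K : realType) r (A R S Q : 'M[K]_r) :
  psdmx R -> psdmx S -> posdefmx Q -> riccati_eq A R S Q ->
  exists kappa : K, exists2 h1 : K, 0 < h1 &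
    forall h, 0 <= h -> h <= h1 -> psdmx (dissipation A R Q kappa h).
Proof.
move=> pR pS pdQ ric; have pQ := posdefmx_psd pdQ; have [sQ Q0] := pQ.
have [C [h1 h10 H]] := expands_quadratic pR pQ ric (expands_linear 1%:M A).
have [c c0 Hc] := posdefmx_coercive pdQ.
(* [C] bounds the quadratic remainder, r converts the entry norm into a Euclidean bound on forms,
   and [c] is the coercivity constant of [Q]. *)
pose kappa := r%:R * `|C| * c.
have k0 : 0 <= kappa by rewrite !mulr_ge0// ltW.
pose h2 := Num.min h1 ((kappa + 1)^-1 : K).
have k1 : 0 < kappa + 1 by rewrite ltr_wpDl.
have h20 : 0 < h2 by rewrite lt_min h10 invr_gt0.
exists kappa, (Num.min h2 1); first by rewrite lt_min h20 ltr01.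
move=> h h0; rewrite !le_min => /andP[/andP[hh1 hk] hl1].
have kh : kappa * h ^+ 2 <= 1.
  have h2h : h ^+ 2 <= h by rewrite expr2 ler_piMr.
  apply: le_trans (ler_wpM2l k0 (le_trans h2h hk)) _.
  by rewrite ler_pdivrMr// mul1r lerDl.
have kh0 : 0 <= kappa * h ^+ 2 by rewrite mulr_ge0// exprn_ge0.
pose E := (1%:M + h *: A)^T *m (Q *m tiltmx (h *: R) Q) *m (1%:M + h *: A).
have DE : dissipation A R Q kappa h = Q - (1 - kappa * h ^+ 2) ^+ 2 *: E.
  rewrite /dissipation /drift_step /E [(_ *: (_ + _))^T]linearZ /=.
  by rewrite -scalemxAr -2!scalemxAl scalerA expr2.
have phR : psdmx (h *: R) by exact: psdmxZ.
have sG : (Q *m tiltmx (h *: R) Q)^T = Q *m tiltmx (h *: R) Q.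
  have [sR _] := phR.
  rewrite trmx_mul sQ tiltmx_tr// mulmxBl mul1mx -!mulmxA.
  have e : tiltmx (h *: R) Q *m (h *: R *m Q) = 1%:M - tiltmx (h *: R) Q.
    have := mulVmx (unitmx_1DPQ phR pQ); rewrite -/(tiltmx (h *: R) Q) mulmxDr mulmx1 => <-.
    by rewrite addrC addKr.
  by rewrite e mulmxBr mulmx1 opprB addrC subrK.
split.
  by rewrite DE /E linearB linearZ /= trmx_mul [(_ *m (_ *m _))^T]trmx_mul sG trmxK sQ mulmxA.
move=> x; rewrite DE qformBl qformZl subr_ge0.
set z := 1 - kappa * h ^+ 2.
have z0 : 0 <= z by rewrite subr_ge0.
have z1 : z <= 1 by rewrite lerBlDr lerDl.
have z2 : z ^+ 2 <= z by rewrite expr2 ler_piMr.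
have [_ S0] := pS.
have qE : qform E x <= qform Q x + kappa * h ^+ 2 * qform Q x.
  have := H h h0 hh1; rewrite -/E => HE.
  have -> : qform E x = qform Q x - h * qform S x + qform (E - Q - h *: - S) x.
    by rewrite !qformBl qformZl -[- S]scaleN1r qformZl; ring.
  apply: lerD; first by rewrite gerBl mulr_ge0.
  apply: le_trans (ler_norm _) _; apply: le_trans (qform_dot _ _) _.
  have HE' : `|E - Q - h *: - S| <= `|C| * h ^+ 2.
    by apply: le_trans HE _; rewrite ler_wpM2r ?exprn_ge0// ler_norm.
  rewrite /kappa.
  have -> : r%:R * `|C| * c * h ^+ 2 * qform Q x = r%:R * (`|C| * h ^+ 2) * (c * qform Q x) by ring.
  by apply: ler_pM; rewrite ?mulr_ge0 ?dot_ge0// ler_wpM2l.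
have z20 : 0 <= z ^+ 2 by rewrite exprn_ge0.
apply: le_trans (ler_wpM2l z20 qE) _.
have -> : z ^+ 2 * (qform Q x + kappa * h ^+ 2 * qform Q x) =
  z ^+ 2 * (1 + kappa * h ^+ 2) * qform Q x by ring.
(* What remains is z^2 (1 + kappa h^2) <= 1, from z^2 <= z and z (1 + kappa h^2) = 1 - (kappa
   h^2)^2. *)
rewrite ler_piMl//.
apply: le_trans (ler_wpM2r _ z2) _; first by rewrite addr_ge0.
rewrite /z (_ : (1 - kappa * h ^+ 2) * (1 + kappa * h ^+ 2) = 1 - (kappa * h ^+ 2) ^+ 2).
  by rewrite gerBl exprn_ge0.
by ring.
Qed.

Lemma expands_dissipation (K : realType) r (A R S Q : 'M[K]_r) kappa :
  psdmx R -> psdmx Q -> riccati_eq A R S Q ->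
  expands (dissipation A R Q kappa) 0 S.
Proof.
move=> pR pQ ric.
have [C [h1 h10 H]] := expands_quadratic pR pQ ric (expands_drift_step A kappa).
exists C, h1 => // h h0 hh1; have := H h h0 hh1.
rewrite -normrN; congr (`|_| <= _).
by rewrite /dissipation scalerN opprK subr0 opprD opprB.
Qed.

(** * Convergence of the Euler chains *)

Lemma continuous_bounded_itv (K : realType) (V : normedModType K) (f : K -> V) (t : K) :
  {within `[0, +oo[, continuous f} -> exists2 C : K, 0 <= C &
    forall s, 0 <= s <= t -> `|f s| <= C.
Proof.
move=> cf; have [t0|t0] := leP 0 t; last first.
  exists 0 => // s /andP[s0 st]; by have := lt_le_trans t0 (le_trans s0 st); rewrite ltxx.
have cn : {within `[0, t], continuous (fun s => `|f s|)}.
  have : {within `[0, +oo[, continuous (fun s => `|f s|)}.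
    by move=> s; apply: cvg_norm; exact: cf.
  by apply: continuous_subspaceW => s /=; rewrite !in_itv /= => /andP[->].
have [c _ H] := EVT_max t0 cn.
by exists `|f c| => // s st; apply: H; rewrite in_itv.
Qed.

(** y' = f on [0, t] in the sense that one explicit Euler step has error o(h), uniformly in its
    starting time. Both integral equations and differential equations yield it, and Gronwall
    arguments need no more. *)
Definition consistent (K : realType) m n (t : K) (y f : K -> 'M[K]_(m, n)) : Prop :=
  forall e : K, 0 < e -> exists2 d : K, 0 < d & forall s h : K, 0 <= s -> 0 <= h -> h <= d ->
    s + h <= t -> `|y (s + h) - y s - h *: f s| <= h * e.

Lemma consistent_integral (K : realType) r (t : K) (y f : K -> 'cV[K]_r) :
  {within `[0, +oo[, continuous f} ->
  (forall s : K, 0 <= s -> y s = y 0 + \col_i \int[lebesgue_measure]_(u in `[0, s]) f u i 0) ->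
  consistent t y f.
Proof.
move=> cf yE e e0; have [d d0 H] := unif_continuous_itv t cf e0.
exists (d / 2); first by rewrite divr_gt0.
move=> s h s0 h0 hd sht; have sh0 : 0 <= s + h by rewrite addr_ge0.
apply: mx_norm_le => [|i j]; first by rewrite mulr_ge0// ltW.
have ssh : s <= s + h by rewrite lerDl.
have osc x : s <= x <= s + h -> `|f x i 0 - f s i 0| <= e.
  move=> /andP[sx xh]; apply: le_trans (H x s _ _ _).
  - by have := @le_mx_norm K r 1 (f x - f s) i 0; rewrite !mxE.
  - by rewrite (le_trans s0 sx) (le_trans xh).
  - by rewrite s0 (le_trans _ sht).
  - rewrite ger0_norm ?subr_ge0// ltrBlDl (le_lt_trans xh)// ltrD2l (le_lt_trans hd)//.
    by rewrite ltr_pdivrMr// ltr_pMr// ltr1n.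
have := Rintegral_increment (@continuous_entry_fun _ _ _ f _ i 0 cf) s0 ssh osc.
rewrite [s + h - s]addrC addKr; apply: le_trans.
rewrite (ord1 j) (yE _ s0) (yE _ sh0) !mxE le_eqVlt; apply/orP; left; apply/eqP.
by congr `|_|; ring.
Qed.

Lemma is_derive_entry (K : realType) m n (y : K -> 'M[K]_(m, n)) (t : K) D i j :
  is_derive t 1 y D -> is_derive t 1 (fun s => y s i j) (D i j).
Proof.
move=> [dy <-]; have /derivable_mxP dyij := dy.
by rewrite derive_mx// mxE; exact: derivableP.
Qed.

Lemma consistent_derive (K : realType) m n (t : K) (y f : K -> 'M[K]_(m, n)) :
  {within `[0, +oo[, continuous y} -> {within `[0, +oo[, continuous f} ->
  (forall s : K, 0 < s -> is_derive s 1 y (f s)) -> consistent t y f.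
Proof.
move=> cy cf dy e e0; have [d d0 H] := unif_continuous_itv t cf e0.
exists (d / 2); first by rewrite divr_gt0.
move=> s h s0 h0 hd sht; have sh0 : 0 <= s + h by rewrite addr_ge0.
apply: mx_norm_le => [|i j]; first by rewrite mulr_ge0// ltW.
have ssh : s <= s + h by rewrite lerDl.
have dij x : x \in `]s, (s + h)[%R -> is_derive x 1 (fun u => y u i j) (f x i j).
  rewrite in_itv /= => /andP[sx _]; apply: is_derive_entry; apply: dy.
  exact: le_lt_trans sx.
have cij : {within `[s, s + h], continuous (fun u => y u i j)}.
  apply: (continuous_subspaceW _ (@continuous_entry_fun _ _ _ y _ i j cy)) => u /=.
  by rewrite !in_itv /= => /andP[su _]; rewrite (le_trans s0 su).
have [c] := MVT_segment ssh dij cij.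
rewrite in_itv /= => /andP[sc ch] E.
have -> : (y (s + h) - y s - h *: f s) i j = h * (f c i j - f s i j).
  by move: E; rewrite !mxE => ->; ring.
rewrite normrM ger0_norm// ler_wpM2l//; apply: le_trans (H c s _ _ _).
- by have := @le_mx_norm K m n (f c - f s) i j; rewrite !mxE.
- by rewrite (le_trans s0 sc) (le_trans ch).
- by rewrite s0 (le_trans _ sht)// lerDl.
- rewrite ger0_norm ?subr_ge0// ltrBlDl (le_lt_trans ch)// ltrD2l (le_lt_trans hd)//.
  by rewrite ltr_pdivrMr// ltr_pMr// ltr1n.
Qed.

Lemma cvg_mesh_lt (K : realType) (t d : K) : 0 <= t -> 0 < d ->
  \forall n \near \oo, mesh t n <= d.
Proof.
move=> t0 d0; have /cvgr0Pnorm_lt /(_ d d0) := cvg_mesh t.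
by apply: filterS => n nh; apply: le_trans (ltW nh); exact: ler_norm.
Qed.

(** The path [p] is rough, but x - B p is consistent, and the chain contains the increments of B p
    exactly; they cancel from the error recursion, to which Gronwall applies. *)
Lemma cvg_euler (K : realType) r r1 (a : K -> 'M[K]_r) (M : 'M[K]_r) (B : 'M[K]_(r, r1))
    (p : K -> 'cV[K]_r1) (x : K -> 'cV[K]_r) (t : K) : 0 <= t ->
  expands a 1%:M M -> {within `[0, +oo[, continuous x} ->
  consistent t (fun s => x s - B *m p s) (fun s => M *m x s) ->
  forall e, 0 < e -> \forall n \near \oo, forall k, (k <= n.+1)%N ->
    `|euler (a (mesh t n)) B p (mesh t n) (x 0) k - x (k%:R * mesh t n)| <= e.
Proof.
move=> t0 ea cx cons e e0.
have [Cx Cx0 xB] := continuous_bounded_itv t cx.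
have [C1 C10 [h1 h10 a1]] := expands_norm ea.
have [C [h2 h20 a2]] := ea.
pose c := r%:R * C1; have c0 : 0 <= c by rewrite mulr_ge0.
pose G := (t + 1) * expR (c * t).
have G0 : 0 < G by rewrite mulr_gt0 ?expR_gt0// ltr_wpDl.
(* [G] is the Gronwall factor; the local error is split into [e'] for consistency and [e'] for the
   quadratic remainder of [a], the latter through the choice of [h3]. *)
pose e' := e / (2 * G); have e'0 : 0 < e' by rewrite divr_gt0// mulr_gt0.
have [d d0 yd] := cons e' e'0.
pose C2 := r%:R * `|C| * Cx + 1.
have C20 : 0 < C2 by rewrite ltr_wpDl// !mulr_ge0.
pose h3 := e' / C2; have h30 : 0 < h3 by rewrite divr_gt0.
have hm : 0 < Num.min (Num.min h1 h2) (Num.min d h3) by rewrite !lt_min h10 h20 d0 h30.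
have := cvg_mesh_lt t0 hm; apply: filterS => n.
rewrite !le_min => /andP[/andP[nh1 nh2] /andP[nd nh3]].
set h := mesh t n in nh1 nh2 nd nh3 *.
have hn0 : 0 <= h by exact: mesh_ge0.
pose E k := `|euler (a h) B p h (x 0) k - x (k%:R * h)|.
move=> k kn.
have := @discrete_gronwall K E c h (2 * e') t n.+1 c0 hn0 _ _ _ _ k kn.
move=> /(_ _ _ _ _)/le_trans; apply.
- by rewrite mulr_ge0// ltW.
- by rewrite /E /= mul0r subrr normr0.
- by rewrite mesh_mul.
- move=> i ni; rewrite /E /=.
  have sh : i.+1%:R * h = i%:R * h + h by rewrite -natr1 mulrDl mul1r.
  have s0 : 0 <= i%:R * h by rewrite mulr_ge0.
  have sht : i%:R * h + h <= t.
    by rewrite -sh -(mesh_mul t n) -/h ler_wpM2r// ler_nat.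
  set s := i%:R * h in sh s0 sht *; rewrite sh.
  set Y := euler _ _ _ _ _ _.
  (* Propagated error, then the remainder of the expansion of [a], then the consistency error. *)
  have -> : a h *m Y + B *m (p (s + h) - p s) - x (s + h) =
    (Y - x s) + (a h - 1%:M) *m (Y - x s) + (a h - 1%:M - h *: M) *m x s -
      (x (s + h) - B *m p (s + h) - (x s - B *m p s) - h *: (M *m x s)).
    rewrite !mulmxBl !mul1mx !mulmxBr -scalemxAl.
    by apply/matrixP => l j; rewrite ![in LHS]mxE ![in RHS]mxE; ring.
  apply: le_trans (ler_normB _ _) _; rewrite mulrDl mul1r.
  have Hy := yd s h s0 hn0 nd sht.
  apply: le_trans (lerD (ler_normD _ _) Hy) _.
  have -> : h * (2 * e') = h * e' + h * e' by ring.
  rewrite [leRHS]addrA lerD2r; apply: lerD.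
    apply: le_trans (ler_normD _ _) _; rewrite lerD2l.
    apply: le_trans (mulmx_norm _ _) _; rewrite mulrA ler_wpM2r// /c -mulrA ler_wpM2l//.
    exact: a1.
  apply: le_trans (mulmx_norm _ _) _.
  have b1 : `|a h - 1%:M - h *: M| <= `|C| * h ^+ 2.
    by apply: le_trans (a2 h hn0 nh2) _; rewrite ler_wpM2r ?exprn_ge0// ler_norm.
  have b2 : `|x s| <= Cx by apply: xB; rewrite s0 (le_trans _ sht)// lerDl.
  apply: le_trans (ler_wpM2l _ (ler_pM _ _ b1 b2)) _ => //.
  have -> : r%:R * (`|C| * h ^+ 2 * Cx) = h * (h * (r%:R * `|C| * Cx)) by ring.
  rewrite ler_wpM2l//; apply: (@le_trans _ _ (h * C2)).
    by rewrite ler_wpM2l// /C2 lerDl.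
  by rewrite -ler_pdivlMr.
- have -> : e = 2 * e' * G by rewrite /e'; field; rewrite gt_eqF.
  have -> : t * (2 * e') * expR (c * t) = 2 * e' * (t * expR (c * t)) by ring.
  have tG : t * expR (c * t) <= G by apply: ler_wpM2r; rewrite ?expR_ge0 ?lerDl.
  have e2 : 0 <= 2 * e' by apply: mulr_ge0 => //; exact: ltW.
  exact: (ler_wpM2l e2 tG).
Qed.

Lemma cvg_h0 (K : realType) r (U : Type) (F : set_system U) {FF : Filter F}
    (Q : 'M[K]_r) (y : U -> 'cV[K]_r) (a : 'cV[K]_r) :
  y @ F --> a -> h0 Q (y i) @[i --> F] --> h0 Q a.
Proof.
move=> ya; apply: (cvg_comp _ expR); last exact: continuous_expR.
by apply: cvgN; apply: cvgM; [exact: cvg_qform|exact: cvg_cst].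
Qed.

Lemma cvg_cos_dot (K : realType) r (U : Type) (F : set_system U) {FF : Filter F}
    (u : 'cV[K]_r) (al : K) (y : U -> 'cV[K]_r) (a : 'cV[K]_r) :
  y @ F --> a -> cos (dot u (y i) + al) @[i --> F] --> cos (dot u a + al).
Proof.
move=> ya; apply: (cvg_comp _ cos); last exact: continuous_cos.
apply: cvgD; last exact: cvg_cst.
by apply: cvg_dot => //; exact: cvg_cst.
Qed.

Lemma qformB_norm (K : realType) r (M : 'M[K]_r) (x y : 'cV[K]_r) (c e : K) :
  `|y| <= c -> `|x - y| <= e -> e <= 1 ->
  `|qform M x - qform M y| <= r%:R ^+ 2 * `|M| * (1 + 2 * c) * e.
Proof.
move=> yc xye e1; have e0 : 0 <= e := le_trans (normr_ge0 _) xye.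
have c0 : 0 <= c := le_trans (normr_ge0 _) yc.
have -> : qform M x - qform M y =
    qform M (x - y) + dot y (M *m (x - y)) + dot (x - y) (M *m y).
  by rewrite !qformE !mulmxBr !dotBl !dotBr; ring.
have B1 (v w : 'cV[K]_r) p q : `|v| <= p -> `|w| <= q ->
    `|dot v (M *m w)| <= r%:R ^+ 2 * `|M| * (p * q).
  move=> vp wq; apply: le_trans (dot_norm _ _) _.
  have h := mulmx_norm M w.
  apply: le_trans (ler_wpM2l _ (ler_wpM2l _ h)) _ => //.
  have -> : r%:R * (`|v| * (r%:R * (`|M| * `|w|))) = r%:R ^+ 2 * `|M| * (`|v| * `|w|) by ring.
  by rewrite ler_wpM2l ?mulr_ge0 ?exprn_ge0// ler_pM.
apply: le_trans (ler_normD _ _) _; apply: le_trans (lerD (ler_normD _ _) (lexx _)) _.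
rewrite qformE; have := B1 _ _ _ _ xye xye; have := B1 _ _ _ _ yc xye.
have := B1 _ _ _ _ xye yc => h1 h2 h3.
apply: le_trans (lerD (lerD h3 h2) h1) _; rewrite -!mulrDr -mulrA.
rewrite ler_wpM2l ?mulr_ge0 ?exprn_ge0//.
have : e * e <= e by rewrite ler_piMr.
by lra.
Qed.

(** D(h) = h S + O(h^2): the first part is a Riemann sum of the potential along the chain, the
    second contributes n + 1 terms of order h^2. *)
Lemma cvg_dissipation (K : realType) r (S : 'M[K]_r) (D : K -> 'M[K]_r)
    (x : K -> 'cV[K]_r) (Y : nat -> nat -> 'cV[K]_r) (t : K) : 0 <= t ->
  expands D 0 S -> {within `[0, +oo[, continuous x} ->
  (forall e, 0 < e -> \forall n \near \oo, forall k, (k <= n.+1)%N ->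
    `|Y n k - x (k%:R * mesh t n)| <= e) ->
  (\sum_(k < n.+1) qform (D (mesh t n)) (Y n k)) / 2 @[n --> \oo] -->
    \int[lebesgue_measure]_(s in `[0, t]) potential S (x s).
Proof.
move=> t0 [C [h1 h10 eD]] cx Yx.
have [c c0 xB] := continuous_bounded_itv t cx.
have xk n k : (k <= n.+1)%N -> `|x (k%:R * mesh t n)| <= c.
  by move=> kn; apply: xB; exact: mesh_le.
have cp : {within `[0, +oo[, continuous (fun s => potential S (x s))}.
  by move=> s; apply: cvgM; [exact: continuous_qform_fun|exact: cvg_cst].
pose u n k := potential S (Y n k).
have uB e : 0 < e -> \forall n \near \oo, forall k, (k <= n)%N ->
    `|u n k - potential S (x (k%:R * mesh t n))| <= e.
  move=> e0; pose b := r%:R ^+ 2 * `|S| * (1 + 2 * c) + 1.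
  have b0 : 0 < b by rewrite ltr_wpDl// mulr_ge0 ?mulr_ge0 ?exprn_ge0// addr_ge0// mulr_ge0.
  have m0 : 0 < Num.min 1 (e / b) by rewrite lt_min ltr01 divr_gt0.
  have := Yx _ m0; apply: filterS => n H k kn.
  have := qformB_norm S (xk n k (leqW kn)) (H k (leqW kn)).
  rewrite ge_min lexx /= => /(_ isT) h.
  rewrite /u /potential -mulrBl normrM [`|2^-1|]ger0_norm ?invr_ge0//.
  apply: (@le_trans _ _ `|qform S (Y n k) - qform S (x (k%:R * mesh t n))|).
    by rewrite ler_piMr// invf_le1// ler1n.
  apply: le_trans h _; apply: (@le_trans _ _ (b * Num.min 1 (e / b))).
    by rewrite ler_wpM2r ?(ltW m0)// lerDl.
  apply: (@le_trans _ _ (b * (e / b))); last by rewrite mulrC divfK// gt_eqF.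
  by rewrite ler_wpM2l ?(ltW b0)// ge_min lexx orbT.
have R1 := Rintegral_riemann cp t0 uB.
rewrite -[X in _ --> X]addr0.
have -> : (fun n => (\sum_(k < n.+1) qform (D (mesh t n)) (Y n k)) / 2) =
    (fun n => mesh t n * (\sum_(k < n.+1) u n k) +
      (\sum_(k < n.+1) qform (D (mesh t n) - mesh t n *: S) (Y n k)) / 2).
  apply/funext => n; rewrite mulr_sumr !mulr_suml -big_split /=; apply: eq_bigr => k _.
  by rewrite /u /potential qformBl qformZl; ring.
apply: cvgD => //.
apply/cvgr0Pnorm_le => e e0.
pose b := r%:R ^+ 2 * `|C| * (c + 1) ^+ 2 * t + 1.
have b0 : 0 < b by rewrite ltr_wpDl// !mulr_ge0 ?exprn_ge0// addr_ge0.
have m0 : 0 < Num.min h1 (e / b) by rewrite lt_min h10 divr_gt0.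
have := Yx _ ltr01; have := cvg_mesh_lt t0 m0.
apply: filterS2 => n; rewrite le_min => /andP[nh1 nhe] H.
have hn0 := mesh_ge0 n t0.
rewrite normrM [`|2^-1|]ger0_norm ?invr_ge0//.
set s := \sum_(k < _) _.
apply: (@le_trans _ _ `|s|); first by rewrite ler_piMr// invf_le1// ler1n.
apply: le_trans (ler_norm_sum _ _ _) _.
have q k : (k <= n.+1)%N -> `|qform (D (mesh t n) - mesh t n *: S) (Y n k)| <=
    r%:R ^+ 2 * (`|C| * mesh t n ^+ 2) * (c + 1) ^+ 2.
  move=> kn; apply: le_trans (qform_norm _ _) _; apply: ler_pM.
  - by rewrite mulr_ge0// exprn_ge0.
  - by rewrite exprn_ge0.
  - rewrite ler_wpM2l ?exprn_ge0//; have := eD _ hn0 nh1; rewrite subr0 => h.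
    by apply: le_trans h _; rewrite ler_wpM2r ?exprn_ge0// ler_norm.
  - rewrite lerXn2r ?nnegrE ?addr_ge0//.
    rewrite -[Y n k](subrK (x (k%:R * mesh t n))) addrC.
    by apply: le_trans (ler_normD _ _) _; apply: lerD; [exact: xk|exact: H].
apply: (@le_trans _ _ (\sum_(k < n.+1) r%:R ^+ 2 * (`|C| * mesh t n ^+ 2) * (c + 1) ^+ 2)).
  by apply: ler_sum => k _; apply: q; exact: ltnW.
rewrite sumr_const card_ord -[_ *+ n.+1]mulr_natl.
have -> : n.+1%:R * (r%:R ^+ 2 * (`|C| * mesh t n ^+ 2) * (c + 1) ^+ 2) =
    r%:R ^+ 2 * `|C| * (c + 1) ^+ 2 * (n.+1%:R * mesh t n) * mesh t n by ring.
rewrite mesh_mul; apply: (@le_trans _ _ (b * mesh t n)).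
  by rewrite ler_wpM2r// lerDl.
by rewrite mulrC -ler_pdivlMr.
Qed.

(** The noise is additive, so X - B W satisfies an ordinary integral equation along almost every
    path; W_0 = 0 identifies its initial value with X_0. *)
Lemma linear_sde_consistent (K : realType) d (T : measurableType d) (Pr : probability T K)
    r r1 (M : 'M[K]_r) (B : 'M[K]_(r, r1)) (W : K -> {mfun T >-> borelV K r1})
    (X : K -> {mfun T >-> borelV K r}) (t : K) :
  brownian_motion Pr W -> linear_sde Pr M B W X ->
  {ae Pr, forall w, consistent t (fun s => (X s w : 'cV[K]_r) - B *m (W s w : 'cV[K]_r1))
    (fun s => M *m (X s w : 'cV[K]_r))}.
Proof.
move=> [W0 _ _ _] [cX XE]; move: W0 XE; apply: filterS2 => w W0 XE.
apply: consistent_integral.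
  apply: (@continuous_mulmx_fun _ _ _ _ (fun=> M) (fun s => X s w : 'cV[K]_r)).
    by move=> s; exact: cvg_cst.
  exact: cX.
by move=> s s0; rewrite W0 mulmx0 subr0 XE// addrK.
Qed.

Section h_transform.
Context (K : realType) (d : measure_display) (T : measurableType d) (Pr : probability T K)
  (r r1 : nat) (A S Q : 'M[K]_r) (B : 'M[K]_(r, r1))
  (W : K -> {mfun T >-> borelV K r1}) (X Xh : K -> {mfun T >-> borelV K r}).
Let R := B *m B^T.
Hypotheses (hS : psdmx S) (hQ : posdefmx Q) (hric : riccati_eq A R S Q).
Hypothesis hW : brownian_motion Pr W.
Hypotheses (hX : linear_sde Pr A B W X) (hXh : linear_sde Pr (A - R *m Q) B W Xh).
Hypothesis hX0W : indep_systems Pr (sigma_rv (X 0)) (sigma_process `[0, +oo[ W).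
Hypothesis hXh0W : indep_systems Pr (sigma_rv (Xh 0)) (sigma_process `[0, +oo[ W).

Let psdR : psdmx R. Proof. exact: psdmx_mulmx_tr. Qed.
Let psdQ : psdmx Q. Proof. exact: posdefmx_psd. Qed.

Let Y (M : K -> 'M[K]_r) (X0 : T -> borelV K r) (t : K) (n k : nat) (w : T) : 'cV[K]_r :=
  euler (M (mesh t n)) B (fun s => W s w) (mesh t n) (X0 w) k.

Let measurable_Y M (X0 : {mfun T >-> borelV K r}) t n k : 0 <= t ->
  measurable_fun setT (Y M X0 t n k : T -> borelV K r).
Proof.
move=> t0.
by apply: (@euler_measurable K r r1 d T W X0 (M (mesh t n)) B (mesh t n)
  (k%:R * mesh t n)) => //; exact: mesh_ge0.
Qed.

Let cvg_Y M F (Z : K -> {mfun T >-> borelV K r}) t : 0 <= t ->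
  linear_sde Pr F B W Z -> expands M 1%:M F ->
  {ae Pr, forall w e, 0 < e -> \forall n \near \oo, forall k, (k <= n.+1)%N ->
    `|Y M (Z 0) t n k w - (Z (k%:R * mesh t n) w : 'cV[K]_r)| <= e}.
Proof.
move=> t0 sdeZ eM; have := linear_sde_consistent t hW sdeZ.
apply: filterS => w cons e e0.
by apply: (@cvg_euler K r r1 M F B (fun s => W s w) (fun s => Z s w) t) => //; exact: sdeZ.1.
Qed.

Let cvg_last (Z : K -> 'cV[K]_r) (y : nat -> nat -> 'cV[K]_r) t :
  (forall e, 0 < e -> \forall n \near \oo, forall k, (k <= n.+1)%N ->
    `|y n k - Z (k%:R * mesh t n)| <= e) -> y n n.+1 @[n --> \oo] --> Z t.
Proof.
move=> H; apply/cvgrPdist_le => e e0; have := H e e0; apply: filterS => n /(_ _ (leqnn _)).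
by rewrite mesh_mul distrC.
Qed.

Lemma cvg_Rintegral_cos_euler M F (Z : K -> {mfun T >-> borelV K r}) t u al : 0 <= t ->
  linear_sde Pr F B W Z -> expands M 1%:M F ->
  \int[Pr]_w cos (dot u (euler (M (mesh t n)) B (fun s => W s w) (mesh t n) (Z 0 w) n.+1) + al)
    @[n --> \oo] --> \int[Pr]_w cos (dot u (Z t w) + al).
Proof.
move=> t0 sdeZ eM.
apply: (@cvg_Rintegral_bounded _ _ _ Pr (fun n w => cos (dot u (Y M (Z 0) t n n.+1 w) + al)) _ 1).
- by move=> n; apply: measurable_cos_dot; exact: measurable_Y.
- by apply: measurable_cos_dot.
- by near=> n => w; exact: cos_norm_le1.
- have := cvg_Y t0 sdeZ eM; apply: filterS => w H.
  apply: cvg_cos_dot.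
  exact: (@cvg_last (fun s => Z s w) (fun n k => Y M (Z 0) t n k w)).
Unshelve. all: by end_near.
Qed.

(** Positivity of the dissipation at small mesh keeps the weights below 1, which provides the
    domination. *)
Lemma cvg_Rintegral_h0_euler kappa t u al : 0 <= t ->
  (\forall n \near \oo, psdmx (dissipation A R Q kappa (mesh t n))) ->
  let y n k w :=
    euler (drift_step A kappa (mesh t n)) B (fun s => W s w) (mesh t n) (X 0 w) k in
  \int[Pr]_w (h0 Q (y n n.+1 w) * cos (dot u (y n n.+1 w) + al) *
     expR (- ((\sum_(i < n.+1) qform (dissipation A R Q kappa (mesh t n)) (y n i w)) / 2)))
    @[n --> \oo] -->
  \int[Pr]_w (h0 Q (X t w) * cos (dot u (X t w) + al) *
     expR (- killing_rate S (fun s => X s) t w)).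
Proof.
move=> t0 psdD y.
have eM := expands_drift_step A kappa.
have mq (M : 'M[K]_r) n k : measurable_fun setT (fun w => qform M (y n k w)).
  by apply: measurable_qform; exact: measurable_Y.
apply: (@cvg_Rintegral_bounded _ _ _ Pr (fun n w => h0 Q (y n n.+1 w) *
   cos (dot u (y n n.+1 w) + al) * expR (- ((\sum_(i < n.+1)
     qform (dissipation A R Q kappa (mesh t n)) (y n i w)) / 2))) _ 1).
- move=> n; apply: measurable_funM.
    apply: measurable_funM; first by apply: measurable_h0; exact: measurable_Y.
    by apply: measurable_cos_dot; exact: measurable_Y.
  apply: (@measurableT_comp _ _ _ _ _ _ expR) => //; apply: measurableT_comp => //.
  by apply: measurable_funM => //; apply: measurable_sum.
- apply: measurable_funM.
    by apply: measurable_funM; [exact: measurable_h0|exact: measurable_cos_dot].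
  apply: (@measurableT_comp _ _ _ _ _ _ expR) => //; apply: measurableT_comp => //.
  exact: (measurable_killing_rateT S hX.1 t0).
- apply: filterS psdD => n [_ D0] w; rewrite normrM -[leRHS]mulr1; apply: ler_pM => //.
    by rewrite normrM -[leRHS]mulr1; apply: ler_pM => //; [exact: (h0_norm_le1 _ psdQ)|exact: cos_norm_le1].
  rewrite ger0_norm ?expR_ge0// -[leRHS]expR0 ler_expR oppr_le0 divr_ge0//.
  by apply: sumr_ge0.
- have := cvg_Y t0 hX eM; apply: filterS => w H.
  have yX := @cvg_last (fun s => X s w) (fun n k => y n k w) t H.
  apply: cvgM; first by apply: cvgM; [exact: cvg_h0|exact: cvg_cos_dot].
  apply: (cvg_comp _ expR); last exact: continuous_expR.
  apply: cvgN.
  apply: (@cvg_dissipation K r S _ (fun s => X s w) (fun n k => y n k w) t t0 _ _ H).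
    exact: (expands_dissipation kappa psdR psdQ hric).
  exact: hX.1.
Qed.

(* Both Euler transforms run through the same vectors [v], so their ratio is a
   constant times [expR (eps n)] with [eps n] of the order of the mesh. *)
Lemma h0_transform_identity t u al : 0 <= t ->
  (exists2 Z0 : K, 0 < Z0 & forall v b,
    \int[Pr]_w (h0 Q (X 0 w) * cos (dot v (X 0 w) + b)) =
    Z0 * \int[Pr]_w cos (dot v (Xh 0 w) + b)) ->
  \int[Pr]_w (h0 Q (X t w) * cos (dot u (X t w) + al) *
     expR (- killing_rate S (fun s => X s) t w)) =
  \int[Pr]_w (h0 Q (X t w) * expR (- killing_rate S (fun s => X s) t w)) *
  \int[Pr]_w cos (dot u (Xh t w) + al).
Proof.
move=> t0 [Z0 Z00 init].
have [kappa [h1 h10 dpsd]] := dissipation_psd psdR hS hQ hric.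
have psdD : \forall n \near \oo, psdmx (dissipation A R Q kappa (mesh t n)).
  have := cvg_mesh_lt t0 h10; apply: filterS => n nh; apply: dpsd => //.
  exact: mesh_ge0.
pose a h := drift_step A kappa h.
pose L h := tiltmx (h *: R) Q.
have ea : expands (fun h => L h *m a h) 1%:M (A - R *m Q) by exact: (expands_tilted_drift A kappa psdR psdQ).
have lim v b := @cvg_Rintegral_h0_euler kappa t v b t0 psdD.
have limh := @cvg_Rintegral_cos_euler (fun h => L h *m a h) _ Xh t u al t0 hXh ea.
pose I v b n := \int[Pr]_w (h0 Q (Y a (X 0) t n n.+1 w) * cos (dot v (Y a (X 0) t n n.+1 w) + b) *
     expR (- ((\sum_(i < n.+1) qform (dissipation A R Q kappa (mesh t n)) (Y a (X 0) t n i w)) / 2))).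
pose J n := \int[Pr]_w cos (dot u (Y (fun h => L h *m a h) (Xh 0) t n n.+1 w) + al).
pose v n i := iter i (mulmx (L (mesh t n) *m a (mesh t n))^T) u.
(* The chain for [Xh] has noise covariance h R, the tilted chain has L h R; [eps] collects this
   discrepancy. *)
pose eps n := (\sum_(i < n.+1) qform (mesh t n *: R - L (mesh t n) *m (mesh t n *: R)) (v n i)) / 2.
have key : \forall n \near \oo, I u al n = I 0 0 n * expR (eps n) * J n.
  have := psdD; apply: filterS => n pD.
  have hn0 := mesh_ge0 n t0.
  have [k k0 Hk] := Rintegral_h0_euler hn0 hW hX0W psdQ pD.
  have JE : J n = expR (- ((\sum_(i < n.+1) qform (mesh t n *: R) (v n i)) / 2)) *
      \int[Pr]_w cos (dot (v n n.+1) (Xh 0 w) + al).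
    exact: (Rintegral_cos_euler _ _ hn0 hW hXh0W).
  have iter0 i : iter i (mulmx (L (mesh t n) *m a (mesh t n))^T) (0 : 'cV[K]_r) = 0.
    by elim: i => // i IH; rewrite iterS IH mulmx0.
  have q0 (M : 'M[K]_r) : qform M 0 = 0 by rewrite qformE dot0l.
  (* Frequency 0 isolates the product of all normalising constants, so the unknown [k] cancels from
     the ratio. *)
  have I0 : I 0 0 n = k ^+ n.+1 * Z0.
    have := Hk n.+1 0 0; rewrite iter0 init.
    under eq_bigr do rewrite iter0 q0.
    rewrite big1// mul0r oppr0 expR0 mulr1.
    under [X in Z0 * X]eq_Rintegral do rewrite dot0l addr0 cos0.
    by rewrite Rintegral_probability_cst mulr1.
  have IE : I u al n = k ^+ n.+1 *
      expR (- ((\sum_(i < n.+1) qform (L (mesh t n) *m (mesh t n *: R)) (v n i)) / 2)) *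
      (Z0 * \int[Pr]_w cos (dot (v n n.+1) (Xh 0 w) + al)).
    by rewrite -init; exact: Hk.
  rewrite IE I0 JE /eps.
  under [X in expR (X / 2)]eq_bigr do rewrite qformBl.
  rewrite sumrB mulrBl expRD.
  have e0 : expR ((\sum_(i < n.+1) qform (mesh t n *: R) (v n i)) / 2) *
      expR (- ((\sum_(i < n.+1) qform (mesh t n *: R) (v n i)) / 2)) = 1.
    by rewrite -expRD subrr expR0.
  by rewrite -[LHS]mulr1 -[X in _ * X = _]e0; ring.
(* Each of the n + 1 terms is O(h^2), because 1 - L = O(h) and the vectors [v n i] stay bounded. *)
have eps0 : eps n @[n --> \oo] --> (0 : K).
  have ev : expands (fun h => (L h *m a h)^T) 1%:M (A - R *m Q)^T.
    by have := expands_tr ea; rewrite trmx1.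
  have [Cv Cv0 Hv] := expands_iter_bounded ev t0.
  have [C C0 [h2 h20 HL]] := expands_norm (expands_tiltmx psdR psdQ).
  pose b := r%:R ^+ 2 * (r%:R * C * `|R|) * (Cv * `|u|) ^+ 2 * t + 1.
  have b0 : 0 < b by rewrite ltr_wpDl// !mulr_ge0 ?exprn_ge0// !mulr_ge0.
  apply/cvgr0Pnorm_le => e e0.
  have m0 : 0 < Num.min h2 (e / b) by rewrite lt_min h20 divr_gt0.
  have := Hv; have := cvg_mesh_lt t0 m0.
  apply: filterS2 => n; rewrite le_min => /andP[nh2 nhe] vB.
  have hn0 := mesh_ge0 n t0.
  rewrite /eps normrM [`|2^-1|]ger0_norm ?invr_ge0//.
  set s := \sum_(k < _) _.
  apply: (@le_trans _ _ `|s|); first by rewrite ler_piMr// invf_le1// ler1n.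
  apply: le_trans (ler_norm_sum _ _ _) _.
  have LB : `|mesh t n *: R - L (mesh t n) *m (mesh t n *: R)| <=
      mesh t n * (r%:R * C * `|R|) * mesh t n.
    rewrite -scalemxAr -scalerBr -{1}[R]mul1mx -mulmxBl normrZ ger0_norm// -mulrA ler_wpM2l//.
    apply: le_trans (mulmx_norm _ _) _; rewrite -mulrA -mulrA ler_wpM2l// [`|R| * mesh t n]mulrC.
    by rewrite mulrA ler_wpM2r// distrC; exact: HL.
  have q k : (k <= n.+1)%N ->
      `|qform (mesh t n *: R - L (mesh t n) *m (mesh t n *: R)) (v n k)| <=
      r%:R ^+ 2 * (mesh t n * (r%:R * C * `|R|) * mesh t n) * (Cv * `|u|) ^+ 2.
    move=> kn; apply: le_trans (qform_norm _ _) _; apply: ler_pM.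
    - by rewrite mulr_ge0// exprn_ge0.
    - by rewrite exprn_ge0.
    - by rewrite ler_wpM2l ?exprn_ge0.
    - by rewrite lerXn2r ?nnegrE ?mulr_ge0//; exact: vB.
  apply: (@le_trans _ _ (\sum_(k < n.+1)
      r%:R ^+ 2 * (mesh t n * (r%:R * C * `|R|) * mesh t n) * (Cv * `|u|) ^+ 2)).
    by apply: ler_sum => k _; apply: q; exact: ltnW.
  rewrite sumr_const card_ord -[_ *+ n.+1]mulr_natl.
  rewrite (_ : _ * _ = r%:R ^+ 2 * (r%:R * C * `|R|) * (Cv * `|u|) ^+ 2 *
    (n.+1%:R * mesh t n) * mesh t n); last by ring.
  rewrite mesh_mul; apply: (@le_trans _ _ (b * mesh t n)).
    by rewrite ler_wpM2r// lerDl.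
  by rewrite mulrC -ler_pdivlMr.
have lim0 : I 0 0 n @[n --> \oo] --> \int[Pr]_w (h0 Q (X t w) * expR (- killing_rate S (fun s => X s) t w)).
  have := lim 0 0; congr (_ --> _); apply: eq_Rintegral => w _.
  by rewrite dot0l addr0 cos0 mulr1.
have limI : I u al n @[n --> \oo] --> _ := lim u al.
have limJ : I 0 0 n * expR (eps n) * J n @[n --> \oo] -->
    \int[Pr]_w (h0 Q (X t w) * expR (- killing_rate S (fun s => X s) t w)) * expR 0 *
    \int[Pr]_w cos (dot u (Xh t w) + al).
  apply: cvgM; last exact: limh.
  apply: cvgM; first exact: lim0.
  by apply: (cvg_comp _ expR eps0); exact: continuous_expR.
rewrite expR0 mulr1 in limJ.
rewrite -(cvg_lim (@norm_hausdorff _ _) limI); apply: cvg_lim; first exact: norm_hausdorff.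
apply: (cvg_trans _ limJ); apply: near_eq_cvg.
by move: key; apply: filterS => n ->.
Qed.
End h_transform.

(** * Matrix differential equations *)

(** From a^-1 - y^-1 = y^-1 (y - a) a^-1. Once y is close to a, this identity first bounds |y^-1| by
    2 |a^-1|, and then gives convergence. *)
Lemma cvg_invmx (K : realType) r (U : Type) (F : set_system U) {FF : Filter F}
    (y : U -> 'M[K]_r) (a : 'M[K]_r) :
  a \in unitmx -> (\forall k \near F, y k \in unitmx) -> y @ F --> a ->
  invmx (y k) @[k --> F] --> invmx a.
Proof.
move=> ua uy /cvgrPdist_le ya; apply/cvgrPdist_le => e e0.
pose c := r%:R * (r%:R * `|invmx a|) + 1.
have c0 : 0 < c by rewrite ltr_wpDl// !mulr_ge0.
pose b := c * (2 * `|invmx a| + 1).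
have b0 : 0 < b by rewrite mulr_gt0// ltr_wpDl// mulr_ge0.
have m0 : 0 < Num.min (2 * c)^-1 (e / b).
  by rewrite lt_min invr_gt0 mulr_gt0//= divr_gt0.
move: uy (ya _ m0); apply: filterS2 => k uy; rewrite le_min => /andP[h1 h2].
have E : invmx a - invmx (y k) = invmx (y k) *m (y k - a) *m invmx a.
  by rewrite mulmxBr mulVmx// mulmxBl mul1mx -mulmxA mulmxV// mulmx1.
have D : `|invmx a - invmx (y k)| <= c * `|invmx (y k)| * `|a - y k|.
  rewrite E; apply: le_trans (mulmx_norm _ _) _.
  apply: (@le_trans _ _ (r%:R * (r%:R * (`|invmx (y k)| * `|y k - a|) * `|invmx a|))).
    by rewrite ler_wpM2l// ler_wpM2r// mulmx_norm.
  rewrite distrC.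
  rewrite (_ : r%:R * _ = (r%:R * (r%:R * `|invmx a|)) * (`|invmx (y k)| * `|a - y k|)); last by ring.
  by rewrite -[leRHS]mulrA ler_wpM2r ?mulr_ge0// lerDl.
have B : `|invmx (y k)| <= 2 * `|invmx a|.
  have : `|invmx (y k)| <= `|invmx a| + `|invmx a - invmx (y k)|.
    by rewrite -{1}[invmx (y k)](subrK (invmx a)) addrC distrC ler_normD.
  have : c * `|invmx (y k)| * `|a - y k| <= `|invmx (y k)| / 2.
    apply: le_trans (ler_wpM2l _ h1) _; first by rewrite mulr_ge0// ltW.
    by rewrite le_eqVlt; apply/orP; left; apply/eqP; field; rewrite gt_eqF.
  by lra.
apply: le_trans D _; apply: (@le_trans _ _ (b * `|a - y k|)).
  rewrite ler_wpM2r// /b ler_wpM2l ?(ltW c0)//.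
  by apply: le_trans B _; rewrite lerDl.
by rewrite mulrC -ler_pdivlMr.
Qed.

Lemma is_derive_mx (K : realType) m n (y : K -> 'M[K]_(m, n)) (t : K) (D : 'M[K]_(m, n)) :
  (forall i j, is_derive t 1 (fun s => y s i j) (D i j)) -> is_derive t 1 y D.
Proof.
move=> H; have dy : derivable y t 1 by apply/derivable_mxP => i j; have [] := H i j.
apply: DeriveDef => //; rewrite derive_mx//; apply/matrixP => i j; rewrite mxE.
by have [] := H i j.
Qed.

Lemma is_derive_near0 (K : realType) (V : normedModType K) (f : K -> V) (s : K) (D : V) :
  (\forall v \near s, f v = 0) -> is_derive s 1 f D -> D = 0.
Proof.
move=> f0 [_ <-]; by rewrite (near_eq_derive (1 : K) (g := cst 0)) ?derive_cst.
Qed.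

Lemma is_derive_mulmx (K : realType) r m n (y : K -> 'M[K]_(m, r)) (z : K -> 'M[K]_(r, n))
    (t : K) (Dy : 'M[K]_(m, r)) (Dz : 'M[K]_(r, n)) : is_derive t 1 y Dy -> is_derive t 1 z Dz ->
  is_derive t 1 (fun s => y s *m z s) (Dy *m z t + y t *m Dz).
Proof.
move=> dy dz; apply: is_derive_mx => i j.
rewrite (_ : (fun s => _) = \sum_k (fun s => y s i k * z s k j)); last first.
  by apply/funext => s; rewrite mxE fct_sumE.
rewrite !mxE -big_split /=; apply: is_derive_sum => k.
apply: is_derive_eq.
  by apply: is_deriveM; exact: is_derive_entry.
by rewrite addrC; congr (_ + _); exact: mulrC.
Qed.

Lemma is_derive_trmx (K : realType) m n (y : K -> 'M[K]_(m, n)) (t : K) (D : 'M[K]_(m, n)) :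
  is_derive t 1 y D -> is_derive t 1 (fun s => (y s)^T) D^T.
Proof.
move=> dy; apply: is_derive_mx => i j; rewrite mxE.
by under eq_fun do rewrite mxE; exact: is_derive_entry.
Qed.

Lemma is_derive_invmx (K : realType) r (y : K -> 'M[K]_r) (t : K) (D : 'M[K]_r) :
  (\forall s \near t, y s \in unitmx) -> is_derive t 1 y D ->
  is_derive t 1 (fun s => invmx (y s)) (- (invmx (y t) *m D *m invmx (y t))).
Proof.
move=> uy dy; have [dy1 dyE] := dy.
have ht : h *: (1 : K) + t @[h --> 0^'] --> t.
  rewrite -[X in _ --> X]add0r -[X in X + t](scale0r (1 : K)); apply: cvgD; last exact: cvg_cst.
  by apply: cvgZr_tmp; exact: nbhs_dnbhs.
have cy : y (h *: 1 + t) @[h --> 0^'] --> y t.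
  have cy : {for t, continuous y} by apply: differentiable_continuous; exact/derivable1_diffP.
  exact: (cvg_comp _ _ ht cy).
have U : \forall h \near 0^', y (h *: 1 + t) \in unitmx by exact: (ht _ uy).
have Ut : y t \in unitmx by exact: (nbhs_singleton uy).
have C : h^-1 *: (invmx (y (h *: 1 + t)) - invmx (y t)) @[h --> 0^'] -->
    - (invmx (y t) *m D *m invmx (y t)).
  have dq : h^-1 *: (y (h *: 1 + t) - y t) @[h --> 0^'] --> D by rewrite -dyE; exact: dy1.
  have : - (invmx (y (h *: 1 + t)) *m (h^-1 *: (y (h *: 1 + t) - y t)) *m invmx (y t))
      @[h --> 0^'] --> - (invmx (y t) *m D *m invmx (y t)).
    apply: cvgN; apply: cvg_mulmx; last exact: cvg_cst.
    by apply: cvg_mulmx => //; exact: cvg_invmx.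
  apply: cvg_trans; apply: near_eq_cvg; move: U; apply: filterS => h Uh.
  rewrite -scalemxAr -scalemxAl -scalerN; congr (_ *: _).
  by rewrite mulmxBr mulVmx// mulmxBl mul1mx -mulmxA mulmxV// mulmx1 opprB.
apply: DeriveDef; first by apply/cvg_ex; eexists; exact: C.
by apply: cvg_lim => //; exact: C.
Qed.

(** Continuity of the derivative up to time 0 makes the one-step error uniform there; the class is
    stable under products, transposes and inverses. *)
Definition primitive (K : realType) m n (y f : K -> 'M[K]_(m, n)) : Prop :=
  [/\ {within `[0, +oo[, continuous y}, {within `[0, +oo[, continuous f} &
    forall s : K, 0 < s -> is_derive s 1 y (f s)].

Lemma primitive_cst (K : realType) m n (y : 'M[K]_(m, n)) : primitive (fun=> y) (fun=> 0).
Proof. by split => [s|s|s _]; [exact: cvg_cst|exact: cvg_cst|exact: is_derive_cst]. Qed.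

Lemma primitiveD (K : realType) m n (y z f g : K -> 'M[K]_(m, n)) :
  primitive y f -> primitive z g -> primitive (fun s => y s + z s) (fun s => f s + g s).
Proof.
move=> [cy cf dy] [cz cg dz]; split => [s|s|s s0].
- by apply: cvgD; [exact: cy|exact: cz].
- by apply: cvgD; [exact: cf|exact: cg].
- by have := dy s s0; have := dz s s0 => ? ?; exact: is_deriveD.
Qed.

Lemma primitiveB (K : realType) m n (y z f g : K -> 'M[K]_(m, n)) :
  primitive y f -> primitive z g -> primitive (fun s => y s - z s) (fun s => f s - g s).
Proof.
move=> [cy cf dy] [cz cg dz]; split => [s|s|s s0].
- by apply: cvgB; [exact: cy|exact: cz].
- by apply: cvgB; [exact: cf|exact: cg].
- by have := dy s s0; have := dz s s0 => ? ?; exact: is_deriveB.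
Qed.

Lemma primitive_mulmx (K : realType) r m n (y f : K -> 'M[K]_(m, r)) (z g : K -> 'M[K]_(r, n)) :
  primitive y f -> primitive z g ->
  primitive (fun s => y s *m z s) (fun s => f s *m z s + y s *m g s).
Proof.
move=> [cy cf dy] [cz cg dz]; split => [|s|s s0].
- exact: continuous_mulmx_fun.
- by apply: cvgD; apply: continuous_mulmx_fun.
- by apply: is_derive_mulmx; [exact: dy|exact: dz].
Qed.

Lemma primitive_trmx (K : realType) m n (y f : K -> 'M[K]_(m, n)) :
  primitive y f -> primitive (fun s => (y s)^T) (fun s => (f s)^T).
Proof.
move=> [cy cf dy]; split; [exact: continuous_trmx_fun|exact: continuous_trmx_fun|].
by move=> s s0; apply: is_derive_trmx; exact: dy.
Qed.

Lemma primitive_invmx (K : realType) r (y f : K -> 'M[K]_r) :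
  (forall s, 0 <= s -> y s \in unitmx) -> primitive y f ->
  primitive (fun s => invmx (y s)) (fun s => - (invmx (y s) *m f s *m invmx (y s))).
Proof.
move=> uy [cy cf dy].
have ci : {within `[0, +oo[, continuous (fun s => invmx (y s))}.
  apply/subspace_continuousP => s; rewrite /= in_itv /= andbT => s0.
  have us : \forall u \near within `[0, +oo[ (nbhs s), y u \in unitmx.
    by rewrite near_withinE; apply: nearW => u /=; rewrite in_itv /= andbT; exact: uy.
  apply: (cvg_invmx (uy _ s0) us).
  have /subspace_continuousP c := cy; apply: c.
  by rewrite /= in_itv /= andbT.
split => [//|s|s s0].
  by apply: cvgN; apply: continuous_mulmx_fun => //; exact: continuous_mulmx_fun.
apply: is_derive_invmx; last exact: dy.
near=> u; apply: uy; apply: ltW; near: u; exact: lt_nbhsr.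
Unshelve. all: by end_near.
Qed.

Lemma primitive_consistent (K : realType) m n (t : K) (y f : K -> 'M[K]_(m, n)) :
  primitive y f -> consistent t y f.
Proof. by move=> [cy cf dy]; exact: consistent_derive. Qed.

(** Uniqueness for linear equations: Gronwall along a grid of arbitrarily small consistency
    error. *)
Lemma consistent_eq0 (K : realType) m n (t c : K) (y f : K -> 'M[K]_(m, n)) : 0 <= t -> 0 <= c ->
  consistent t y f -> (forall s, 0 <= s <= t -> `|f s| <= c * `|y s|) -> y 0 = 0 -> y t = 0.
Proof.
move=> t0 c0 cons fy y0; apply/eqP; rewrite -normr_le0; apply/ler_addgt0Pr => e e0.
rewrite add0r.
pose G := (t + 1) * expR (c * t).
have G0 : 0 < G by rewrite mulr_gt0 ?expR_gt0// ltr_wpDl.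
have e'0 : 0 < e / G by rewrite divr_gt0.
have [d d0 yd] := cons _ e'0.
have [N nd] := @filter_ex _ _ _ _ (cvg_mesh_lt t0 d0).
set h := mesh t N in nd; have hn0 : 0 <= h by exact: mesh_ge0.
have := @discrete_gronwall K (fun k => `|y (k%:R * h)|) c h (e / G) t N.+1 c0 hn0 (ltW e'0).
rewrite mul0r y0 normr0 mesh_mul => /(_ erefl (lexx _)) H.
have := H _ N.+1 (leqnn _); rewrite mesh_mul => {}H.
apply: le_trans (H _) _.
  move=> k kn.
  have sh : k.+1%:R * h = k%:R * h + h by rewrite -natr1 mulrDl mul1r.
  have s0 : 0 <= k%:R * h by rewrite mulr_ge0.
  have sht : k%:R * h + h <= t.
    by rewrite -sh -(mesh_mul t N) -/h ler_wpM2r// ler_nat.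
  have st : k%:R * h <= t by rewrite (le_trans _ sht)// lerDl.
  rewrite sh -[y (k%:R * h + h)](subrK (y (k%:R * h))).
  rewrite -[y (k%:R * h + h) - _](subrK (h *: f (k%:R * h))).
  apply: le_trans (ler_normD _ _) _; apply: le_trans (lerD (ler_normD _ _) (lexx _)) _.
  have h1 := yd _ _ s0 hn0 nd sht.
  have h2 : `|h *: f (k%:R * h)| <= c * h * `|y (k%:R * h)|.
    have st' : 0 <= k%:R * h <= t by rewrite s0.
    rewrite normrZ (ger0_norm hn0).
    by have := ler_wpM2l hn0 (fy _ st'); lra.
  by move: h1 h2; lra.
have -> : t * (e / G) * expR (c * t) = e * (t * expR (c * t) / G) by ring.
by rewrite ler_piMr ?(ltW e0)// ler_pdivrMr// mul1r ler_wpM2r ?expR_ge0// lerDl.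
Qed.

(** * The exponential exp(s A) z and the rank condition *)

Definition expmx_coef (K : realType) r (A : 'M[K]_r) (z : 'cV[K]_r) (i : 'I_r) : K^nat :=
  fun k => iter k (mulmx A) z i 0 / k`!%:R.

(** exp(s A) z, taken coordinate by coordinate as a scalar power series in [s], so that it can be
    differentiated termwise. *)
Definition expmx (K : realType) r (A : 'M[K]_r) (z : 'cV[K]_r) (s : K) : 'cV[K]_r :=
  \col_i limn (pseries (expmx_coef A z i) s).

Lemma expmx_coef_diffs (K : realType) r (A : 'M[K]_r) (z : 'cV[K]_r) i :
  pseries_diffs (expmx_coef A z i) = expmx_coef A (A *m z) i.
Proof.
apply/funext => k; rewrite /pseries_diffs /expmx_coef -iterSr factS natrM.
have : (k`!%:R : K) != 0 by rewrite pnatr_eq0 -lt0n fact_gt0.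
have : (k.+1%:R : K) != 0 by rewrite pnatr_eq0.
by move: (k.+1%:R : K) (k`!%:R : K) => a b a0 b0; field; rewrite a0 b0.
Qed.

Lemma is_cvg_expmx (K : realType) r (A : 'M[K]_r) (z : 'cV[K]_r) i (s : K) :
  cvgn (pseries (expmx_coef A z i) s).
Proof.
pose c := r%:R * `|A|; have c0 : 0 <= c by rewrite mulr_ge0.
apply: normed_cvg; apply: (@series_le_cvg _ _ (`|z| *: exp_coeff (c * `|s|))) => [k|k|k|].
- exact: normr_ge0.
- by rewrite mulr_ge0// exp_coeff_ge0// mulr_ge0.
- rewrite /expmx_coef /exp_coeff /= normrM normrM [`|_^-1|]ger0_norm ?invr_ge0// normrX.
  have : `|iter k (mulmx A) z i 0| <= c ^+ k * `|z|.
    apply: le_trans (le_mx_norm _ _ _) _.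
    elim: k => [|k IH]; first by rewrite expr0 mul1r.
    rewrite /= exprS -[leRHS]mulrA; apply: le_trans (mulmx_norm _ _) _.
    by rewrite mulrA ler_wpM2l.
  move=> h; rewrite [leRHS](_ : _ = c ^+ k * `|z| * (k`!%:R)^-1 * `|s| ^+ k); last first.
    by rewrite /GRing.scale /= /GRing.scale /= /exp_coeff /= exprMn; ring.
  by rewrite !ler_wpM2r ?invr_ge0 ?exprn_ge0.
apply: is_cvg_seriesZ; exact: is_cvg_series_exp_coeff.
Qed.

Lemma is_derive_expmx (K : realType) r (A : 'M[K]_r) (z : 'cV[K]_r) (s : K) :
  is_derive s 1 (expmx A z) (expmx A (A *m z) s).
Proof.
apply: is_derive_mx => i j; rewrite mxE.
under eq_fun do rewrite mxE.
rewrite -expmx_coef_diffs.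
apply: (@pseries_snd_diffs _ _ (`|s| + 1)).
- exact: is_cvg_expmx.
- by rewrite expmx_coef_diffs; exact: is_cvg_expmx.
- by rewrite !expmx_coef_diffs; exact: is_cvg_expmx.
- by rewrite [`|_ + 1|]ger0_norm ?addr_ge0// ltrDl.
Qed.

Lemma expmx0 (K : realType) r (A : 'M[K]_r) (z : 'cV[K]_r) : expmx A z 0 = z.
Proof.
apply/matrixP => i j; rewrite mxE (ord1 j).
apply/cvg_lim => //; apply/cvgrPdist_le => e e0; near=> n.
rewrite /pseries /series /=.
have n0 : (0 < n)%N by near: n; exact: nbhs_infty_gt.
rewrite big_ltn// big1_seq => [|k]; last first.
  by rewrite mem_index_iota => /andP[_ /andP[k0 _]]; rewrite expr0n gtn_eqF// mulr0.
by rewrite expr0 /expmx_coef /= fact0 invr1 !mulr1 addr0 subrr normr0 ltW.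
Unshelve. all: by end_near.
Qed.

Lemma expmx_mulmx (K : realType) r (A : 'M[K]_r) (z : 'cV[K]_r) (s : K) :
  expmx A (A *m z) s = A *m expmx A z s.
Proof.
apply/matrixP => i j; rewrite !mxE; apply/cvg_lim => //.
have -> : pseries (expmx_coef A (A *m z) i) s =
   fun n => \sum_k A i k * pseries (expmx_coef A z k) s n.
  apply/funext => n; rewrite /pseries /series /=.
  under [RHS]eq_bigr do rewrite mulr_sumr.
  rewrite exchange_big /=; apply: eq_bigr => l _.
  rewrite /expmx_coef -iterSr iterS mxE !mulr_suml.
  by apply: eq_bigr => k _; ring.
elim: (index_enum _) => [|k l IH].
  rewrite big_nil (_ : (fun n => _) = cst 0); first exact: cvg_cst.
  by apply/funext => n; rewrite big_nil.
rewrite big_cons (_ : (fun n => _) = fun n => A i k * pseries (expmx_coef A z k) s n +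
    \sum_(k <- l) A i k * pseries (expmx_coef A z k) s n).
  apply: cvgD => //; apply: cvgMl_tmp; rewrite mxE; exact: is_cvg_expmx.
by apply/funext => n; rewrite big_cons.
Qed.

(** Transposing, z^T A^k N = 0 for all k, so z^T annihilates the Kalman matrix, whose rows are
    independent. *)
Lemma full_kalman_rank_eq0 (K : realType) r (A N : 'M[K]_r) (z : 'cV[K]_r) : N^T = N ->
  \rank (\mxrow_(j < r) (A ^+ j *m N)) = r ->
  (forall k, N *m iter k (mulmx A^T) z = 0) -> z = 0.
Proof.
move=> sN rk H; have free : row_free (\mxrow_(j < r) (A ^+ j *m N)) by apply/eqP.
apply: trmx_inj; rewrite trmx0; apply: (row_free_inj free); rewrite mul0mx mul_mxrow.
rewrite -[RHS]mxrow0; apply: eq_mxrow => j.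
have E k : (A ^+ k)^T *m z = iter k (mulmx A^T) z.
  elim: k => [|k IH]; first by rewrite expr0 trmx1 mul1mx.
  by rewrite exprSr [(_ * _)^T]trmx_mul -mulmxA IH.
by rewrite -[LHS]trmxK trmx_mul trmxK [(_ *m N)^T]trmx_mul sN -mulmxA E H trmx0.
Qed.

(** Cauchy-Schwarz for P between P x and x bounds |P x|^2 by a multiple of x^T P x. It supplies the
    differential inequality q' >= - c q for q = x^T P x. *)
Lemma psdmx_mulmx_bound (K : realType) r (S P : 'M[K]_r) (x : 'cV[K]_r) : psdmx P ->
  qform S (P *m x) <= r%:R * `|S| * (r%:R * `|P|) * qform P x.
Proof.
move=> pP; have [_ P0] := pP.
apply: le_trans (ler_norm _) _; apply: le_trans (qform_dot _ _) _.
rewrite -[leRHS]mulrA ler_wpM2l ?mulr_ge0//.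
have [->|x0] := eqVneq (dot (P *m x) (P *m x)) 0; first by rewrite !mulr_ge0.
have xp : 0 < dot (P *m x) (P *m x) by rewrite lt_neqAle eq_sym x0 dot_ge0.
rewrite -(ler_pM2l xp) -expr2.
apply: le_trans (psdmx_Cauchy (P *m x) x pP) _.
rewrite mulrA ler_wpM2r// mulrC; apply: le_trans (ler_norm _) _; exact: qform_dot.
Qed.

Lemma is_derive_qform (K : realType) r (P : K -> 'M[K]_r) (x : K -> 'cV[K]_r) (s : K)
    (DP : 'M[K]_r) (Dx : 'cV[K]_r) :
  is_derive s 1 P DP -> is_derive s 1 x Dx ->
  is_derive s 1 (fun s => qform (P s) (x s))
    (qform DP (x s) + dot Dx (P s *m x s) + dot (x s) (P s *m Dx)).
Proof.
move=> dP dx.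
have := is_derive_entry 0 0
  (is_derive_mulmx (is_derive_mulmx (is_derive_trmx dx) dP) dx).
move=> H; apply: (is_derive_eq H).
by rewrite mulmxDl mxE [X in X + _]mxE /qform /dot !mulmxA [X in X + _]addrC.
Qed.

Lemma cvg_telescope (K : realType) (p : nat -> nat -> K) (t : K) : 0 <= t ->
  (forall e, 0 < e -> \forall n \near \oo, forall i, (i <= n)%N ->
    `|p n i.+1 - p n i| <= mesh t n * e) ->
  p n n.+1 - p n 0%N @[n --> \oo] --> (0 : K).
Proof.
move=> t0 H; apply/cvgr0Pnorm_le => e e0.
have t1 : 0 < t + 1 by rewrite ltr_wpDl.
have e1 : 0 < e / (t + 1) by rewrite divr_gt0.
have := H _ e1; apply: filterS => n Hn.
have -> : p n n.+1 - p n 0%N = \sum_(i < n.+1) (p n i.+1 - p n i).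
  by rewrite -(big_mkord xpredT (fun i => p n i.+1 - p n i)) telescope_sumr.
apply: le_trans (ler_norm_sum _ _ _) _.
apply: (@le_trans _ _ (\sum_(i < n.+1) mesh t n * (e / (t + 1)))).
  by apply: ler_sum => i _; apply: Hn; rewrite -ltnS.
rewrite sumr_const card_ord -[_ *+ n.+1]mulr_natl mulrA mesh_mul mulrCA.
by rewrite ler_piMr ?(ltW e0)// ler_pdivrMr// mul1r lerDl.
Qed.

(* Adjoint Euler scheme of y' = G y + y G^T + R, run backwards from time t. *)
Fixpoint backward (K : realType) r (M : nat -> 'M[K]_r) (u : 'cV[K]_r) (i : nat) : 'cV[K]_r :=
  if i is i'.+1 then (M i')^T *m backward M u i' else u.

Lemma backward_cst (K : realType) r (M : 'M[K]_r) (u : 'cV[K]_r) (i : nat) :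
  backward (fun=> M) u i = iter i (mulmx M^T) u.
Proof. by elim: i => //= i ->. Qed.

Section backward_euler.
Context (K : realType) (r : nat) (G : K -> 'M[K]_r) (u : 'cV[K]_r) (t c : K).
Hypotheses (t0 : 0 <= t) (c0 : 0 <= c) (Gc : forall s, 0 <= s <= t -> `|G s| <= c).

(** Step [i] uses [G] at the left end of the i-th grid interval counted from time t; after n + 1
    steps the recursion reaches time 0. *)
Let U n := backward (fun i => 1%:M + mesh t n *: G ((n - i)%:R * mesh t n)) u.

Lemma backward_bounded n i : (i <= n.+1)%N -> `|U n i| <= expR (r%:R * c * t) * `|u|.
Proof.
move=> iN; have h0 := mesh_ge0 n t0; set h := mesh t n in h0 *.
have ch : 0 <= r%:R * c * h by rewrite !mulr_ge0.
have : `|U n i| <= (1 + r%:R * c * h) ^+ i * `|u|.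
  elim: i iN => [|i IH] iN; first by rewrite expr0 mul1r.
  have := IH (ltnW iN) => {}IH.
  rewrite /U /= -/(U n i) -/h linearD /= trmx1 linearZ /= mulmxDl mul1mx -scalemxAl exprS.
  apply: le_trans (ler_normD _ _) _; rewrite -[leRHS]mulrA mulrDl mul1r; apply: lerD => //.
  rewrite normrZ (ger0_norm h0).
  have g : `|(G ((n - i)%:R * h))^T| <= c.
    rewrite trmx_norm; apply: Gc; apply: mesh_le => //; exact: leq_trans (leq_subr _ _) _.
  have : `|(G ((n - i)%:R * h))^T *m U n i| <= r%:R * (c * ((1 + r%:R * c * h) ^+ i * `|u|)).
    by apply: le_trans (mulmx_norm _ _) _; rewrite ler_wpM2l// ler_pM.
  by move=> /(ler_wpM2l h0); lra.
move=> H; apply: le_trans H _; rewrite ler_wpM2r//.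
by apply: expr1D_le_expR; rewrite ?mulr_ge0//; have /andP[] := mesh_le t0 iN.
Qed.

Let step n i : (i <= n)%N ->
  (n.+1 - i)%:R * mesh t n = (n - i)%:R * mesh t n + mesh t n.
Proof. by move=> ni; rewrite subSn// -natr1 mulrDl mul1r. Qed.

Let step_le n i : (i <= n)%N -> (n - i)%:R * mesh t n + mesh t n <= t.
Proof.
move=> ni; rewrite -step//.
by have /andP[_] := mesh_le t0 (leq_subr i n.+1).
Qed.

(** Duality: the pairing of the backward vector with the forward solution changes by o(h) at each
    step, so its values at times 0 and t agree in the limit. *)
Lemma cvg_backward_dot (m : K -> 'cV[K]_r) :
  consistent t m (fun s => G s *m m s) ->
  dot (U n n.+1) (m 0) @[n --> \oo] --> dot u (m t).
Proof.
move=> cons.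
pose p n i := dot (U n i) (m ((n.+1 - i)%:R * mesh t n)).
suff : p n n.+1 - p n 0%N @[n --> \oo] --> (0 : K).
  rewrite /p => H; apply/subr_cvg0; move: H.
  rewrite (_ : (fun n => _) = (fun n => dot (U n n.+1) (m 0) - dot u (m t))) //.
  by apply/funext => n /=; rewrite subnn mul0r subn0 mesh_mul.
apply: (@cvg_telescope _ p t t0) => e e0.
pose Cu := expR (r%:R * c * t) * `|u|; have Cu0 : 0 <= Cu by rewrite mulr_ge0 ?expR_ge0.
pose b := r%:R * Cu + 1; have b0 : 0 < b by rewrite ltr_wpDl// mulr_ge0.
have [d d0 Hd] := cons (e / b) (divr_gt0 e0 b0).
have := cvg_mesh_lt t0 d0; apply: filterS => n nd i ni.
have h0 := mesh_ge0 n t0; have := step ni; have := step_le ni.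
rewrite /p subSS; set h := mesh t n in h0 nd *; set s := (n - i)%:R * h => sht ->.
have s0 : 0 <= s by rewrite mulr_ge0.
have -> : dot (U n i.+1) (m s) - dot (U n i) (m (s + h)) =
    - dot (U n i) (m (s + h) - m s - h *: (G s *m m s)).
  rewrite {1}/U /= -/(U n i) -dot_mulmx mulmxDl mul1mx -scalemxAl !dotBr dotDr.
  by ring.
rewrite normrN; apply: le_trans (dot_norm _ _) _.
apply: (@le_trans _ _ (r%:R * (Cu * (h * (e / b))))).
  rewrite ler_wpM2l//; apply: ler_pM => //; last exact: Hd.
  exact: backward_bounded (leqW ni).
have -> : r%:R * (Cu * (h * (e / b))) = h * (e * (r%:R * Cu / b)) by ring.
by rewrite ler_wpM2l// ler_piMr ?(ltW e0)// ler_pdivrMr// mul1r lerDl.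
Qed.

(** The same duality for quadratic forms, the source term [R] being accumulated along the way. *)
Lemma cvg_backward_qform (y : K -> 'M[K]_r) (R : 'M[K]_r) (cy : K) : 0 <= cy ->
  (forall s, 0 <= s <= t -> `|y s| <= cy) ->
  consistent t y (fun s => G s *m y s + y s *m (G s)^T + R) ->
  \sum_(i < n.+1) (mesh t n * qform R (U n i)) + qform (y 0) (U n n.+1) @[n --> \oo] -->
  qform (y t) u.
Proof.
move=> cy0 yB cons.
pose p n i := \sum_(j < i) (mesh t n * qform R (U n j)) +
  qform (y ((n.+1 - i)%:R * mesh t n)) (U n i).
suff : p n n.+1 - p n 0%N @[n --> \oo] --> (0 : K).
  rewrite /p => H; apply/subr_cvg0; move: H.
  rewrite (_ : (fun n => _) = (fun n => \sum_(i < n.+1) (mesh t n * qform R (U n i)) +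
    qform (y 0) (U n n.+1) - qform (y t) u)) //.
  by apply/funext => n /=; rewrite subnn mul0r subn0 mesh_mul big_ord0 add0r.
apply: (@cvg_telescope _ p t t0) => e e0.
pose Cu := expR (r%:R * c * t) * `|u|; have Cu0 : 0 <= Cu by rewrite mulr_ge0 ?expR_ge0.
pose b := r%:R ^+ 2 * Cu ^+ 2 * 2 + 1.
have b0 : 0 < b by rewrite ltr_wpDl// !mulr_ge0 ?exprn_ge0.
(* Bound for G y G^T, the second-order term in (1 + h G) y (1 + h G)^T. *)
pose k := r%:R * r%:R * c * cy * c + 1.
have k0 : 0 < k by rewrite ltr_wpDl// !mulr_ge0.
have [d d0 Hd] := cons (e / b) (divr_gt0 e0 b0).
have m0 : 0 < Num.min d (e / b / k) by rewrite lt_min d0 !divr_gt0.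
have := cvg_mesh_lt t0 m0; apply: filterS => n; rewrite le_min => /andP[nd nk] i ni.
have h0 := mesh_ge0 n t0; have := step ni; have := step_le ni.
rewrite /p subSS; set h := mesh t n in h0 nd nk *; set s := (n - i)%:R * h => sht ->.
have s0 : 0 <= s by rewrite mulr_ge0.
have st : 0 <= s <= t by rewrite s0 (le_trans _ sht)// lerDl.
rewrite big_ord_recr /=.
set E := y (s + h) - y s - h *: (G s *m y s + y s *m (G s)^T + R).
have -> : \sum_(j < i) (h * qform R (U n j)) + h * qform R (U n i) + qform (y s) (U n i.+1) -
    (\sum_(j < i) (h * qform R (U n j)) + qform (y (s + h)) (U n i)) =
    - qform (E - h ^+ 2 *: (G s *m y s *m (G s)^T)) (U n i).
  rewrite {3}/U /= -/(U n i) -/h -/s -qform_congr.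
  have -> : (1%:M + h *: G s) *m y s *m (1%:M + h *: G s)^T =
      y s + h *: (G s *m y s + y s *m (G s)^T) + h ^+ 2 *: (G s *m y s *m (G s)^T).
    rewrite linearD /= trmx1 linearZ /= !mulmxDl !mul1mx !mulmxDr !mulmx1 -!scalemxAl -!scalemxAr.
    rewrite scalerA -expr2 scalerDr.
    set X1 := y s *m _; set X2 := G s *m y s; set X3 := X2 *m _; clearbody X1 X2 X3.
    by apply/matrixP => i0 j0; rewrite !mxE; ring.
  by rewrite /E !qformBl !qformZl !qformDl !qformZl !qformDl; ring.
rewrite normrN; apply: le_trans (qform_norm _ _) _.
have EB : `|E - h ^+ 2 *: (G s *m y s *m (G s)^T)| <= h * (2 * (e / b)).
  apply: le_trans (ler_normB _ _) _.
  have -> : h * (2 * (e / b)) = h * (e / b) + h * (e / b) by ring.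
  apply: lerD; first exact: Hd.
  rewrite normrZ ger0_norm ?exprn_ge0// expr2 -mulrA ler_wpM2l//.
  apply: (@le_trans _ _ (h * k)); last by rewrite -ler_pdivlMr.
  rewrite ler_wpM2l//; apply: (@le_trans _ _ (r%:R * r%:R * c * cy * c)); last by rewrite lerDl.
  apply: le_trans (mulmx_norm _ _) _; rewrite trmx_norm.
  apply: (@le_trans _ _ (r%:R * (r%:R * (`|G s| * `|y s|) * `|G s|))).
    by rewrite ler_wpM2l// ler_wpM2r// mulmx_norm.
  rewrite -!mulrA ler_wpM2l// ler_wpM2l// ; apply: ler_pM => //; rewrite ?mulr_ge0 ?Gc//.
  by apply: ler_pM; rewrite ?Gc ?yB.
apply: (@le_trans _ _ (r%:R ^+ 2 * (h * (2 * (e / b))) * Cu ^+ 2)).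
  apply: ler_pM; rewrite ?mulr_ge0 ?exprn_ge0//; first by rewrite ler_wpM2l ?exprn_ge0.
  by rewrite lerXn2r ?nnegrE//; apply: backward_bounded (leqW ni).
have -> : r%:R ^+ 2 * (h * (2 * (e / b))) * Cu ^+ 2 = h * (e * (r%:R ^+ 2 * Cu ^+ 2 * 2 / b)) by ring.
by rewrite ler_wpM2l// ler_piMr ?(ltW e0)// ler_pdivrMr// mul1r lerDl.
Qed.
End backward_euler.

(** * The Riccati flow: symmetry, positivity, invertibility and its tilt *)

Section riccati_flow.
Context (K : realType) (r : nat) (A R S : 'M[K]_r) (P0 : 'M[K]_r) (P : K -> 'M[K]_r).
Hypotheses (pR : psdmx R) (pS : psdmx S) (pP0 : psdmx P0).
Hypothesis hP : solves_ode (fun _ p => A *m p + p *m A^T + R - p *m S *m p) P0 P.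

Let F s := A *m P s + P s *m A^T + R - P s *m S *m P s.

Lemma riccati_primitive : primitive P F.
Proof.
have [P00 cP dP] := hP; split => // s.
apply: cvgB; last first.
  by apply: cvg_mulmx; [apply: cvg_mulmx; [exact: cP|exact: cvg_cst]|exact: cP].
apply: cvgD; last exact: cvg_cst.
by apply: cvgD; apply: cvg_mulmx; [exact: cvg_cst|exact: cP|exact: cP|exact: cvg_cst].
Qed.

(** D = P - P^T satisfies the linear equation D' = A D + D A^T - (D S P + P^T S D) and starts from
    0. *)
Lemma riccati_sym s : 0 <= s -> (P s)^T = P s.
Proof.
move=> s0; have [P00 cP dP] := hP; have [sP0 _] := pP0.
have pp := riccati_primitive.
have [C C0 PB] := continuous_bounded_itv s cP.
have cons : consistent s (fun u => P u - (P u)^T) (fun u => F u - (F u)^T).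
  by apply: primitive_consistent; apply: primitiveB => //; exact: primitive_trmx.
pose c := r%:R * (2 * `|A| + r%:R * `|S| * C * 2).
have c0 : 0 <= c by rewrite mulr_ge0// addr_ge0 ?mulr_ge0.
apply/esym/eqP; rewrite -subr_eq0; apply/eqP.
apply: (consistent_eq0 s0 c0 cons).
  move=> u us; set D := P u - (P u)^T.
  have -> : F u - (F u)^T = A *m D + D *m A^T - (D *m S *m P u + (P u)^T *m S *m D).
    have [sR _] := pR; have [sS _] := pS.
    have -> : (F u)^T = (P u)^T *m A^T + A *m (P u)^T + R - (P u)^T *m S *m (P u)^T.
      rewrite /F linearB !linearD /= !trmx_mul trmxK sR sS mulmxA.
      by rewrite [(_ *m _) + (_ *m _)]addrC.
    rewrite /F /D !mulmxBl !mulmxBr ?mulmxA.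
    set X1 := A *m P u; set X2 := A *m (P u)^T; set X3 := P u *m A^T; set X4 := (P u)^T *m A^T.
    set X5 := P u *m S *m P u; set X6 := (P u)^T *m S *m (P u)^T.
    set X7 := (P u)^T *m S *m P u.
    (* Matrix monomials are made opaque, so that the noncommutative identity becomes linear and is
       checked entry by entry. *)
    by clearbody X1 X2 X3 X4 X5 X6 X7; apply/matrixP => i j; rewrite !mxE; ring.
  have B3 (X Y Z : 'M[K]_r) x y z : `|X| <= x -> `|Y| <= y -> `|Z| <= z ->
      `|X *m Y *m Z| <= r%:R * r%:R * x * y * z.
    move=> Xx Yy Zz; apply: le_trans (mulmx_norm _ _) _.
    have -> : r%:R * r%:R * x * y * z = r%:R * (r%:R * (x * y) * z) by ring.
    rewrite ler_wpM2l//; apply: ler_pM => //; apply: le_trans (mulmx_norm _ _) _.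
    by rewrite ler_wpM2l// ler_pM.
  have D1 := mulmx_norm A D; have D2 := mulmx_norm D A^T.
  have D3 := B3 _ _ _ _ _ _ (lexx `|D|) (lexx `|S|) (PB u us).
  have PBt : `|(P u)^T| <= C by rewrite trmx_norm PB.
  have D4 := B3 _ _ _ _ _ _ PBt (lexx `|S|) (lexx `|D|).
  rewrite trmx_norm in D2.
  apply: le_trans (ler_normB _ _) _; apply: le_trans (lerD (ler_normD _ _) (ler_normD _ _)) _.
  by rewrite /c; lra.
by rewrite P00 sP0 subrr.
Qed.

(* The Riccati equation reads P' = G P + P G^T + R with G = A - P S / 2, so that
   u^T P_t u is a limit of sums of values of positive semi-definite forms. *)
Lemma riccati_psd s : 0 <= s -> psdmx (P s).
Proof.
move=> s0; split => [|u]; first exact: riccati_sym.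
have [P00 cP dP] := hP.
have [C C0 PB] := continuous_bounded_itv s cP.
pose G v := A - 2^-1 *: (P v *m S).
pose c := `|A| + 2^-1 * (r%:R * (C * `|S|)).
have c0 : 0 <= c by rewrite addr_ge0// !mulr_ge0.
have Gc v : 0 <= v <= s -> `|G v| <= c.
  move=> vs; apply: le_trans (ler_normB _ _) _; rewrite lerD2l normrZ ger0_norm// ler_wpM2l//.
  by apply: le_trans (mulmx_norm _ _) _; rewrite ler_wpM2l// ler_wpM2r// PB.
have cons : consistent s P (fun v => G v *m P v + P v *m (G v)^T + R).
  move=> e e0; have [d d0 H] := primitive_consistent s riccati_primitive e0.
  exists d => // v h v0 h0 hd vhs; have := H v h v0 h0 hd vhs.
  congr (`|_ - _ *: _| <= _); have [sS _] := pS.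
  have -> : (G v)^T = A^T - 2^-1 *: (S *m P v).
    by rewrite /G linearB linearZ /= trmx_mul sS riccati_sym.
  rewrite /F /G !mulmxBl !mulmxBr.
  rewrite -scalemxAl -scalemxAr !mulmxA.
  set X1 := A *m P v; set X2 := P v *m A^T; set X3 := _ *m S *m _; clearbody X1 X2 X3.
  by apply/matrixP => i j; rewrite !mxE; field.
have lim := cvg_backward_qform s0 c0 Gc C0 PB cons.
apply: (cvgr_to_ge (lim u)); near=> n.
rewrite addr_ge0//; last by rewrite P00; exact: pP0.2.
by apply: sumr_ge0 => i _; rewrite mulr_ge0 ?mesh_ge0//; exact: pR.2.
Unshelve. all: by end_near.
Qed.

(* If P_t z = 0 and x(s) = exp((t - s) A^T) z, then q = x^T P x is nonnegative,
   vanishes at t and satisfies q' >= - c q, so it vanishes on ]0, t]; then so does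
   q' = |N x|^2, hence all N (A^T)^k z are 0 and the rank condition gives z = 0. *)
Lemma riccati_unit t : 0 < t -> full_kalman_rank A R -> P t \in unitmx.
Proof.
move=> t0 [N [[sN _] NN] rk]; apply: unitmx_ker0 => z Pz.
have [P00 cP dP] := hP.
have [C C0 PB] := continuous_bounded_itv t cP.
pose x s := expmx A^T z (t - s).
have dx (s : K) : is_derive s 1 x (- (A^T *m x s)).
  rewrite /x -expmx_mulmx; apply: is_derive_mx => i j.
  have H := is_derive_entry i j (is_derive_expmx A^T z (t - s)).
  have h : is_derive s 1 (fun v => t - v) (- 1) by apply: is_derive_eq; ring.
  have H2 : is_derive s 1 (fun v => expmx A^T z (t - v) i j) _ :=
    @is_derive1_comp K (fun v => expmx A^T z v i j) (fun v => t - v) s _ _ H h.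
  by apply: (is_derive_eq H2); rewrite mulrN1 [RHS]mxE.
pose q s := qform (P s) (x s).
have q0 s : 0 <= s -> 0 <= q s by move=> s0; apply: (riccati_psd s0).2.
have dq (s : K) : 0 < s -> is_derive s 1 q (qform R (x s) - qform S (P s *m x s)).
  move=> s0; apply: (is_derive_eq (is_derive_qform (dP s s0) (dx s))).
  have sP := riccati_sym (ltW s0).
  have e1 : qform (A *m P s) (x s) = dot (A^T *m x s) (P s *m x s).
    by rewrite qformE -mulmxA dot_mulmx.
  have e2 : qform (P s *m A^T) (x s) = dot (x s) (P s *m (A^T *m x s)).
    by rewrite qformE -mulmxA.
  have e3 : qform (P s *m S *m P s) (x s) = qform S (P s *m x s).
    by rewrite !qformE -!mulmxA dot_mulmx sP.
  by rewrite qformBl !qformDl e1 e2 e3 dotNl mulmxN dotNr; ring.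
pose c := r%:R * `|S| * (r%:R * C).
have qE s : 0 < s -> s <= t -> q s = 0.
  move=> s0 st; have qt : q t = 0.
    by rewrite /q /x subrr expmx0 qformE Pz dot0r.
  apply/eqP; rewrite eq_le q0 ?(ltW s0)// andbT.
  (* Integrating factor: g is nondecreasing with g(t) = 0, while q >= 0, so q vanishes before t. *)
  pose g v := expR (c * v) * q v.
  pose g' v := expR (c * v) * (c * q v + (qform R (x v) - qform S (P v *m x v))).
  have dg (v : K) : 0 < v -> is_derive v 1 g (g' v).
    move=> v0; have := dq v v0 => dqv; apply: is_derive_eq.
    by rewrite /g' /GRing.scale /=; ring.
  have [xi] : exists2 xi, xi \in `[s, t]%R & g t - g s = g' xi * (t - s).
    apply: MVT_segment => // [v|].
      by rewrite in_itv /= => /andP[sv _]; apply: dg; exact: lt_trans sv.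
    apply: derivable_within_continuous => v; rewrite in_itv /= => /andP[sv _].
    by have [] := dg v (lt_le_trans s0 sv).
  rewrite in_itv /= => /andP[sx xt]; have x0 := lt_le_trans s0 sx.
  have g0 : 0 <= g' xi.
    rewrite mulr_ge0 ?expR_ge0// addrCA addr_ge0 ?pR.2// subr_ge0.
    apply: le_trans (psdmx_mulmx_bound S (x xi) (riccati_psd (ltW x0))) _.
    apply: ler_wpM2r; first by apply: q0; exact: ltW.
    apply: ler_wpM2l; first by rewrite mulr_ge0.
    by apply: ler_wpM2l => //; apply: PB; rewrite ltW.
  rewrite /g qt mulr0 sub0r => gE.
  have : 0 <= - (expR (c * s) * q s) by rewrite gE mulr_ge0// subr_ge0.
  by rewrite oppr_ge0 pmulr_rle0 ?expR_gt0.
have Px s : 0 < s -> s <= t -> P s *m x s = 0.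
  by move=> s0 st; apply: psdmx_qform0 (riccati_psd (ltW s0)) (qE s s0 st).
have near_itv (s : K) : 0 < s < t -> \forall v \near s, 0 < v < t.
  move=> /andP[s0 st]; near=> v; apply/andP; split; near: v.
    exact: lt_nbhsr.
  exact: lt_nbhsl.
have Nx s : 0 < s < t -> N *m x s = 0.
  move=> st; have /andP[s0 st'] := st.
  have q_near : \forall v \near s, q v = 0.
    by have := near_itv s st; apply: filterS => v /andP[v0 vt]; rewrite qE// ltW.
  have := is_derive_near0 q_near (dq s s0).
  rewrite Px ?ltW// [qform S 0]qformE dot0l subr0 => R0.
  by apply: dot_eq0; rewrite dot_mulmx sN mulmxA NN dotC -qformE.
have Nk k s : 0 < s < t -> N *m expmx A^T (iter k (mulmx A^T) z) s = 0.
  elim: k s => [|k IH] s st.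
    have := Nx (t - s); rewrite /x subKr; apply.
    by have /andP[s0 st'] := st; rewrite subr_gt0 st' gtrBl.
  have N0 : \forall v \near s, N *m expmx A^T (iter k (mulmx A^T) z) v = 0.
    by have := near_itv s st; apply: filterS => v /IH.
  have := is_derive_near0 N0 (is_derive_mulmx (is_derive_cst N s 1) (is_derive_expmx _ _ s)).
  by rewrite mul0mx add0r.
have Nk0 k : N *m iter k (mulmx A^T) z = 0.
  rewrite -[X in _ *m X](expmx0 A^T).
  set w := iter k _ z.
  (* The vanishing is known inside ]0, t[ only; the value at 0 follows by continuity from the
     right. *)
  have cw : N *m expmx A^T w s @[s --> 0^'+] --> N *m expmx A^T w 0.
    apply: cvg_at_right_filter; apply: cvg_mulmx; first exact: cvg_cst.
    have c0 : {for 0, continuous (expmx A^T w)}.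
      apply: differentiable_continuous; apply/derivable1_diffP.
      by have [] := is_derive_expmx A^T w 0.
    exact: c0.
  have c0 : N *m expmx A^T w s @[s --> (0 : K)^'+] --> (0 : 'cV[K]_r).
    apply: cvg_near_cst; near=> s.
    by rewrite Nk//; apply/andP; split => //; near: s; exact: nbhs_right_lt.
  by rewrite -(cvg_lim (@norm_hausdorff _ _) cw) (cvg_lim (@norm_hausdorff _ _) c0).
exact: (full_kalman_rank_eq0 sN rk Nk0).
Unshelve. all: by end_near.
Qed.

Section tilted_flow.
Variables (Q : 'M[K]_r) (m : K -> 'cV[K]_r) (m0 : 'cV[K]_r).
Hypotheses (pQ : psdmx Q) (ric : riccati_eq A R S Q).
Hypothesis hm : solves_ode (fun t x => (A - P t *m S) *m x) m0 m.

Let L s := tiltmx (P s) Q.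
Let M := A - R *m Q.

Let unit_tilt s : 0 <= s -> 1%:M + P s *m Q \in unitmx.
Proof. by move=> s0; apply: unitmx_1DPQ => //; exact: riccati_psd. Qed.

Let primitive_tilt : primitive L (fun s => - (L s *m (F s *m Q) *m L s)).
Proof.
have : primitive (fun s => 1%:M + P s *m Q) (fun s => F s *m Q).
  rewrite (_ : (fun s => F s *m Q) = fun s => 0 + (F s *m Q + P s *m 0)).
    apply: primitiveD; first exact: primitive_cst.
    by apply: primitive_mulmx; [exact: riccati_primitive|exact: primitive_cst].
  by apply/funext => s; rewrite mulmx0 addr0 add0r.
exact: (primitive_invmx unit_tilt).
Qed.

Lemma primitive_tilt_cov : primitive (fun s => L s *m P s)
  (fun s => - (L s *m (F s *m Q) *m L s) *m P s + L s *m F s).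
Proof. by apply: primitive_mulmx; [exact: primitive_tilt|exact: riccati_primitive]. Qed.

Lemma primitive_tilt_mean : primitive (fun s => L s *m m s)
  (fun s => - (L s *m (F s *m Q) *m L s) *m m s + L s *m ((A - P s *m S) *m m s)).
Proof.
have [_ cm dm] := hm; have [_ cP _] := hP; apply: primitive_mulmx; first exact: primitive_tilt.
split => //; apply: continuous_mulmx_fun => // s.
by apply: cvgB; [exact: cvg_cst|apply: cvg_mulmx; [exact: cP|exact: cvg_cst]].
Qed.

(** The Riccati equation factored through the drift M = A - R Q; it serves to eliminate S. *)
Let ricE : A^T *m Q + S = - (Q *m M).
Proof.
have := ric; rewrite /riccati_eq /M => e; apply/eqP; rewrite -subr_eq0 opprK mulmxBr mulmxA.
rewrite -[X in _ == X]e; apply/eqP.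
set X1 := _ *m Q; set X2 := Q *m A; set X3 := Q *m R *m Q; clearbody X1 X2 X3.
by apply/matrixP => i j; rewrite !mxE; ring.
Qed.

Let tilt_mulmx s : 0 <= s -> L s *m (1%:M + P s *m Q) = 1%:M.
Proof. by move=> s0; rewrite mulVmx// unit_tilt. Qed.

Lemma tilt_cov_derive s : 0 <= s ->
  - (L s *m (F s *m Q) *m L s) *m P s + L s *m F s =
  M *m (L s *m P s) + (L s *m P s) *m M^T + R.
Proof.
move=> s0; have pP := riccati_psd s0; have [sP _] := pP; have [sQ _] := pQ.
have [sR _] := pR; have [sS _] := pS.
have LT : (L s)^T = 1%:M - Q *m L s *m P s by exact: tiltmx_tr.
have LE : L s = 1%:M - L s *m P s *m Q.
  by have := tilt_mulmx s0; rewrite mulmxDr mulmx1 mulmxA => <-; rewrite addrK.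
have LPT : P s *m (L s)^T = L s *m P s.
  by have [] := psdmx_tilt pP pQ; rewrite -/(L s) trmx_mul sP.
(* The left-hand side is L F (1 - Q L P), and the bracket is the transpose of L by [tiltmx_tr]. *)
transitivity (L s *m F s *m (L s)^T).
  by rewrite LT; move: (F s) => Fs; rewrite mulmxBr mulmx1 mulNmx addrC !mulmxA.
rewrite /F mulmxBr mulmxBl !mulmxDr !mulmxDl.
have -> : L s *m (P s *m S *m P s) *m (L s)^T = (L s *m P s) *m S *m (L s *m P s).
  by rewrite -!mulmxA LPT.
have -> : L s *m (A *m P s) *m (L s)^T = L s *m A *m (L s *m P s).
  by rewrite -!mulmxA LPT.
rewrite (mulmxA (L s) (P s)) -(mulmxA _ A^T).
have LPs : (L s *m P s)^T = L s *m P s by have [] := psdmx_tilt pP pQ.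
set H := L s *m P s in LE LPs *.
have LTE : (L s)^T = 1%:M - Q *m H by rewrite LE linearB /= trmx1 trmx_mul sQ LPs.
(* With H = L P one has L = 1 - H Q and L^T = 1 - Q H, so that, once S is eliminated, both sides are
   polynomials in A, A^T, R, Q and H. *)
rewrite LTE LE.
have SE : S = - (Q *m M) - A^T *m Q by rewrite -ricE addrAC subrr add0r.
have MT : M^T = A^T - Q *m R by rewrite /M linearB /= trmx_mul sR sQ.
rewrite MT SE /M.
rewrite !(mulmxBl, mulmxBr, mul1mx, mulmx1, mulmxN, mulNmx, mulmxA).
set X1 := A *m H; set X2 := H *m Q *m A *m H; set X3 := H *m A^T.
set X4 := H *m A^T *m Q *m H; set X5 := R *m Q *m H; set X6 := H *m Q *m R.
set X7 := H *m Q *m R *m Q *m H.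
clearbody X1 X2 X3 X4 X5 X6 X7.
by apply/matrixP => i j; rewrite !mxE; ring.
Qed.

Lemma tilt_mean_derive s : 0 <= s ->
  - (L s *m (F s *m Q) *m L s) *m m s + L s *m ((A - P s *m S) *m m s) = M *m (L s *m m s).
Proof.
move=> s0.
have mE : m s = (1%:M + P s *m Q) *m (L s *m m s).
  by rewrite mulmxA mulmxV ?mul1mx// unit_tilt.
rewrite {2}mE; set mh := L s *m m s.
(* Inserting L (1 + P Q) = 1 lets the common left factor L be cancelled. *)
have -> : M *m mh = L s *m ((1%:M + P s *m Q) *m M *m mh).
  by rewrite !mulmxA tilt_mulmx// mul1mx.
rewrite mulNmx -!mulmxA -/mh -mulmxN -mulmxDr; congr (_ *m _).
have SE : S = - (Q *m M) - A^T *m Q by rewrite -ricE addrAC subrr add0r.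
rewrite /F !mulmxA -mulNmx -mulmxDl; congr (_ *m _).
rewrite SE.
rewrite !(mulmxBl, mulmxBr, mulmxDl, mulmxDr, mul1mx, mulmx1, mulmxN, mulNmx, mulmxA).
rewrite /M ?(mulmxBl, mulmxBr, mulmxA).
set X1 := P s *m Q *m A; set X2 := A *m P s *m Q; set X3 := P s *m A^T *m Q.
set X4 := R *m Q; set X5 := P s *m Q *m R *m Q;
set X6 := P s *m Q *m A *m P s *m Q; set X7 := P s *m Q *m R *m Q *m P s *m Q.
set X8 := P s *m A^T *m Q *m P s *m Q.
clearbody X1 X2 X3 X4 X5 X6 X7 X8.
by apply/matrixP => i j; rewrite !mxE; ring.
Qed.

Lemma tilt_cov_consistent t : consistent t (fun s => L s *m P s)
  (fun s => M *m (L s *m P s) + (L s *m P s) *m M^T + R).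
Proof.
move=> e e0; have [d d0 H] := primitive_consistent t primitive_tilt_cov e0.
by exists d => // s h s0 h0 hd st; rewrite -tilt_cov_derive// H.
Qed.

Lemma tilt_mean_consistent t : consistent t (fun s => L s *m m s)
  (fun s => M *m (L s *m m s)).
Proof.
move=> e e0; have [d d0 H] := primitive_consistent t primitive_tilt_mean e0.
by exists d => // s h s0 h0 hd st; rewrite -tilt_mean_derive// H.
Qed.

(** The formula without inverse of P covers both branches of [hcov], hence also a singular initial
    covariance. *)
Lemma hcovE s : 0 <= s -> hcov Q (P s) = L s *m P s.
Proof.
move=> s0; rewrite /hcov; case: ifPn => // U.
have -> : invmx (P s) + Q = invmx (P s) *m (1%:M + P s *m Q).
  by rewrite mulmxDr mulmx1 mulmxA mulVmx// mul1mx.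
have U1 := unit_tilt s0.
apply: (can_inj (mulKmx (_ : invmx (P s) *m (1%:M + P s *m Q) \in unitmx))).
  by rewrite unitmx_mul unitmx_inv U.
rewrite mulmxV ?unitmx_mul ?unitmx_inv ?U// -mulmxA [X in _ *m X]mulmxA mulmxV//.
by rewrite mul1mx mulVmx.
Qed.

Lemma hmeanE s x : 0 <= s -> hmean Q (P s) x = L s *m x.
Proof.
move=> s0; rewrite /hmean; case: ifPn => // U.
by rewrite hcovE// -[_ *m P s *m _]mulmxA mulmxV// mulmx1.
Qed.
End tilted_flow.
End riccati_flow.

(** The Euler chain from a Gaussian start has an explicit transform in terms of the iterated
    transposed step, which is the backward scheme with constant G = M; its limits are the mean and
    covariance at time t. *)
Lemma linear_sde_gaussian (K : realType) d (T : measurableType d) (Pr : probability T K)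
    r r1 (M : 'M[K]_r) (B : 'M[K]_(r, r1)) (W : K -> {mfun T >-> borelV K r1})
    (Z : K -> {mfun T >-> borelV K r}) (m : K -> 'cV[K]_r) (P : K -> 'M[K]_r) (t : K) :
  0 <= t -> brownian_motion Pr W -> linear_sde Pr M B W Z ->
  indep_systems Pr (sigma_rv (Z 0)) (sigma_process `[0, +oo[ W) ->
  gaussian_transform Pr (Z 0) (fun=> 1) 1 (m 0) (P 0) ->
  consistent t m (fun s => M *m m s) ->
  {within `[0, +oo[, continuous P} ->
  consistent t P (fun s => M *m P s + P s *m M^T + B *m B^T) ->
  gaussian_transform Pr (Z t) (fun=> 1) 1 (m t) (P t).
Proof.
move=> t0 hW hZ ind init cm cP consP u al; rewrite mul1r.
under eq_Rintegral do rewrite mul1r.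
have lim := @cvg_Rintegral_cos_euler K d T Pr r r1 B W hW (fun h => 1%:M + h *: M) M Z t u al
  t0 hZ (expands_linear 1%:M M).
have [C C0 PB] := continuous_bounded_itv t cP.
have Gc s : 0 <= s <= t -> `|M| <= `|M| by [].
have l1 := cvg_backward_dot t0 (normr_ge0 M) Gc cm.
have l2 := cvg_backward_qform t0 (normr_ge0 M) Gc C0 PB consP.
rewrite -(cvg_lim (@norm_hausdorff _ _) lim); apply: cvg_lim; first exact: norm_hausdorff.
have l3 : expR (- ((\sum_(i < n.+1) (mesh t n * qform (B *m B^T) (backward (fun=> 1%:M + mesh t n *: M) u i)) +
    qform (P 0) (backward (fun=> 1%:M + mesh t n *: M) u n.+1)) / 2)) *
    cos (dot (backward (fun=> 1%:M + mesh t n *: M) u n.+1) (m 0) + al) @[n --> \oo] -->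
    expR (- (qform (P t) u / 2)) * cos (dot u (m t) + al).
  apply: cvgM.
    apply: (cvg_comp _ expR); last exact: continuous_expR.
    by apply: cvgN; apply: cvgM; [exact: l2|exact: cvg_cst].
  apply: (cvg_comp _ cos); last exact: continuous_cos.
  by apply: cvgD; [exact: l1|exact: cvg_cst].
apply: (cvg_trans _ l3); apply: near_eq_cvg; near=> n.
have hn0 := mesh_ge0 n t0.
rewrite (Rintegral_cos_euler (1%:M + mesh t n *: M) B hn0 hW ind).
have := init (iter n.+1 (mulmx (1%:M + mesh t n *: M)^T) u) al.
under eq_Rintegral do rewrite mul1r.
rewrite mul1r => ->.
rewrite mulrA -expRD !backward_cst; congr (expR _ * _).
under eq_bigr do rewrite backward_cst -qformZl.
by ring.
Unshelve. all: by end_near.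
Qed.

(** * Boltzmann transforms *)

Lemma Rintegral_gt0 d (T : measurableType d) (K : realType) (P : probability T K)
    (f : T -> K) (C : K) : measurable_fun setT f -> (forall x, 0 < f x) ->
  (forall x, f x <= C) -> 0 < \int[P]_x f x.
Proof.
move=> mf f0 fC; have fC' x : `|f x| <= C by rewrite ger0_norm// ltW.
have := EFin_Rintegral P mf fC' => E.
rewrite lt_neqAle; apply/andP; split; last first.
  by apply: fine_ge0; apply: integral_ge0 => x _; rewrite lee_fin ltW.
apply/eqP => I0.
have mfE : measurable_fun setT (EFin \o f) by exact/measurable_EFinP.
have : (\int[P]_x `|(EFin \o f) x|)%E = 0.
  rewrite -[RHS]/(0%:E) I0 -E; apply: eq_integral => x _ /=.
  by rewrite ger0_norm// ltW.
move=> /(ae_eq_integral_abs _ measurableT mfE)[N [mN N0 sub]].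
have : P setT = 0%E.
  apply/eqP; rewrite eq_le measure_ge0 andbT -N0; apply: le_measure; rewrite ?inE//.
  move=> x _; apply: sub => /= H; have /(_ I)[] := H => fx.
  by have := f0 x; rewrite fx ltxx.
by rewrite probability_setT => /eqP; rewrite onee_eq0.
Qed.

(** Realises the conditional law as the law of X_t under Pr restricted to survival and renormalised,
    so that it is a genuine probability with computable integrals. *)
Lemma nonabsorbed_probability (K : realType) d (T : measurableType d) (Pr : probability T K)
    r (S : 'M[K]_r) (X : K -> {mfun T >-> borelV K r}) (xi : {RV Pr >-> measurableTypeR K})
    (t : K) (Lam := killing_rate S (fun s => X s) t) (p := \int[Pr]_w expR (- Lam w)) :
  psdmx S -> continuous_paths X -> 0 <= t -> killing_clock X xi ->
  exists N : probability (borelV K r) K,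
    law_nonabsorbed Pr X (killing_time (potential S) X xi) t = N /\
    forall (phi : 'cV[K]_r -> K) C, measurable_fun setT (phi : borelV K r -> K) ->
      (forall x, `|phi x| <= C) ->
      \int[N]_x phi x = (\int[Pr]_w (phi (X t w) * expR (- Lam w))) / p.
Proof.
move=> pS cX t0 hxi.
pose F := [set w | (t%:E < killing_time (potential S) X xi w)%E].
have mLam : measurable_fun setT Lam by exact: measurable_killing_rateT.
have mF : measurable F.
  have -> : F = [set w | Lam w < xi w] by apply/seteqP; split => w /killing_time_gt; exact.
  have := @measurable_fun_ltr _ T K setT Lam xi mLam (@measurable_funPT _ _ _ _ xi).
  by move=> /(_ measurableT [set true] I); rewrite setTI.
have kill phi C := @Rintegral_killing K d T Pr r S X xi t C phi pS cX t0 hxi.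
have mexp : measurable_fun setT (fun w => expR (- Lam w)).
  by apply: (@measurableT_comp _ _ _ _ _ _ expR) => //; exact: measurableT_comp.
have pF : Pr F = p%:E.
  have := kill (fun=> 1) 1 (measurable_cst _) _; rewrite normr1 => /(_ (fun=> lexx _)).
  under eq_Rintegral do rewrite mul1r.
  under [X in _ = X]eq_Rintegral do rewrite mul1r.
  rewrite -/F -/Lam -/p /Rintegral => <-.
  by rewrite integral_indic// setIT fineK// fin_num_measure.
have p0 : 0 < p.
  apply: (@Rintegral_gt0 _ _ _ _ _ 1) => // w; first exact: expR_gt0.
  by rewrite -[leRHS]expR0 ler_expR oppr_le0 killing_rate_ge0.
have pV : 0 <= p^-1 by rewrite invr_ge0 ltW.
pose Q := mnormalize (mrestr Pr mF) Pr.
have QE A : Q A = (Pr (A `&` F) * (p^-1)%:E)%E.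
  (* [mnormalize] falls back on [Pr] when the mass is 0 or infinite; the survival probability [p] is
     positive and finite. *)
  have -> : Q A = ((if (Pr (setT `&` F) == 0) || (Pr (setT `&` F) == +oo) then
      (Pr : set T -> \bar K) else fun U => Pr (U `&` F) * ((fine (Pr (setT `&` F)))^-1)%:E) A)%E.
    by [].
  rewrite setTI pF.
  by rewrite ifF//; apply/negbTE; rewrite negb_or eqe gt_eqF.
exists [the probability _ _ of distribution [the probability _ _ of Q] (X t)].
split.
  apply/funext => C; rewrite /law_nonabsorbed /cond_prob -/F pF inver gt_eqF//.
  rewrite /distribution /= /pushforward -/Q QE; congr (Pr _ * _)%E.
  apply/seteqP; split => w /= [+ Fw]; rewrite /killed_process.
    by rewrite Fw => -[x Cx [<-]].
  by move=> CX; split => //; rewrite Fw; exists (X t w).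
move=> phi C mphi phiC.
rewrite (@Rintegral_distribution _ _ _ _ _ _ _ _ C)//.
have mphiX : measurable_fun setT (fun w => phi (X t w)).
  exact: (measurableT_comp mphi (@measurable_funPT _ _ _ _ (X t))).
rewrite (@Rintegral_density _ _ _ Pr _ (fun w => \1_F w * p^-1) _ C)//.
- rewrite -(kill _ _ mphi phiC).
  under [LHS]eq_Rintegral do rewrite mulrA.
  rewrite -/F RintegralZr//.
  apply: (@bounded_integrable _ _ _ _ _ C); first exact: measurable_funM.
  move=> w; rewrite normrM -[leRHS]mulr1 ler_pM// indicE.
  by case: (_ \in _); rewrite ?normr1 ?normr0.
- exact: measurable_funM.
- by move=> w; exact: mulr_ge0.
- apply: (@bounded_integrable _ _ _ _ _ p^-1); first exact: measurable_funM.
  by move=> w; rewrite ger0_norm ?mulr_ge0// ler_piMl// indicE.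
- move=> A mA; apply: (etrans (QE A)).
  under [RHS]eq_integral do rewrite EFinM.
  rewrite ge0_integralZr//= ?lee_fin//.
  + by rewrite integral_indic// setIC.
  + by apply/measurable_EFinP.
Qed.

(** Uniqueness of transforms with weight h0 under [N] and the constant weight N(h0) under [P]. *)
Lemma is_boltzmann_h0 (K : realType) r (N P : probability (borelV K r) K) (Q : 'M[K]_r) :
  psdmx Q ->
  (forall u a, \int[N]_x (h0 Q x * cos (dot u x + a)) =
    (\int[N]_x h0 Q x) * \int[P]_x cos (dot u x + a)) ->
  is_boltzmann (h0 Q) N P.
Proof.
move=> pQ H.
have mh : measurable_fun setT (h0 Q : borelV K r -> K).
  exact: (measurable_h0 Q (@measurable_id _ (borelV K r) setT)).
have hB (x : 'cV[K]_r) := h0_norm_le1 x pQ.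
set z := \int[N]_x h0 Q x in H *.
have zE : (\int[N]_x (h0 Q x)%:E = z%:E)%E by exact: (EFin_Rintegral _ mh hB).
have z0 : 0 < z.
  apply: (@Rintegral_gt0 _ _ _ _ _ 1) => // x; first exact: h0_gt0.
  exact: h0_le1.
have z1 : `|z| <= 1 by apply: le_norm_Rintegral.
have mid := @measurable_id _ (borelV K r) setT.
have U := @cos_transform_unique K r _ _ _ _ N P id id (h0 Q) (cst z) 1 mid mid mh
  (measurable_cst _) hB (fun=> z1).
have {}U : forall D : set (borelV K r), measurable D ->
    \int[N]_x (h0 Q x * \1_D x) = \int[P]_x (z * \1_D x).
  apply: U => u a; rewrite H RintegralZl//.
  apply: (@bounded_integrable _ _ _ _ _ 1); first exact: measurable_cos_dot.
  by move=> x; exact: cos_norm_le1.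
split; first by rewrite zE lte_fin z0 ltry.
move=> C mC; rewrite zE inver gt_eqF// integral_mkcond.
have -> : (\int[N]_x ((fun x => (h0 Q x)%:E) \_ C) x = \int[N]_x (h0 Q x * \1_C x)%:E)%E.
  apply: eq_integral => x _; rewrite patchE indicE.
  by case: (x \in C); rewrite ?mulr1 ?mulr0.
rewrite (@EFin_Rintegral _ _ _ _ _ 1)//.
- rewrite U// RintegralZl//; last first.
    apply: (@bounded_integrable _ _ _ _ _ 1) => // x; rewrite indicE.
    by case: (_ \in _); rewrite ?normr1 ?normr0.
  rewrite -EFinM mulrAC mulfV ?gt_eqF// mul1r /Rintegral integral_indic// setIT.
  by rewrite fineK// fin_num_measure.
- exact: measurable_funM.
- move=> x; rewrite normrM -[leRHS]mulr1 ler_pM// indicE.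
  by case: (_ \in _); rewrite ?normr1 ?normr0.
Qed.

Lemma is_boltzmann_inv (K : realType) r (eta nu : probability (borelV K r) K)
    (g : 'cV[K]_r -> K) : measurable_fun setT (g : borelV K r -> K) -> (forall x, 0 < g x) ->
  is_boltzmann g eta nu -> is_boltzmann (fun x => (g x)^-1) nu eta.
Proof.
move=> mg g0 [Z0 nuE]; have H := boltzmann_inv mg g0 Z0 nuE.
have H1 := H setT measurableT; rewrite probability_setT mul1e in H1.
move: Z0 H H1; case: (\int[eta]_x (g x)%:E)%E => [z| |]; rewrite ?ltxx ?andbF//.
rewrite ltry andbT lte_fin => z0 H H1.
have zV : (z%:E^-1)%E = (z^-1)%:E by rewrite inver gt_eqF.
split; first by rewrite H1 zV lte_fin invr_gt0 z0 ltry.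
move=> C mC; rewrite H// H1 zV inver gt_eqF ?invr_gt0// invrK -muleA -EFinM mulVf ?mule1//.
by rewrite gt_eqF.
Qed.

Lemma boltzmann_Rintegral (K : realType) r (eta nu : probability (borelV K r) K)
    (Q : 'M[K]_r) (phi : 'cV[K]_r -> K) (C : K) : psdmx Q ->
  measurable_fun setT (phi : borelV K r -> K) -> (forall x, `|phi x| <= C) ->
  is_boltzmann (h0 Q) eta nu ->
  \int[eta]_x (h0 Q x * phi x) = (\int[eta]_x h0 Q x) * \int[nu]_x phi x.
Proof.
move=> pQ mphi phiC [_ nuE].
have mh : measurable_fun setT (h0 Q : borelV K r -> K).
  exact: (measurable_h0 Q (@measurable_id _ (borelV K r) setT)).
have hB (x : 'cV[K]_r) := h0_norm_le1 x pQ.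
set z := \int[eta]_x h0 Q x.
have zE : (\int[eta]_x (h0 Q x)%:E = z%:E)%E by exact: (EFin_Rintegral _ mh hB).
have z0 : 0 < z.
  apply: (@Rintegral_gt0 _ _ _ _ _ 1) => // x; first exact: h0_gt0.
  exact: h0_le1.
have zV : 0 <= z^-1 by rewrite invr_ge0 ltW.
rewrite (@Rintegral_density _ _ _ eta nu (fun x => h0 Q x * z^-1) phi C)//.
- rewrite -RintegralZl//; last first.
    apply: (@bounded_integrable _ _ _ _ _ (C * z^-1)).
      by apply: measurable_funM => //; exact: measurable_funM.
    by move=> x; rewrite normrM ler_pM// normrM (ger0_norm zV) ler_piMl.
  by apply: eq_Rintegral => x _; field; rewrite gt_eqF.
- exact: measurable_funM.
- by move=> x; apply: mulr_ge0 => //; exact: h0_ge0.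
- apply: (@bounded_integrable _ _ _ _ _ z^-1); first exact: measurable_funM.
  by move=> x; rewrite normrM (ger0_norm zV) ler_piMl.
- move=> A mA; rewrite nuE// zE inver gt_eqF//.
  under [RHS]eq_integral do rewrite EFinM.
  rewrite ge0_integralZr ?lee_fin//.
  + by apply/measurable_EFinP; exact: measurable_funTS.
  + by move=> x _; rewrite lee_fin h0_ge0.
Qed.

Lemma gaussian_transform_h0 (K : realType) r (N : probability (borelV K r) K)
    (m : 'cV[K]_r) (P Q : 'M[K]_r) : psdmx P -> psdmx Q ->
  gaussian_transform N id (fun=> 1) 1 m P ->
  gaussian_transform N id (h0 Q) (\int[N]_x h0 Q x) (tiltmx P Q *m m) (tiltmx P Q *m P).
Proof.
move=> pP pQ G; have [k _ Hk] := gaussian_transform_tilt pP pQ.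
have := Hk _ _ N id (fun=> 1) 1 1 m
  (@measurable_id _ (borelV K r) setT) (measurable_cst _) _ G.
rewrite normr1 => /(_ (fun=> lexx _)); set c := 1 * _ => H.
have {}H : gaussian_transform N id (h0 Q) c (tiltmx P Q *m m) (tiltmx P Q *m P).
  by move=> u a; rewrite -H; apply: eq_Rintegral => x _; rewrite mul1r.
(* The total mass is the transform at u = 0, a = 0, which identifies the constant of the tilt. *)
have -> : \int[N]_x h0 Q x = c; last exact: H.
transitivity (\int[N]_x (h0 Q x * cos (dot 0 x + 0))).
  by apply: eq_Rintegral => x _; rewrite dot0l addr0 cos0 mulr1.
by rewrite H dot0l addr0 cos0 qformE dot0l mul0r oppr0 expR0 !mulr1.
Qed.

Theorem theorem3p2 (K : realType) (r r1 : nat) (hr : (0 < r)%N)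
    (A R S : 'M[K]_r) (hR : psdmx R) (hS : psdmx S)
    (hrank : rank_condition A R S)
    (Q : 'M[K]_r) (hQ : posdefmx Q) (hQeq : riccati_eq A R S Q)
    (B : 'M[K]_(r, r1)) (hB : B *m B^T = R)
    (d : measure_display) (T : measurableType d) (Pr : probability T K)
    (W : K -> {mfun T >-> borelV K r1}) (hW : brownian_motion Pr W)
    (eta0 : probability (borelV K r) K)
    (X : K -> {mfun T >-> borelV K r})
    (hX : linear_sde Pr A B W X)
    (hX0 : same_measure (distribution Pr (X 0)) eta0)
    (hX0W : indep_systems Pr (sigma_rv (X 0)) (sigma_process `[0, +oo[ W))
    (xi : {RV Pr >-> measurableTypeR K}) (hxi : killing_clock X xi)
    (Xh : K -> {mfun T >-> borelV K r})
    (hXh : linear_sde Pr (A - R *m Q) B W Xh)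
    (hXh0 : is_boltzmann (h0 Q) eta0 (distribution Pr (Xh 0)))
    (hXh0W : indep_systems Pr (sigma_rv (Xh 0)) (sigma_process `[0, +oo[ W)) :
  let tau := killing_time (potential S) X xi in
  let eta := law_nonabsorbed Pr X tau in
  let etah := fun t : K => distribution Pr (Xh t) in
  (forall t : K, 0 <= t ->
     is_boltzmann (h0 Q) (eta t) (etah t) /\
     is_boltzmann (fun x => (h0 Q x)^-1) (etah t) (eta t)) /\
  (forall (m0 : 'cV[K]_r) (P0 : 'M[K]_r) (m : K -> 'cV[K]_r) (P : K -> 'M[K]_r),
     is_gaussian m0 P0 eta0 ->
     solves_ode (fun t x => (A - P t *m S) *m x) m0 m ->
     solves_ode (fun _ p => A *m p + p *m A^T + R - p *m S *m p) P0 P ->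
     (forall t : K, 0 < t -> P t \in unitmx) /\
     (forall t : K, 0 <= t ->
        is_gaussian (hmean Q (P t) (m t)) (hcov Q (P t)) (etah t) /\
        is_gaussian (m t) (P t) (eta t))).
Proof.
move=> tau eta etah.
have pQ := posdefmx_psd hQ.
have cX : continuous_paths X := hX.1.
have mh0 : measurable_fun setT (h0 Q : borelV K r -> K).
  exact: (measurable_h0 Q (@measurable_id _ (borelV K r) setT)).
have mcos u a : measurable_fun setT ((fun x => cos (dot u x + a)) : borelV K r -> K).
  exact: (measurable_cos_dot u a (@measurable_id _ (borelV K r) setT)).
have bcos u a (x : 'cV[K]_r) : `|cos (dot u x + a)| <= 1 by exact: cos_norm_le1.
have mhcos u a : measurable_fun setT ((fun x => h0 Q x * cos (dot u x + a)) : borelV K r -> K).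
  exact: measurable_funM.
have bh (x : 'cV[K]_r) := h0_norm_le1 x pQ.
have bhcos u a (x : 'cV[K]_r) : `|h0 Q x * cos (dot u x + a)| <= 1.
  by rewrite normrM -[leRHS]mulr1 ler_pM.
have etahE t u a : \int[distribution Pr (Xh t)]_x cos (dot u x + a) =
    \int[Pr]_w cos (dot u (Xh t w) + a).
  exact: (Rintegral_distribution Pr (Xh t) (mcos u a) (bcos u a)).
(* The Boltzmann relation at time 0 written on transforms, with Z0 = eta0(h0). *)
have init : exists2 Z0 : K, 0 < Z0 & forall v b,
    \int[Pr]_w (h0 Q (X 0 w) * cos (dot v (X 0 w) + b)) =
    Z0 * \int[Pr]_w cos (dot v (Xh 0 w) + b).
  exists (\int[eta0]_x h0 Q x).
    by apply: (Rintegral_gt0 _ mh0 (h0_gt0 Q)) => x; exact: h0_le1.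
  move=> v b; rewrite -etahE -(boltzmann_Rintegral pQ (mcos v b) (bcos v b) hXh0).
  rewrite -(same_measure_Rintegral _ hX0).
  by rewrite (Rintegral_distribution Pr (X 0) (mhcos v b) (bhcos v b)).
have part1 t : 0 <= t -> exists N : probability (borelV K r) K,
    [/\ eta t = N, is_boltzmann (h0 Q) N (etah t) &
       is_boltzmann (fun x => (h0 Q x)^-1) (etah t) N].
  move=> t0; have [N [NE NI]] := nonabsorbed_probability hS cX t0 hxi.
  exists N; suff bN : is_boltzmann (h0 Q) N (etah t).
    by split => //; apply: is_boltzmann_inv bN => //; exact: h0_gt0.
  have hX' : linear_sde Pr A B W X := hX.
  have hXh' := hXh; rewrite -hB in hXh'.
  apply: is_boltzmann_h0 => // u a.
  rewrite (NI _ _ mh0 bh) (NI _ _ (mhcos u a) (bhcos u a)) etahE.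
  by rewrite (h0_transform_identity hS hQ _ hW hX' hXh' hX0W hXh0W u a t0 init) ?hB// mulrAC.
split=> [t t0|m0 P0 m P G0 om oP].
  by have [N [-> ? ?]] := part1 t t0.
have pP0 : psdmx P0 := G0.1.
have pP s : 0 <= s -> psdmx (P s) by exact: (riccati_psd hR hS pP0 oP).
split=> [t t0|t t0]; first exact: (riccati_unit hR hS pP0 oP t0 hrank.1).
have P00 : P 0 = P0 by case: oP.
have m00 : m 0 = m0 by case: om.
have GX0 : gaussian_transform Pr (X 0) (fun=> 1) 1 m0 P0.
  apply: is_gaussian_transform; split => // u D mD; rewrite -(G0.2 u D mD).
  apply: hX0; rewrite -[X in measurable X]setTI.
  exact: (measurable_dot u (@measurable_id _ (borelV K r) setT)).
have Geta0 : gaussian_transform eta0 id (fun=> 1) 1 m0 P0.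
  move=> u a; rewrite -(same_measure_Rintegral _ hX0) -GX0.
  under eq_Rintegral do rewrite mul1r.
  under [RHS]eq_Rintegral do rewrite mul1r.
  exact: (Rintegral_distribution Pr (X 0) (mcos u a) (bcos u a)).
have z0 : 0 < \int[eta0]_x h0 Q x.
  by apply: (Rintegral_gt0 _ mh0 (h0_gt0 Q)) => x; exact: h0_le1.
have GXh0 : gaussian_transform Pr (Xh 0) (fun=> 1) 1 (tiltmx (P 0) Q *m m 0)
    (tiltmx (P 0) Q *m P 0).
  (* Multiplied by eta0(h0), both sides are the transform of h0 times eta0: one by the Boltzmann
     relation, the other by the Gaussian tilt. *)
  move=> u a; rewrite P00 m00; apply: (mulfI (negbT (gt_eqF z0))).
  rewrite [X in _ * X](_ : _ = \int[Pr]_w cos (dot u (Xh 0 w) + a)); last first.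
    by apply: eq_Rintegral => w _; rewrite mul1r.
  rewrite -etahE -(boltzmann_Rintegral pQ (mcos u a) (bcos u a) hXh0).
  by rewrite (gaussian_transform_h0 pP0 pQ Geta0) mul1r.
have GXh : gaussian_transform Pr (Xh t) (fun=> 1) 1 (tiltmx (P t) Q *m m t)
    (tiltmx (P t) Q *m P t).
  apply: (@linear_sde_gaussian _ _ _ Pr _ _ (A - R *m Q) B W Xh
    (fun s => tiltmx (P s) Q *m m s) (fun s => tiltmx (P s) Q *m P s) t) => //.
  - exact: (tilt_mean_consistent hR hS pP0 oP pQ hQeq om).
  - by have [] := primitive_tilt_cov hR hS pP0 oP pQ.
  - by rewrite hB; exact: (tilt_cov_consistent hR hS pP0 oP pQ hQeq).
rewrite (hcovE hR hS pP0 oP pQ t0) (hmeanE hR hS pP0 oP pQ _ t0).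
split.
  by apply: gaussian_transform_is_gaussian => //; apply: psdmx_tilt => //; exact: pP.
have [N GN] := gaussian_measure_exists (m t) (pP t t0).
have [E [-> _ [_ EE]]] := part1 t t0.
(* [N] and the law of the non-absorbed particle are both the inverse Boltzmann transform of the same
   measure, so they agree on every Borel set. *)
have [_ NE] : is_boltzmann (fun x => (h0 Q x)^-1) (etah t) N.
  apply: is_boltzmann_inv => //; first exact: h0_gt0.
  apply: is_boltzmann_h0 => // u a.
  rewrite (gaussian_transform_h0 (pP t t0) pQ GN) etahE; congr (_ * _).
  by have := GXh u a; under eq_Rintegral do rewrite mul1r; rewrite mul1r.
have [_ GN'] : is_gaussian (m t) (P t) (pushforward N (mfun_of (@measurable_id _ (borelV K r) setT))).
  exact: (gaussian_transform_is_gaussian (pP t t0)).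
split; first exact: pP.
move=> u D mD; rewrite -(GN' u D mD) /pushforward.
have mDu : measurable ((fun x : borelV K r => (u^T *m (x : 'cV[K]_r)) 0 0) @^-1` D).
  rewrite -[X in measurable X]setTI.
  exact: (measurable_dot u (@measurable_id _ (borelV K r) setT)).
by rewrite EE// -NE.
Qed.
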